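(* Let $\Omega=(a,b)\subset\mathbb{R}$ be a bounded open interval, $f\in BV(\Omega)$ and $\alpha\in C(\overline\Omega)$ with $\alpha\ge0$. Then the minimisation problem $$\min_{u\in BV(\Omega)}J(u):=\frac12\int_\Omega (f-u)^2\,dx+\int_\Omega\alpha(x)\,d|Du|$$ has a unique solution $u^\ast\in BV(\Omega)$. Moreover, if $$J_n(u):=\frac12\int_\Omega (f-u)^2\,dx+\int_\Omega\alpha_n(x)\,d|Du|,$$ where $(\alpha_n)_{n\in\mathbb{N}}\subseteq C^\infty(\overline\Omega)$ is a decreasing sequence, uniformly convergent to $\alpha$, with $\alpha_n>0$ for every $n\in\mathbb{N}$, then $$J(u^\ast)=\lim_{n\to\infty}\ \min_{u\in BV(\Omega)}J_n(u).$$
   Context: For $u\in BV(\Omega)$, $|Du|$ is the total variation measure of the distributional derivative $Du$. *)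

(* Defs.v *)
From HB Require Import structures.
From mathcomp Require Import all_boot all_order all_algebra.
From mathcomp Require Import all_classical all_reals all_analysis.

Set Implicit Arguments.
Unset Strict Implicit.
Unset Printing Implicit Defensive.
Import Order.TTheory GRing.Theory Num.Theory.
Import numFieldNormedType.Exports.
Local Open Scope ring_scope.
Local Open Scope classical_set_scope.

Section charges.
Context d (T : measurableType d) (R : realType).
Variable nu : {charge set T -> \bar R}.

(* The sets chosen in the Hahn decomposition are unique up to nu-null sets
   ([Hahn_decomposition_uniq]), so the measures below agree on measurable sets
   for any choice. *)
Definition hahn_pos : set T := sval (cid (Hahn_decomposition nu)).
Definition hahn_neg : set T := sval (cid (svalP (cid (Hahn_decomposition nu)))).
Definition hahn_posneg : hahn_decomposition nu hahn_pos hahn_neg :=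
  svalP (cid (svalP (cid (Hahn_decomposition nu)))).

Definition variation_measure : {measure set T -> \bar R} :=
  charge_variation hahn_posneg.

Definition charge_integral (D : set T) (g : T -> R) : \bar R :=
  (\int[jordan_pos hahn_posneg]_(x in D) (g x)%:E -
   \int[jordan_neg hahn_posneg]_(x in D) (g x)%:E)%E.

End charges.

Section BV.
Context (R : realType).
Variables a b : R.

Let mu := @lebesgue_measure R.
Let Omega : set R := `]a, b[%classic.
Let Omega_bar : set R := `[a, b]%classic.

(* C_c^oo(Omega), extended by zero to the whole line. *)
Definition test_function (phi : R -> R) : Prop :=
  (forall k x, derivable (phi^`(k)) x 1) /\
  exists K : set R,
    [/\ compact K, K `<=` Omega & forall x, ~ K x -> phi x = 0].

(* A signed measure on Omega is represented by a charge on the line that is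
   concentrated on Omega; charges are finite by definition. *)
Definition is_distr_derivative (u : R -> R)
    (nu : {charge set (measurableTypeR R) -> \bar R}) : Prop :=
  (forall A, measurable A -> nu A = nu (A `&` Omega)) /\
  forall phi, test_function phi ->
    (\int[mu]_(x in Omega) (u x * derive1 phi x)%:E =
     - charge_integral nu Omega phi)%E.

(* Elements of BV(Omega) are represented by functions on the line, of which only
   the restriction to Omega, up to Lebesgue-null sets, is relevant. *)
Definition BV : set (R -> R) :=
  [set u | mu.-integrable Omega (EFin \o u) /\
           exists nu, is_distr_derivative u nu].

(* Du; the value outside BV is a dummy. *)
Definition distr_derivative (u : R -> R) :
    {charge set (measurableTypeR R) -> \bar R} :=
  match pselect (exists nu, is_distr_derivative u nu) with
  | left Du => sval (cid Du)
  | right _ => czero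
  end.

Definition Dvariation (u : R -> R) :
    {measure set (measurableTypeR R) -> \bar R} :=
  variation_measure (distr_derivative u).

Definition weightedTV_functional (f alpha u : R -> R) : \bar R :=
  ((2^-1)%:E * \int[mu]_(x in Omega) ((f x - u x) ^+ 2)%:E +
   \int[Dvariation u]_(x in Omega) (alpha x)%:E)%E.

(* C^oo of the closed interval: every derivative on Omega extends continuously
   to the closure. *)
Definition smooth_on_closure (g : R -> R) : Prop :=
  {within Omega_bar, continuous g} /\
  forall k,
    (forall x, Omega x -> derivable (g^`(k)) x 1) /\
    exists h : R -> R, {within Omega_bar, continuous h} /\
                       forall x, Omega x -> g^`(k) x = h x.

End BV.

Section minimum.
Context {R : realType} {T : Type}.
Variables (S : set T) (F : T -> \bar R).

Definition minimizer (u : T) : Prop :=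
  S u /\ forall v, S v -> (F u <= F v)%E.

Definition is_minimum (m : \bar R) : Prop := exists2 u, minimizer u & F u = m.

End minimum.

(* Main.v *)
(* On an interval, [u] is BV iff [u = c + m1(]-oo, x]) - m2(]-oo, x])] a.e. for finite measures
   [m1], [m2] on the interval, and then [|Du| <= m1 + m2], with equality for the Jordan
   decomposition.  Helly's selection theorem and the lower semicontinuity of the weighted
   variation give a minimizer of [J] among the [u] with [|Du|(Omega) <= M], for every [M].

   The coercivity that is missing where [alpha] vanishes comes from the bound
   [|Du|(Omega) <= |Df|(Omega)], valid for every such constrained minimizer [u] when
   [alpha > 0].  Indeed let [h = f - u] and let [H(t)] be the integral of [h] over [[t, b[].
   Removing a part of [Du] is an admissible variation, and the first-order condition yields that
   the integral of [h] is [0], that [(Du)^+] is carried by [{H > 0}] and [(Du)^-] by [{H < 0}].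
   On each component [(p, q)] of [{H > 0}], [H] vanishes at both ends, so the limits of [h]
   give [Dh((p, q)) >= 0], i.e. [Du({H > 0}) <= Df({H > 0})], and symmetrically on [{H < 0}].

   Hence for [alpha > 0] the minimizer with [M = |Df|(Omega)] is a global one; for [alpha >= 0]
   apply this to [alpha + eta] and let [eta] tend to [0].  Uniqueness follows from the two
   variational inequalities, and the convergence of the minima from
   [J ustar <= J u_n <= J_n u_n <= J_n ustar]. *)

From HB Require Import structures.
Require Import Defs.
From mathcomp Require Import all_boot all_order all_algebra.
From mathcomp Require Import all_classical all_reals all_analysis.
From mathcomp Require Import measurable_realfun lra.
Set Implicit Arguments.
Unset Strict Implicit.
Unset Printing Implicit Defensive.
Import Order.TTheory GRing.Theory Num.Theory.
Import numFieldNormedType.Exports.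
Local Open Scope ring_scope.
Local Open Scope classical_set_scope.

(** The argument works with the pair of finite measures behind a BV function rather than with the
    function. Dropping a part of either Jordan measure gives an admissible variation: it does not
    raise the weighted variation for any nonnegative weight, so it respects the constraint
    [|Du|(Omega) <= M] too. The new pair only represents the competitor, which is why
    representations need not be mutually singular and the bound [|Du| <= m1 + m2] replaces an
    equality. Strict positivity of [alpha] matters in the variation bound for one reason. For the
    part of [(Du)^+] off [{H > 0}], the first-order condition bounds its integral of [alpha] by its
    integral of [H], which is at most [0]; only [alpha > 0] then forces this part to vanish, since
    nothing else excludes mass on [{H = 0}]. The passage to [alpha >= 0] needs no convergence of
    minimizers: the minimizer of [J] under the constraint [M = |Df|(Omega)] is compared directly
    with minimizers for [alpha + eta], which satisfy that same constraint whatever [eta] is. *)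

Section real_integrable.
Context d (T : measurableType d) (R : realType) (mu : {measure set T -> \bar R}).
Implicit Types (D : set T) (f g : T -> R).

Lemma integrable_realZl D k f : measurable D -> mu.-integrable D (EFin \o f) ->
  mu.-integrable D (EFin \o (fun x => k * f x)).
Proof. by move=> mD intf; have := integrableZl mD k intf. Qed.

Lemma integrable_realD D f g : measurable D ->
  mu.-integrable D (EFin \o f) -> mu.-integrable D (EFin \o g) ->
  mu.-integrable D (EFin \o (fun x => f x + g x)).
Proof. by move=> mD intf intg; have := integrableD mD intf intg. Qed.

Lemma integrable_realB D f g : measurable D ->
  mu.-integrable D (EFin \o f) -> mu.-integrable D (EFin \o g) ->
  mu.-integrable D (EFin \o (fun x => f x - g x)).
Proof. by move=> mD intf intg; have := integrableB mD intf intg. Qed.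

Lemma integrable_realMbounded D f g (B : R) : measurable D ->
  mu.-integrable D (EFin \o f) -> measurable_fun D g ->
  (forall x, D x -> `|g x| <= B) ->
  mu.-integrable D (EFin \o (fun x => f x * g x)).
Proof.
move=> mD intf mg gB; apply: (integrableMl mD intf mg).
exists B; split; first exact: num_real.
by move=> M BM x Dx; exact: le_trans (gB _ Dx) (ltW BM).
Qed.

Lemma integrable_real_measurable D f : mu.-integrable D (EFin \o f) ->
  measurable_fun D f.
Proof. by move/measurable_int/measurable_EFinP. Qed.

Lemma integrable_bounded D f (B : R) : measurable D -> (mu D < +oo)%E ->
  measurable_fun D f -> (forall x, D x -> `|f x| <= B) ->
  mu.-integrable D (EFin \o f).
Proof.
move=> mD muD mf fB; apply: measurable_bounded_integrable => //.
exists B; split; first exact: num_real.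
by move=> M BM x Dx; exact: le_trans (fB _ Dx) (ltW BM).
Qed.

Lemma EFin_Rintegral D f : measurable D -> mu.-integrable D (EFin \o f) ->
  (\int[mu]_(x in D) f x)%:E = (\int[mu]_(x in D) (f x)%:E)%E.
Proof. by move=> mD intf; rewrite /Rintegral fineK//; exact: integrable_fin_num. Qed.

End real_integrable.

(* [filterS] and [filterS2] fail to find the filter instance of
   [almost_everywhere lebesgue_measure]. *)
Lemma aeS d (T : measurableType d) (R : realType) (mu : {measure set T -> \bar R})
    (P Q : T -> Prop) :
  (forall x, P x -> Q x) -> {ae mu, forall x, P x} -> {ae mu, forall x, Q x}.
Proof. by move=> PQ; apply: filterS. Qed.

Lemma ae2S d (T : measurableType d) (R : realType) (mu : {measure set T -> \bar R})
    (P Q S : T -> Prop) :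
  (forall x, P x -> Q x -> S x) ->
  {ae mu, forall x, P x} -> {ae mu, forall x, Q x} -> {ae mu, forall x, S x}.
Proof. by move=> PQS; apply: filterS2. Qed.

Lemma integral_null_setC d (T : measurableType d) (R : realType)
    (mu : {measure set T -> \bar R}) (D : set T) (f : T -> \bar R) :
  measurable D -> mu (~` D) = 0%E -> mu.-integrable setT f ->
  (\int[mu]_x f x = \int[mu]_(x in D) f x)%E.
Proof.
move=> mD D0 intf.
rewrite (@negligible_integral _ _ _ mu setT (~` D))//; last exact: measurableC.
by rewrite setTD setCK.
Qed.

Lemma Rintegral_bounded_cvg d (T : measurableType d) (R : realType)
    (mu : {measure set T -> \bar R}) (D : set T) (f_ : nat -> T -> R) (f : T -> R) (B : R) :
  measurable D -> (mu D < +oo)%E ->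
  (forall n, measurable_fun D (f_ n)) -> measurable_fun D f ->
  (forall n x, D x -> `|f_ n x| <= B) ->
  {ae mu, forall x, D x -> f_ n x @[n --> \oo] --> f x} ->
  \int[mu]_(x in D) f_ n x @[n --> \oo] --> \int[mu]_(x in D) f x.
Proof.
move=> mD muD mf_ mf fB cvg_f.
have iB : mu.-integrable D (EFin \o cst B).
  apply: (@integrable_bounded _ _ _ _ _ _ `|B|) => //.
have [||||| intf _ h] := @dominated_convergence _ _ _ mu D mD (fun n => EFin \o f_ n) (EFin \o f) (EFin \o cst B).
- by move=> n; exact/measurable_EFinP.
- exact/measurable_EFinP.
- apply: aeS cvg_f => x fx Dx; apply: cvg_EFin; last exact: fx.
  by near=> n.
- exact: iB.
- by apply: aeW => x n Dx; rewrite lee_fin fB.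
by apply: fine_cvg; rewrite EFin_Rintegral.
Unshelve. all: by end_near. Qed.

Section ae_Rintegral.
Context d (T : measurableType d) (R : realType) (mu : {measure set T -> \bar R}).
Variable D : set T.
Hypothesis mD : measurable D.
Implicit Types f g : T -> R.

Lemma eq_Rintegral_ae f g : measurable_fun D f -> measurable_fun D g ->
  {ae mu, forall x, D x -> f x = g x} ->
  \int[mu]_(x in D) f x = \int[mu]_(x in D) g x.
Proof.
move=> mf mg fg; congr fine; apply: ae_eq_integral => //; try exact/measurable_EFinP.
by apply: aeS fg => x fg Dx; rewrite fg.
Qed.

Lemma integrable_ae_eq f g : measurable_fun D g ->
  {ae mu, forall x, D x -> g x = f x} ->
  mu.-integrable D (EFin \o f) -> mu.-integrable D (EFin \o g).
Proof.
move=> mg gf intf; have /integrableP[mf ffin] := intf.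
apply/integrableP; split; first exact/measurable_EFinP.
rewrite (_ : integral _ _ _ = \int[mu]_(x in D) `|(EFin \o f) x|)%E//.
apply: ae_eq_integral => //; try exact: measurableT_comp.
- by apply: measurableT_comp => //; exact/measurable_EFinP.
- by apply: aeS gf => x gf Dx /=; rewrite gf.
Qed.

Lemma le_Rintegral_ae f g : mu.-integrable D (EFin \o f) ->
  mu.-integrable D (EFin \o g) -> {ae mu, forall x, D x -> f x <= g x} ->
  \int[mu]_(x in D) f x <= \int[mu]_(x in D) g x.
Proof.
move=> intf intg fg.
have mf := integrable_real_measurable intf.
have mg := integrable_real_measurable intg.
(* [f \max g] dominates [f] everywhere and equals [g] almost everywhere, which reduces the claim to
   a pointwise comparison. *)
have mfg : measurable_fun D (f \max g) by exact: measurable_maxr.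
have fgE : {ae mu, forall x, D x -> (f \max g) x = g x}.
  by apply: aeS fg => x fg Dx /=; rewrite (max_idPr (fg Dx)).
rewrite -(eq_Rintegral_ae mfg mg fgE); apply: le_Rintegral => //.
- exact: integrable_ae_eq intg.
- by move=> x _ /=; rewrite le_max lexx.
Qed.

End ae_Rintegral.

(** * Mollifiers and the lemma of du Bois-Reymond *)

Section bump.
Context {R : realType}.
Implicit Types (n : nat) (p : {poly R}) (x y : R).

(** This family is closed under differentiation, so a single derivative formula yields smoothness of
    all orders. *)
Definition bump n p x : R :=
  if 0 < x < 1 then p.[x] * ((x * (1 - x))^-1 ^+ n * expR (- (x * (1 - x))^-1))
  else 0.

(** With [q = 'X - 'X^2], the derivative of [p q^-n exp(-1/q)] is [q^-(n+2) exp(-1/q)] times this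
    numerator, [p' q^2 + (1 - n q) p q']. *)
Definition bump_step n p : {poly R} :=
  p^`() * ('X - 'X^2) ^+ 2 + (1 - n%:R *: ('X - 'X^2)) * p * (1 - 2%:R *: 'X).

(** A single term of the exponential series bounds [expR y] from below. *)
Lemma expRN_bound n y : 0 < y -> y ^+ n * expR (- y) <= (n`!)%:R.
Proof.
case: n => [|n] y0; first by rewrite mul1r fact0 -expR0 ler_expR; lra.
rewrite expRN ler_pdivrMr ?expR_gt0// mulrC -ler_pdivrMr ?ltr0n ?fact_gt0//.
by apply: le_trans (expR_ge1Dxn n (ltW y0)); rewrite lerDr.
Qed.

Lemma poly_bounded p : exists2 B, 0 <= B & forall x, 0 < x < 1 -> `|p.[x]| <= B.
Proof.
elim/poly_ind: p => [|p c [B B0 IH]]; first by exists 0 => // x; rewrite horner0 normr0.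
exists (B + `|c|) => [|x x01]; first by rewrite addr_ge0.
rewrite hornerMXaddC (le_trans (ler_normD _ _))// lerD2r normrM.
rewrite -[leRHS]mulr1 ler_pM// ?IH// ger0_norm; lra.
Qed.

(** Spending two more powers in [expRN_bound] leaves the factor [(x * (1 - x)) ^+ 2]. This quadratic
    decay makes the derivative vanish at [0] and [1]. *)
Lemma bump_bound n p : exists2 B, 0 <= B & forall x,
  `|bump n p x| <= if 0 < x < 1 then B * (x * (1 - x)) ^+ 2 else 0.
Proof.
have [B B0 pB] := poly_bounded p.
exists (B * (n.+2`!)%:R) => [|x]; first by rewrite mulr_ge0.
rewrite /bump; case: ifPn => [x01|_]; last by rewrite normr0.
have q0 : 0 < x * (1 - x) by rewrite mulr_gt0; lra.
have r0 : 0 < (x * (1 - x))^-1 by rewrite invr_gt0.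
rewrite normrM -mulrA ler_pM ?pB//.
rewrite ger0_norm ?mulr_ge0 ?exprn_ge0 ?expR_ge0// ?(ltW r0)//.
rewrite -ler_pdivrMr ?exprn_gt0// mulrAC -exprVn -exprD addn2.
exact: expRN_bound.
Qed.

Lemma is_derive_sq (f : R -> R) x B :
  0 <= B -> (forall y, `|f y| <= B * (y - x) ^+ 2) -> is_derive x 1 f 0.
Proof.
move=> B0 fB; have fx : f x = 0.
  by apply/eqP; rewrite -normr_le0 (le_trans (fB x))// subrr expr0n mulr0.
(* Division by zero gives the slope the value [0] at [y = x], which is the derivative wanted
   there. *)
apply/is_derive1_caratheodory; exists (fun y => f y / (y - x)); split.
- move=> z; rewrite fx subr0; have [->|zx] := eqVneq z x; first by rewrite fx !mul0r.
  by rewrite divfK// subr_eq0.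
- apply/cvgrPdist_le => e e0; near=> y.
  rewrite fx mul0r sub0r normrN; have [->|yx] := eqVneq y x.
    by rewrite fx mul0r normr0 ltW.
  rewrite normrM normfV ler_pdivrMr ?normr_gt0 ?subr_eq0// (le_trans (fB y))//.
  rewrite -real_normK ?num_real// expr2 mulrA ler_wpM2r//.
  apply: (@le_trans _ _ ((B + 1) * `|y - x|)); first by rewrite ler_wpM2r// lerDl.
  rewrite -ler_pdivlMl ?ltr_wpDl//.
  near: y; apply/nbhs_ballP; exists ((B + 1)^-1 * e) => /=.
    by rewrite mulr_gt0// invr_gt0 ltr_wpDl.
  by move=> y; rewrite /ball/= distrC => /ltW.
- by rewrite fx mul0r.
Unshelve. all: by end_near. Qed.

Lemma is_derive_bump n p x : is_derive x 1 (bump n p) (bump n.+2 (bump_step n p) x).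
Proof.
have [x01|x01] := boolP (0 < x < 1); last first.
  rewrite [X in is_derive _ _ _ X](_ : _ = 0); last by rewrite /bump (negbTE x01).
  have [B B0 pB] := bump_bound n p.
  apply: (@is_derive_sq _ _ B) => // y; apply: le_trans (pB y) _.
  case: ifPn => y01; last by rewrite mulr_ge0// sqr_ge0.
  (* For [y] inside and [x] outside the unit interval, [y * (1 - y)] is at most the distance from
     [y] to the endpoint on the side of [x], hence at most the distance from [y] to [x]. *)
  rewrite ler_wpM2l// -[leRHS]real_normK ?num_real// lerXn2r ?nnegrE//.
    by rewrite mulr_ge0; lra.
  move: x01; rewrite negb_and -!leNgt => /orP[x0|x1].
    by rewrite ger0_norm; nra.
  by rewrite ler0_norm; nra.
pose q y := y * (1 - y).
have q0 : q x != 0 by rewrite /q mulf_neq0//; lra.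
have dq : is_derive x 1 q (1 - 2 * x).
  rewrite (_ : q = id * (cst 1 - id))//.
  apply: is_derive_eq; transitivity (x * (0 - 1) + (1 - x) * 1); [by []|lra].
have dr : is_derive x 1 (fun y => (q y)^-1) (- (q x) ^- 2 *: (1 - 2 * x)) by exact: is_deriveV.
have dp := is_derive_poly p x.
apply: (@near_eq_is_derive _ _ _
  (horner p * ((fun y => (q y)^-1) ^+ n * (expR \o (- (fun y => (q y)^-1)))))).
  have : \forall y \near x, 0 < y < 1.
    near=> y; apply/andP; split; near: y; [apply: lt_nbhsr|apply: lt_nbhsl]; lra.
  apply: filterS => y y01; rewrite /bump y01.
  by congr (_ * (_ * _)); rewrite exprfctE.
apply: is_derive_eq; rewrite exprfctE /bump x01 /=.
rewrite -/(q x); set r := (q x)^-1; set e := expR (- r).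
transitivity (p.[x] * (r ^+ n * (e * - (- q x ^- 2 * (1 - 2 * x))) +
   e * (n%:R * r ^+ n.-1 * (- q x ^- 2 * (1 - 2 * x)))) + r ^+ n * e * p^`().[x]).
  by rewrite /GRing.scale/=; congr (_ + _ * _); rewrite -[LHS]/(_ ^+ n * _).
have qr : q x * r = 1 by rewrite mulfV.
have -> : (bump_step n p).[x] = p^`().[x] * q x ^+ 2 + (1 - n%:R * q x) * p.[x] * (1 - 2 * x).
  by rewrite /bump_step !(hornerM, hornerD, hornerN, horner_exp, hornerZ, hornerX, hornerC) /q; lra.
rewrite -!exprVn -/r.
set p' := p^`().[x]; set s := 1 - 2 * x.
have q2r2 : q x ^+ 2 * r ^+ 2 = 1 by rewrite -exprMn qr expr1n.
(* [lra] treats products as atoms, so the consequences of [q x * r = 1] are supplied already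
   multiplied by the monomials that occur. *)
have E1 := congr1 (fun z => z * (p' * r ^+ n * e)) q2r2.
case: n => [|n] /= in E1 *; first by rewrite !expr0 in E1 *; lra.
have E2 := congr1 (fun z => z * (n.+1%:R * p.[x] * s * r ^+ n * e * r ^+ 2)) qr.
rewrite !exprS in E1 E2 *; lra.
Unshelve. all: by end_near. Qed.

End bump.

Section fundamental_lemma.
Context {R : realType}.
Notation mu := (@lebesgue_measure R).
Implicit Types (n : nat) (p : {poly R}) (x e t : R).

Definition bump_at (x e : R) n p (t : R) : R := bump n p ((t - x) / e).

Lemma is_derive_bump_at x e n p t :
  is_derive t 1 (bump_at x e n p) (bump_at x e n.+2 (e^-1 *: bump_step n p) t).
Proof.
have -> : bump_at x e n.+2 (e^-1 *: bump_step n p) t =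
    bump n.+2 (bump_step n p) ((t - x) / e) * e^-1.
  by rewrite /bump_at /bump; case: ifP; rewrite ?mul0r// hornerZ; lra.
apply: (@is_derive1_comp _ (bump n p) (fun t => (t - x) / e)).
  exact: is_derive_bump.
rewrite (_ : (fun t => (t - x) / e) = e^-1 \*: (id - cst x)); last first.
  by apply/funext => z; rewrite mulrC.
by apply: is_derive_eq; rewrite subr0 /GRing.scale/= mulr1.
Qed.

Lemma continuous_bump_at x e n p : continuous (bump_at x e n p).
Proof.
by move=> t; apply/differentiable_continuous/derivable1_diffP;
  have [] := is_derive_bump_at x e n p t.
Qed.

Lemma bump_at_out x e n p t : 0 < e -> ~ `[x, x + e]%classic t ->
  bump_at x e n p t = 0.
Proof.
move=> e0 tK; rewrite /bump_at /bump; case: ifPn => // /andP[].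
rewrite ltr_pdivlMr// mul0r ltr_pdivrMr// mul1r => t0 t1; exfalso; apply: tK.
by rewrite /= in_itv/=; lra.
Qed.

Lemma bump_at_bounded x e n p : exists B, forall t, `|bump_at x e n p t| <= B.
Proof.
have [B B0 pB] := bump_bound n p; exists B => t; apply: le_trans (pB _) _.
move: ((t - x) / e) => s; case: ifPn => // /andP[s0 s1].
by rewrite ler_piMr// expr_le1//; nra.
Qed.

Lemma bump_at_integrable x e n p : 0 < e ->
  mu.-integrable setT (EFin \o bump_at x e n p).
Proof.
move=> e0; have [B pB] := bump_at_bounded x e n p.
rewrite (_ : EFin \o _ = (EFin \o bump_at x e n p) \_ `[x, x + e]); last first.
  apply/funext => t; rewrite patchE; case: ifPn => // /negP tK /=.
  by rewrite bump_at_out// => ?; apply/tK/mem_set.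
apply/(integrable_mkcond _ _).1 => //; apply: (@integrable_bounded _ _ _ _ _ _ B) => //.
- by rewrite /= lebesgue_measure_itv/=; case: ifP => _; rewrite ltry.
- apply: measurable_funTS; apply: continuous_measurable_fun; exact: continuous_bump_at.
Qed.

(** Reduces smoothness to exhibiting a class of derivable functions that is stable under
    differentiation. *)
Lemma smooth_of_class (P : (R -> R) -> Prop) :
  (forall f, P f -> (forall x, derivable f x 1) /\ P f^`()) ->
  forall f, P f -> forall k x, derivable (f^`(k)) x 1.
Proof.
move=> HP f Pf k; suff Pk : P f^`(k) by exact: (HP _ Pk).1.
by elim: k => [//|k IH]; rewrite derive1nS; exact: (HP _ IH).2.
Qed.

Lemma bump01_ge0 x : 0 <= bump 0 1 x :> R.
Proof. by rewrite /bump; case: ifP => // _; rewrite hornerC expr0 !mul1r expR_ge0. Qed.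

Lemma bump01_le1 x : bump 0 1 x <= 1 :> R.
Proof.
rewrite /bump; case: ifP => // /andP[x0 x1]; rewrite hornerC expr0 !mul1r.
by rewrite -[leRHS]expR0 ler_expR oppr_le0 invr_ge0 mulr_ge0//; lra.
Qed.

(** One-sided: the support lies in [[x, x + e]], to the right of [x]. *)
Definition mollifier (x e t : R) : R :=
  bump_at x e 0 1 t / \int[mu]_s bump_at x e 0 1 s.

Lemma bump_mass_ge : exists2 c : R, 0 < c &
  forall x e, 0 < e -> c * e <= \int[mu]_t bump_at x e 0 1 t.
Proof.
(* On the middle half of the support [s * (1 - s) >= 3 / 16], so the bump is at least
   [expR (- (16 / 3))] over a length [e / 2]. *)
pose k := expR (- (16 / 3)) : R; have k0 : 0 < k by exact: expR_gt0.
exists (k / 2) => [|x e e0]; first by rewrite divr_gt0//.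
pose D := `[x + e / 4, x + e * (3 / 4)]%classic.
have mD : measurable D by exact: measurable_itv.
have Dk : k / 2 * e = \int[mu]_t ((cst k \_ D) t).
  rewrite -Rintegral_mkcond Rintegral_cst// /D /= lebesgue_measure_itv/= lte_fin ifT/=; nra.
rewrite Dk; apply: le_Rintegral => //.
- rewrite (_ : EFin \o _ = (EFin \o cst k) \_ D); last first.
    by apply/funext => t /=; rewrite !patchE; case: ifP.
  apply/(integrable_mkcond _ _).1 => //; apply: (@integrable_bounded _ _ _ _ _ _ `|k|) => //.
  by rewrite /D /= lebesgue_measure_itv/=; case: ifP => _; rewrite ltry.
- exact: bump_at_integrable.
- move=> t _; rewrite patchE; case: ifPn => [/set_mem|_]; last first.
    by rewrite /bump_at bump01_ge0.
  rewrite /D/= in_itv/= => /andP[tl tr].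
  rewrite /bump_at; set s := (t - x) / e.
  have s1 : 1 / 4 <= s by rewrite /s ler_pdivlMr//; lra.
  have s2 : s <= 3 / 4 by rewrite /s ler_pdivrMr//; lra.
  rewrite /bump ifT ?hornerC ?expr0 ?mul1r; last by lra.
  rewrite ler_expR lerN2 -[leRHS]invrK lef_pV2 ?posrE ?invr_gt0//; last by nra.
  by rewrite invf_div; nra.
Qed.

Lemma mollifier_ge0 x e t : 0 <= mollifier x e t.
Proof.
by rewrite divr_ge0 ?bump01_ge0// Rintegral_ge0// => s _; exact: bump01_ge0.
Qed.

Lemma mollifier_le : exists2 C : R, 0 < C &
  forall x e t, 0 < e -> mollifier x e t <= C / e.
Proof.
have [c c0 cI] := bump_mass_ge; exists c^-1 => [|x e t e0]; first by rewrite invr_gt0.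
rewrite /mollifier -invfM -[leRHS]mul1r ler_pM ?bump01_ge0//.
- by rewrite invr_ge0 Rintegral_ge0// => s _; exact: bump01_ge0.
- exact: bump01_le1.
- by rewrite lef_pV2 ?posrE ?cI// ?mulr_gt0// (lt_le_trans _ (cI x e e0))// mulr_gt0.
Qed.

Lemma mollifier_integrable x e : 0 < e -> mu.-integrable setT (EFin \o mollifier x e).
Proof.
move=> e0; rewrite (_ : mollifier x e = fun t => (\int[mu]_s bump_at x e 0 1 s)^-1 * bump_at x e 0 1 t).
  by apply: integrable_realZl => //; exact: bump_at_integrable.
by apply/funext => t; rewrite mulrC.
Qed.

Lemma mollifier_mass x e : 0 < e -> \int[mu]_t mollifier x e t = 1.
Proof.
move=> e0; have [c c0 cI] := bump_mass_ge.
rewrite RintegralZr ?mulfV//; last exact: bump_at_integrable.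
by rewrite gt_eqF// (lt_le_trans _ (cI x e e0))// mulr_gt0.
Qed.

Lemma mollifier_out x e t : 0 < e -> ~ `[x, x + e]%classic t -> mollifier x e t = 0.
Proof. by move=> e0 tK; rewrite /mollifier bump_at_out// mul0r. Qed.

Lemma continuous_mollifier x e : continuous (mollifier x e).
Proof. by move=> t; apply: cvgM; [exact: continuous_bump_at|exact: cvg_cst]. Qed.

End fundamental_lemma.

Section du_bois_reymond.
Context {R : realType}.
Notation mu := (@lebesgue_measure R).
Implicit Types (n : nat) (p : {poly R}) (a b c x y e t : R).

(** Both mollifiers have mass [1], so the primitive of their difference vanishes again beyond the
    two supports and is a test function. *)
Lemma mollifier_primitive a b x y e : 0 < e ->
  a < x -> x + e < b -> a < y -> y + e < b ->
  exists phi, test_function a b phi /\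
    forall t, phi^`() t = mollifier x e t - mollifier y e t.
Proof.
move=> e0 ax xb ay yb.
pose g t := mollifier x e t - mollifier y e t.
have ig : mu.-integrable setT (EFin \o g).
  by apply: integrable_realB => //; exact: mollifier_integrable.
have cg : continuous g by move=> t; apply: cvgB; exact: continuous_mollifier.
pose phi t := \int[mu]_(s in `]-oo, t]) g s.
have dphi t : derivable phi t 1 /\ phi^`() t = g t.
  apply: (@continuous_FTC1 _ g -oo%O t (t + 1)) => //.
  - by rewrite ltrDl.
  - exact: integrableS ig.
  - exact: ltNyr.
  - exact: cg.
have phiE : phi^`() = g by apply/funext => t; exact: (dphi t).2.
have g_out t : t < Num.min x y \/ Num.max x y + e < t -> g t = 0.
  move=> h; rewrite /g !mollifier_out ?subrr//= in_itv/= => /andP[].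
    by case: h; rewrite ?lt_min -?ltrBrDr ?gt_max; lra.
  by case: h; rewrite ?lt_min -?ltrBrDr ?gt_max; lra.
have smooth_g k t : derivable (g^`(k)) t 1.
  (* The normalising factors and the sign are constant polynomials, so sums of two bumps with a
     common [n] include [g] and all its derivatives. *)
  pose P (f : R -> R) :=
    exists n p q, f = fun t => bump_at x e n p t + bump_at y e n q t.
  apply: (@smooth_of_class _ P) k t => [f [n [p [q ->]]]|].
    have d t := is_deriveD (is_derive_bump_at x e n p t) (is_derive_bump_at y e n q t).
    split=> [t|]; first by have [] := d t.
    exists n.+2, (e^-1 *: bump_step n p), (e^-1 *: bump_step n q).
    by apply/funext => t; rewrite derive1E; have [_] := d t.
  exists 0%N, (\int[mu]_s bump_at x e 0 1 s)^-1%:P, (- (\int[mu]_s bump_at y e 0 1 s)^-1)%:P.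
  apply/funext => t; rewrite /g /mollifier.
  move: (Rintegral _ _ _) (Rintegral _ _ _) => Ix Iy; rewrite /bump_at /bump !hornerC.
  by case: ifP => _; case: ifP => _; clear; lra.
exists phi; split; last by move=> t; exact: (dphi t).2.
split=> [[|k] t|]; first exact: (dphi t).1.
  by rewrite derive1Sn phiE.
exists `[Num.min x y, Num.max x y + e]%classic; split.
- exact: segment_compact.
- move=> t /=; rewrite !in_itv/= ge_min -lerBlDr le_max.
  lra.
- move=> t /= /negP; rewrite in_itv/= negb_and -!ltNge => /orP[tl|tr].
    rewrite /phi; under eq_Rintegral.
      move=> s /set_mem/=; rewrite in_itv/= => st; rewrite g_out; last by left; exact: le_lt_trans tl.
      over.
    by rewrite Rintegral_cst// mul0r.
  transitivity (\int[mu]_s g s).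
    rewrite /phi Rintegral_mkcond; apply: eq_Rintegral => s _; rewrite patchE.
    case: ifPn => // /negP st; rewrite g_out//; right.
    rewrite ltNge; apply/negP => sm; apply: st; rewrite inE/= in_itv/=.
    exact: le_trans sm (ltW tr).
  rewrite /g RintegralB; [|exact: measurableT|exact: mollifier_integrable..].
  by rewrite !mollifier_mass// subrr.
Qed.

(** The mollifier is at most [C / e] and lives inside the ball of radius [2 * e], so the error is
    controlled by the average deviation that defines a Lebesgue point. *)
Lemma mollifier_lebesgue_pt (w : R -> R) x : mu.-integrable setT (EFin \o w) ->
  lebesgue_pt w x -> forall d : R, 0 < d -> \forall e \near 0^'+,
  `|\int[mu]_t (w t * mollifier x e t) - w x| <= d.
Proof.
move=> iw wx d d0; have [C C0 mC] := @mollifier_le R.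
have mw : measurable_fun setT w by exact: integrable_real_measurable iw.
(* The ball of radius [2 * e] has length [4 * e], so the bound [C / e] multiplies the average
   deviation by [4 * C]. *)
have /wx : nbhs 0%E [set z : \bar R | (z < (d / (4 * C))%:E)%E].
  by apply: lt_nbhsl; rewrite divr_gt0// mulr_gt0.
rewrite near_simpl => -[r /= r0 davg_lt].
exists (r / 2) => /=; first by rewrite divr_gt0.
move=> e /=; rewrite sub0r normrN => er e0.
have {davg_lt} : (davg w x (2 * e) < (d / (4 * C))%:E)%E.
  apply: davg_lt => /=; last by rewrite mulr_gt0.
  by rewrite sub0r normrN normrM ger0_norm//; lra.
have iwK : mu.-integrable setT (EFin \o (fun t => w t * mollifier x e t)).
  apply: (@integrable_realMbounded _ _ _ _ _ _ _ (C / e)) => //.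
    by apply: continuous_measurable_fun; exact: continuous_mollifier.
  by move=> t _; rewrite ger0_norm ?mollifier_ge0// mC.
have iK : mu.-integrable setT (EFin \o mollifier x e) by exact: mollifier_integrable.
have -> : \int[mu]_t (w t * mollifier x e t) - w x =
    \int[mu]_t ((w t - w x) * mollifier x e t).
  rewrite -[X in _ - X]mulr1 -(@mollifier_mass _ x e e0) -RintegralZl// -RintegralB//.
    by apply: eq_Rintegral => t _; rewrite mulrBl.
  exact: integrable_realZl.
move=> davg_lt; rewrite -lee_fin.
have iwxK : mu.-integrable setT (EFin \o (fun t => (w t - w x) * mollifier x e t)).
  have -> : (fun t => (w t - w x) * mollifier x e t) =
      fun t => w t * mollifier x e t - w x * mollifier x e t.
    by apply/funext => t; rewrite mulrBl.
  by apply: integrable_realB => //; exact: integrable_realZl.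
rewrite EFin_normr_Rintegral//; apply: le_trans (le_abse_integral _ _ _) _ => //.
  exact: measurable_int iwxK.
have mB : measurable (ball x (2 * e)) by exact: measurable_ball.
apply: (@le_trans _ _ (\int[mu]_(t in ball x (2 * e)) ((C / e)%:E * `|(w t - w x)%:E|))%E).
  rewrite [leRHS]integral_mkcond; apply: ge0_le_integral => //.
  - by apply: measurableT_comp => //; exact: measurable_int iwxK.
  - apply/(measurable_restrictT _ _).1 => //; apply: measurable_funTS.
    apply: measurable_funeM; apply: measurableT_comp => //; apply/measurable_EFinP.
    exact: measurable_funB.
  - move=> t _; rewrite patchE; case: ifPn => [_|/negP tB] /=.
      by rewrite lee_fin normrM mulrC ler_wpM2r// ger0_norm ?mollifier_ge0// mC.
    rewrite mollifier_out ?mulr0 ?normr0//= in_itv/= => tK; apply: tB; rewrite inE.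
    by rewrite /ball/= ltr_norml; lra.
rewrite ge0_integralZl_EFin//; last 2 first.
- apply: measurable_funTS; apply: measurableT_comp => //; apply/measurable_EFinP.
  exact: measurable_funB.
- by rewrite divr_ge0// ltW.
move: davg_lt; rewrite /davg /iavg lebesgue_measure_ball; last by rewrite mulr_ge0// ltW.
rewrite inver ifF; last by apply/negbTE; rewrite gt_eqF// mulrn_wgt0// mulr_gt0.
set I := (\int[mu]_(_ in _) _)%E => davg_lt.
rewrite lte_pdivrMl ?mulrn_wgt0 ?mulr_gt0// in davg_lt.
rewrite -[(C / e)%R]invf_div lee_pdivrMl ?divr_gt0//.
apply: le_trans (ltW davg_lt) _; rewrite -!EFinM lee_fin le_eqVlt; apply/orP; left.
apply/eqP; have C1 : C * C^-1 = 1 by rewrite mulfV// gt_eqF.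
rewrite -mulr_natl !invfM; have := congr1 (fun z => z * (e * d)) C1; lra.
Qed.

(** Testing against the primitive of a difference of mollifiers shows that the mollified values at
    two points agree. At Lebesgue points they tend to the values of the zero extension [W], so [W]
    is constant on the Lebesgue points of the interval, hence almost everywhere. *)
Lemma du_bois_reymond a b (w : R -> R) : a < b ->
  mu.-integrable `]a, b[ (EFin \o w) ->
  (forall phi, test_function a b phi ->
    \int[mu]_(x in `]a, b[) (w x * derive1 phi x)%:E = 0)%E ->
  exists c, {ae mu, forall x, `]a, b[%classic x -> w x = c}.
Proof.
move=> ab iw wphi; pose W := w \_ `]a, b[%classic.
have iW : mu.-integrable setT (EFin \o W).
  rewrite (_ : EFin \o W = (EFin \o w) \_ `]a, b[%classic); last exact/esym/restrict_EFin.
  by apply/(integrable_mkcond _ _).1.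
have aeW : {ae mu, forall x, lebesgue_pt W x}.
  by apply: lebesgue_differentiation; apply: open_integrable_locally => //; exact: openT.
have Wcst x y : a < x < b -> a < y < b -> lebesgue_pt W x -> lebesgue_pt W y -> W x = W y.
  move=> /andP[ax xb] /andP[ay yb] Wx Wy.
  apply/eqP; rewrite -subr_eq0 -normr_le0; apply/ler_addgt0Pr => d d0; rewrite add0r.
  have d20 : 0 < d / 2 by rewrite divr_gt0.
  have close (u v z : R) : `|z - u| <= d / 2 -> `|z - v| <= d / 2 -> `|u - v| <= d.
    by rewrite !ler_norml; lra.
  have : \forall e \near (0 : R)^'+, `|W x - W y| <= d.
    near=> e.
    have e0 : 0 < e by near: e; exact: nbhs_right_gt.
    have xeb : x + e < b by rewrite -ltrBrDl; near: e; apply: nbhs_right_lt; rewrite subr_gt0.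
    have yeb : y + e < b by rewrite -ltrBrDl; near: e; apply: nbhs_right_lt; rewrite subr_gt0.
    have WxE : `|\int[mu]_t (W t * mollifier x e t) - W x| <= d / 2.
      by near: e; exact: mollifier_lebesgue_pt.
    have WyE : `|\int[mu]_t (W t * mollifier y e t) - W y| <= d / 2.
      by near: e; exact: mollifier_lebesgue_pt.
    suff E : \int[mu]_t (W t * mollifier x e t) = \int[mu]_t (W t * mollifier y e t).
      by rewrite E in WxE; exact: close WxE WyE.
    have [phi [tphi phiE]] := @mollifier_primitive a b x y e e0 ax xeb ay yeb.
    have iWm z : mu.-integrable setT (EFin \o (fun t => W t * mollifier z e t)).
      have [C C0 mC] := @mollifier_le R.
      apply: (@integrable_realMbounded _ _ _ _ _ _ _ (C / e)) => //.
        by apply: continuous_measurable_fun; exact: continuous_mollifier.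
      by move=> t _; rewrite ger0_norm ?mollifier_ge0// mC.
    apply/eqP; rewrite -subr_eq0 -RintegralB//; apply/eqP.
    rewrite /Rintegral -[RHS]/(fine 0%E) -(wphi _ tphi) [in RHS]integral_mkcond.
    congr fine; apply: eq_integral => t _; rewrite patchE /W patchE phiE.
    by case: ifP => _; [rewrite -mulrBr|rewrite !mul0r subrr].
  by case/filter_ex => e.
(* Without a Lebesgue point the whole interval would be negligible. *)
have [x0 x0ab Wx0] : exists2 x, a < x < b & lebesgue_pt W x.
  apply: contrapT => nex; have : mu.-negligible `]a, b[.
    apply: negligibleS aeW => x /=; rewrite in_itv/= => xab Wx; apply: nex; by exists x.
  rewrite negligibleP//= lebesgue_measure_itv/= lte_fin ab => /eqP.
  by rewrite -EFinB eqe subr_eq0 gt_eqF.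
exists (W x0); refine (@aeS _ _ _ mu (lebesgue_pt W) _ _ aeW) => x Wx /= xab; move: (xab); rewrite in_itv/= => xab'.
by rewrite -(Wcst x x0)// /W patchE mem_set.
Unshelve. all: by end_near. Qed.

End du_bois_reymond.

(** * Cumulative distributions *)

Section fubini_sections.
Context d1 d2 (T1 : measurableType d1) (T2 : measurableType d2) (R : realType).
Variables (m1 : {sigma_finite_measure set T1 -> \bar R})
  (m2 : {finite_measure set T2 -> \bar R}).
Implicit Types (g : T1 -> R) (A : set (T1 * T2)).

Lemma integrable_section g A : m1.-integrable setT (EFin \o g) -> measurable A ->
  (m1 \x m2)%E.-integrable setT (fun z => (g z.1)%:E * (\1_A z)%:E)%E.
Proof.
move=> ig mA; have mg : measurable_fun setT g by exact: integrable_real_measurable ig.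
have mf : measurable_fun setT (fun z : T1 * T2 => (g z.1)%:E * (\1_A z)%:E)%E.
  apply: emeasurable_funM; apply/measurable_EFinP; last exact: measurable_indic.
  by apply: (measurableT_comp mg); exact: measurable_fst.
apply/(integrable12ltyP m1 m2 mf).
apply: (@le_lt_trans _ _ (\int[m1]_x (`|(g x)%:E| * m2 setT))%E).
  apply: ge0_le_integral => //.
  - by move=> x _; apply: integral_ge0 => t _.
  - apply: (@measurable_fun_fubini_tonelli_F _ _ _ _ _ _ (fun z => `|(g z.1)%:E * (\1_A z)%:E|)%E) => //.
    exact: measurableT_comp.
  - apply: emeasurable_funM => //; apply: measurableT_comp => //; exact/measurable_EFinP.
  - move=> x _; rewrite -integral_cst//; apply: ge0_le_integral => //.
    + apply: measurableT_comp => //; exact: (measurableT_comp mf (measurable_pair1 x)).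
    + move=> t _ /=; rewrite lee_fin normrM ler_piMr// indicE.
      by case: (_ \in _); rewrite ?normr1 ?normr0.
have /integrableP[_ gfin] := ig.
rewrite -(@fineK _ (m2 setT)) ?fin_num_measure// ge0_integralZr//.
- apply: lte_mul_pinfty; [exact: integral_ge0|by rewrite ge0_fin_numE ?integral_ge0|exact: ltry].
- by apply: measurableT_comp => //; exact/measurable_EFinP.
- by rewrite lee_fin fine_ge0.
Qed.

(** Applied to the half-plane [t <= x], whose sections have measure [cumul m x], and to the strip
    [t <= x < t + h], whose sections give the increments of [cumul m]. *)
Lemma fubini_section g A : m1.-integrable setT (EFin \o g) -> measurable A ->
  (\int[m1]_x (g x * fine (m2 (xsection A x)))%:E =
   \int[m2]_t \int[m1]_(x in ysection A t) (g x)%:E)%E.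
Proof.
move=> ig mA.
transitivity (\int[m1]_x \int[m2]_t ((g x)%:E * (\1_A (x, t))%:E))%E.
  apply: eq_integral => x _; have mAx := measurable_xsection x mA.
  rewrite (_ : (fun t => _) = fun t => (g x)%:E * (\1_(xsection A x) t)%:E)%E; last first.
    by apply/funext => t; rewrite !indicE mem_xsection.
  rewrite integralZl//; last exact: integrable_indic.
  by rewrite integral_indic// setIT EFinM fineK ?fin_num_measure.
rewrite (@Fubini _ _ _ _ _ m1 m2 (fun z => (g z.1)%:E * (\1_A z)%:E)%E); last exact: integrable_section.
apply: eq_integral => t _; rewrite [RHS]integral_mkcond; apply: eq_integral => x _.
rewrite patchE indicE mem_ysection; case: ifP => _; by rewrite ?mule1 ?mule0.
Qed.

Lemma integrable_fubini_section g A : m1.-integrable setT (EFin \o g) -> measurable A ->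
  m2.-integrable setT (fun t => \int[m1]_(x in ysection A t) (g x)%:E)%E.
Proof.
move=> ig mA.
have E : (fun t => \int[m1]_(x in ysection A t) (g x)%:E)%E =
    fubini_G m1 (fun z => (g z.1)%:E * (\1_A z)%:E)%E.
  apply/funext => t; rewrite integral_mkcond; apply: eq_integral => x _.
  rewrite patchE indicE mem_ysection; case: ifP => _; by rewrite ?mule1 ?mule0.
apply/integrableP; split.
  by rewrite E; apply: measurable_fubini_G; exact: integrable_section.
have /integrableP[mg gfin] := ig.
apply: (@le_lt_trans _ _ (\int[m2]_t (\int[m1]_x `|(EFin \o g) x|))%E).
  apply: ge0_le_integral => //.
  - apply: measurableT_comp => //.
    by rewrite E; apply: measurable_fubini_G; exact: integrable_section.
  - move=> t _; have mAt := measurable_ysection t mA.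
    apply: le_trans (le_abse_integral _ _ _) _ => //; first exact: measurable_funTS.
    by apply: ge0_subset_integral => //; exact: measurableT_comp.
rewrite integral_cst//; apply: lte_mul_pinfty; first exact: integral_ge0.
  by rewrite ge0_fin_numE ?integral_ge0.
by rewrite -ge0_fin_numE// fin_num_measure.
Qed.

End fubini_sections.

Section cumulative_distribution.
Context {R : realType}.
Notation mu := (@lebesgue_measure R).
Notation bmeasure := {finite_measure set (measurableTypeR R) -> \bar R}.
Implicit Types (m : bmeasure) (g : R -> R) (a b c t x y : R).

Definition cumul m x : R := fine (m `]-oo, x]%classic).

Definition concentrated m (D : set R) := m (~` D) = 0%E.

(** Fubini on the half-plane [t <= x], playing the role of integration by parts. *)
Lemma integral_cumul a b m g : concentrated m `]a, b[%classic ->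
  mu.-integrable `]a, b[ (EFin \o g) ->
  (\int[mu]_(x in `]a, b[) (g x * cumul m x)%:E =
   \int[m]_(t in `]a, b[) \int[mu]_(x in `[t, b[) (g x)%:E)%E.
Proof.
move=> mc ig; pose G := g \_ `]a, b[%classic.
have iG : mu.-integrable setT (EFin \o G).
  rewrite (_ : EFin \o G = (EFin \o g) \_ `]a, b[%classic); last exact/esym/restrict_EFin.
  by apply/(integrable_mkcond _ _).1.
pose A : set (measurableTypeR R * measurableTypeR R) := [set z | z.2 <= z.1].
have mA : measurable A.
  rewrite (_ : A = setT `&` (fun z => z.1 - z.2) @^-1` `[0, +oo[%classic); last first.
    by apply/seteqP; split=> z; rewrite /A /= in_itv/= andbT subr_ge0 => // -[].
  have : measurable_fun setT (fun z : measurableTypeR R * measurableTypeR R => z.1 - z.2).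
    by apply: measurable_funB; [exact: measurable_fst|exact: measurable_snd].
  exact.
transitivity (\int[mu]_x (G x * fine (m (xsection A x)))%:E)%E.
  rewrite integral_mkcond; apply: eq_integral => x _.
  rewrite patchE /G patchE; case: ifP => _; last by rewrite mul0r.
  congr (_ * fine (m _))%:E; apply/seteqP; split => t.
    by rewrite /= in_itv/= /xsection /= inE.
  by rewrite /= in_itv/= /xsection /= inE.
rewrite (@fubini_section _ _ _ _ _ _ m _ _ iG mA).
have iS := @integrable_fubini_section _ _ _ _ _ _ m _ _ iG mA.
rewrite (integral_null_setC _ mc iS); [|exact: measurable_itv].
apply: eq_integral => t /set_mem/=; rewrite in_itv/= => /andP[at_ tb].
rewrite integral_mkcond [RHS]integral_mkcond; apply: eq_integral => x _.
rewrite !patchE /G patchE mem_ysection.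
have -> : ((x, t) \in A) = (t <= x) by apply/idP/idP; rewrite inE.
rewrite !mem_setE !in_itv/=; case: (leP t x) => [tx|//].
by rewrite (lt_le_trans at_ tx); case: ifP.
Qed.

End cumulative_distribution.

(** * Sums, multiples and restrictions of finite measures *)

Section finite_measure_operations.
Context d (T : measurableType d) (R : realType).
Implicit Types m : {finite_measure set T -> \bar R}.

(** A name of its own, on which the structure of finite measure is declared, so that [cumul] applies
    to the sum. The multiple and the restriction below are set up in the same way. *)
Definition fmeasure_add m1 m2 : set T -> \bar R := measure_add m1 m2.

HB.instance Definition _ m1 m2 := Measure.on (fmeasure_add m1 m2).

Let fmeasure_add_fin m1 m2 : fin_num_fun (fmeasure_add m1 m2).
Proof.
by move=> A mA; rewrite /fmeasure_add measure_addE fin_numD !fin_num_measure.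
Qed.

HB.instance Definition _ m1 m2 :=
  Measure_isFinite.Build _ _ _ (fmeasure_add m1 m2) (@fmeasure_add_fin m1 m2).

Definition fmeasure_scale (r : {nonneg R}) m : set T -> \bar R := mscale r m.

HB.instance Definition _ r m := Measure.on (fmeasure_scale r m).

Let fmeasure_scale_fin r m : fin_num_fun (fmeasure_scale r m).
Proof. by move=> A mA; rewrite /fmeasure_scale /mscale fin_numM// fin_num_measure. Qed.

HB.instance Definition _ r m :=
  Measure_isFinite.Build _ _ _ (fmeasure_scale r m) (@fmeasure_scale_fin r m).

Definition fmeasure_restr m (D : set T) (mD : measurable D) : set T -> \bar R :=
  mrestr m mD.

HB.instance Definition _ m D (mD : measurable D) := Measure.on (fmeasure_restr m mD).

Let fmeasure_restr_fin m D (mD : measurable D) : fin_num_fun (fmeasure_restr m mD).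
Proof. by move=> A mA; rewrite fin_num_measure//; exact: measurableI. Qed.

HB.instance Definition _ m D (mD : measurable D) :=
  Measure_isFinite.Build _ _ _ (fmeasure_restr m mD) (@fmeasure_restr_fin m D mD).

Lemma fmeasure_addE m1 m2 A :
  (fmeasure_add m1 m2 : {finite_measure set T -> \bar R}) A = (m1 A + m2 A)%E.
Proof. exact: measure_addE. Qed.

Lemma fmeasure_scaleE r m A :
  (fmeasure_scale r m : {finite_measure set T -> \bar R}) A = (r%:num%:E * m A)%E.
Proof. by []. Qed.

Lemma fmeasure_restrE m D (mD : measurable D) A :
  (fmeasure_restr m mD : {finite_measure set T -> \bar R}) A = m (A `&` D).
Proof. by []. Qed.

End finite_measure_operations.

Section cumul_theory.
Context {R : realType}.
Notation mu := (@lebesgue_measure R).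
Notation bmeasure := {finite_measure set (measurableTypeR R) -> \bar R}.
Implicit Types (m : bmeasure) (g : R -> R) (a b c t x y : R).

Lemma cumulE m x : (cumul m x)%:E = m `]-oo, x]%classic.
Proof. by rewrite /cumul fineK// fin_num_measure. Qed.

Lemma cumul_ge0 m x : 0 <= cumul m x.
Proof. exact: fine_ge0. Qed.

Lemma cumul_le_mass m x : cumul m x <= fine (m setT).
Proof. by apply: fine_le; rewrite ?fin_num_measure// le_measure ?inE. Qed.

Lemma cumul_nd m : {homo cumul m : x y / x <= y}.
Proof.
move=> x y xy; apply: fine_le; rewrite ?fin_num_measure// le_measure ?inE//.
exact: subset_itvl.
Qed.

Lemma cumulB m x y : x <= y -> (cumul m y - cumul m x)%:E = m `]x, y]%classic.
Proof.
move=> xy; rewrite EFinB !cumulE.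
have -> : `]-oo, y]%classic = `]-oo, x]%classic `|` `]x, y]%classic :> set R.
  by rewrite -itv_bndbnd_setU// bnd_simp.
rewrite measureU//; last first.
  apply/seteqP; split=> z //= [] /=; rewrite !in_itv/= => zx /andP[xz _].
  by move: (lt_le_trans xz zx); rewrite ltxx.
by rewrite addeAC subee ?add0e// fin_num_measure.
Qed.

Lemma cumul_lt_cst m a b x : concentrated m `]a, b[%classic -> x <= a -> cumul m x = 0.
Proof.
move=> mc xa; have le0 : (m `]-oo, x]%classic <= m (~` `]a, b[%classic))%E.
  apply: le_measure; rewrite ?inE//; first by apply: measurableC.
  by move=> z /=; rewrite !in_itv/= => zx /andP[az _]; lra.
rewrite [X in (_ <= X)%E](_ : _ = 0%E)// in le0; rewrite /cumul (_ : m _ = 0%E)//.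
by apply/eqP; rewrite eq_le le0 measure_ge0.
Qed.

Lemma cumul_ge_cst m a b x : concentrated m `]a, b[%classic -> b <= x ->
  cumul m x = fine (m `]a, b[%classic).
Proof.
move=> mc bx; congr fine; apply/eqP; rewrite eq_le; apply/andP; split; last first.
  by apply: le_measure; rewrite ?inE// => z /=; rewrite !in_itv/=; lra.
apply: (@le_trans _ _ (m (`]a, b[%classic `|` ~` `]a, b[%classic))).
  by rewrite setUv le_measure ?inE.
rewrite measureU ?setICr//; last by apply: measurableC.
by rewrite [X in (_ + X)%E](_ : _ = 0%E) ?adde0.
Qed.

Lemma cumul_right_continuous m x : cumul m y @[y --> x^'+] --> cumul m x.
Proof.
pose F n : set (measurableTypeR R) := `]-oo, x + n.+1%:R^-1]%classic.
have mF n : measurable (F n) by exact: measurable_itv.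
have Fcvg : m (F n) @[n --> \oo] --> m (\bigcap_n F n).
  apply: nonincreasing_cvg_mu => //.
  - by rewrite ltey_eq fin_num_measure.
  - exact: bigcapT_measurable.
  - move=> n k nk; apply/subsetPset; apply: subset_itvl; rewrite bnd_simp lerD2l.
    by rewrite lef_pV2 ?posrE// ler_nat ltnS.
have capF : \bigcap_n F n = `]-oo, x]%classic.
  apply/seteqP; split=> z /=; last first.
    by rewrite in_itv/= => zx n _; rewrite /F/= in_itv/= ler_wpDr.
  move=> zF; rewrite in_itv/=; apply/ler_addgt0Pr => e e0.
  have [n ne] := ltr_add_invr e0; rewrite add0r in ne.
  have := zF n Logic.I; rewrite /F/= in_itv/= => /le_trans; apply.
  by rewrite lerD2l ltW.
rewrite capF in Fcvg.
apply/cvgrPdist_le => e e0.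
have /fine_cvgP[_ /cvgrPdist_le/(_ _ e0)[N _ Ne]] : m (F n) @[n --> \oo] --> (cumul m x)%:E.
  by rewrite cumulE.
have := Ne N (leqnn N); rewrite /= -/(cumul m _) => xN.
near=> y.
have xy : x < y by near: y; exact: nbhs_right_gt.
have yN : y <= x + N.+1%:R^-1 by near: y; apply: nbhs_right_le; rewrite ltrDl.
move: xN; have := cumul_nd m yN; have := cumul_nd m (ltW xy).
by rewrite !ler_norml; lra.
Unshelve. all: by end_near. Qed.

Lemma measurable_cumul m : measurable_fun setT (cumul m).
Proof. by apply: nondecreasing_measurable => //; exact: cumul_nd. Qed.

End cumul_theory.

(** * BV functions as differences of cumulative distributions *)

Section bv_representation.
Context {R : realType}.
Notation mu := (@lebesgue_measure R).
Notation bmeasure := {finite_measure set (measurableTypeR R) -> \bar R}.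
Implicit Types (m : bmeasure) (u g phi : R -> R) (a b c t x y : R).

(** A nonzero value at [x] would persist on an interval to the right of [x], which has positive
    measure. The point [x = a] is included: the cumulative distributions vanish there, and this
    identifies the constant of a representation. *)
Lemma right_continuous_ae0 g a b x : g y @[y --> x^'+] --> g x ->
  {ae mu, forall t, `]a, b[%classic t -> g t = 0} -> a <= x < b -> g x = 0.
Proof.
move=> gx [N [mN N0 gN]] /andP[ax xb]; apply: contrapT => /eqP gx0.
have gx0' : 0 < `|g x| by rewrite normr_gt0.
have /cvgrPdist_lt/(_ _ gx0') := gx.
move=> -[e /= e0 xe].
pose I := `]x, Num.min b (x + e)[%classic.
have IN : I `<=` N.
  move=> t; rewrite /I/= in_itv/= lt_min => /and3P[xt tb te]; apply: gN => /= gt0.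
  have : `|g x - g t| < `|g x|.
    apply: xe => //=; rewrite ltr_norml; lra.
  by rewrite gt0 ?subr0 ?ltxx//= in_itv/= tb andbT (le_lt_trans ax).
have : (mu I <= mu N)%E by apply: le_measure; rewrite ?inE//; exact: measurable_itv.
rewrite N0 /I lebesgue_measure_itv/= lte_fin lt_min xb ltrDl e0/=.
rewrite -EFinB lee_fin leNgt subr_gt0 lt_min xb ltrDl e0//.
Qed.

Lemma fin_measure_eq_cumul m m' : (forall x, cumul m x = cumul m' x) ->
  forall A, measurable A -> m A = m' A.
Proof.
move=> mm' A mA.
have := @measure_unique _ R (measurableTypeR R) (@ocitv R)
  (fun k => `](- k%:R), k%:R]%classic) erefl (@ocitvI R) _ _ m m' _ _ A mA.
apply.
- by move=> i; exact: is_ocitv.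
- rewrite -subTset => /= x _ /=.
  exists (Num.bound `|x|) => //=; rewrite in_itv/=.
  by have := archi_boundP (normr_ge0 x); rewrite ltr_norml => /andP[-> /ltW].
- move=> B /ocitvP[->|[[x y] /= xy ->]]; first by rewrite !measure0.
  by rewrite -!cumulB ?ltW// !mm'.
- by move=> k; rewrite ltey_eq fin_num_measure.
Qed.

(** Up to [a] both functions vanish. From [b] on they equal the total mass, which continuity from
    below recovers from the points [b - n.+1%:R^-1]. *)
Lemma concentrated_eq_cumul a b m m' : concentrated m `]a, b[%classic ->
  concentrated m' `]a, b[%classic -> a < b ->
  (forall x, a < x < b -> cumul m x = cumul m' x) ->
  forall A, measurable A -> m A = m' A.
Proof.
move=> mc mc' ab mm'; apply: fin_measure_eq_cumul => x.
have mm'' y : y < b -> cumul m y = cumul m' y.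
  move=> yb; have [ya|ay] := leP y a; last by rewrite mm' ?ay.
  by rewrite (cumul_lt_cst mc)// (cumul_lt_cst mc').
have [bx|] := leP b x; last exact: mm''.
rewrite (cumul_ge_cst mc bx) (cumul_ge_cst mc' bx); congr fine.
pose F n : set (measurableTypeR R) := `]-oo, b - n.+1%:R^-1]%classic.
have cap_F : \bigcup_n F n = `]-oo, b[%classic.
  apply/seteqP; split=> z /=; rewrite ?in_itv/=.
    by move=> [n _]; rewrite /F/= in_itv/= => /le_lt_trans; apply; rewrite ltrBlDr ltrDl invr_gt0.
  move=> zb; have [n nb] := ltr_add_invr zb; exists n => //.
  by rewrite /F/= in_itv/= lerBrDr ltW.
have mF n : measurable (F n) by exact: measurable_itv.
have Fcvg m0 : m0 (F n) @[n --> \oo] --> m0 `]-oo, b[%classic.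
  rewrite -cap_F; apply: nondecreasing_cvg_mu => //.
  - by rewrite cap_F; exact: measurable_itv.
  - move=> n k nk; apply/subsetPset; apply: subset_itvl; rewrite bnd_simp lerD2l lerN2.
    by rewrite lef_pV2 ?posrE// ler_nat ltnS.
have mE m0 : concentrated m0 `]a, b[%classic -> m0 `]a, b[%classic = m0 `]-oo, b[%classic.
  move=> m0c; apply/eqP; rewrite eq_le; apply/andP; split.
    by apply: le_measure; rewrite ?inE// => z /=; rewrite !in_itv/=; case/andP.
  apply: (@le_trans _ _ (m0 `]-oo, b]%classic)).
    by apply: le_measure; rewrite ?inE// => z /=; rewrite !in_itv/=; exact: ltW.
  by rewrite -cumulE (cumul_ge_cst m0c (lexx b)) fineK// fin_num_measure.
rewrite !mE//.
have Fm := Fcvg m; have Fm' := Fcvg m'.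
have E : (fun n => m (F n)) = (fun n => m' (F n)).
  by apply/funext => n; rewrite -!cumulE mm''// ltrBlDr ltrDl invr_gt0.
by rewrite E in Fm; exact: (cvg_unique _ Fm Fm').
Qed.

(** Mutual singularity is not demanded, so that adding, scaling and restricting the measures gives
    representations again. What [u] determines is [c], its essential limit at [a], and the
    difference of the two measures. *)
Definition bv_rep a b u c m1 m2 := [/\ measurable_fun `]a, b[ u, concentrated m1 `]a, b[%classic,
  concentrated m2 `]a, b[%classic &
  {ae mu, forall x, `]a, b[%classic x -> u x = c + cumul m1 x - cumul m2 x}].

Lemma concentratedI m D A : concentrated m D -> measurable D -> measurable A ->
  m A = m (A `&` D).
Proof.
move=> mc mD mA; rewrite (measureDI m mA mD) [X in (X + _)%E](_ : _ = 0%E) ?add0e//.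
apply/eqP; rewrite eq_le measure_ge0 andbT -[leRHS]mc; apply: le_measure; rewrite ?inE//.
- exact: measurableD.
- exact: measurableC.
Qed.

Lemma concentrated_add D m1 m2 : concentrated m1 D -> concentrated m2 D ->
  concentrated (fmeasure_add m1 m2) D.
Proof. by rewrite /concentrated fmeasure_addE => -> ->; rewrite adde0. Qed.

Lemma cumul_add m1 m2 x : cumul (fmeasure_add m1 m2) x = cumul m1 x + cumul m2 x.
Proof. by apply: EFin_inj; rewrite EFinD !cumulE fmeasure_addE. Qed.

(** The difference of the two right-hand sides is right-continuous and vanishes almost everywhere,
    hence everywhere on [[a, b[]. The conclusion is additive so that it stays an identity between
    measures. *)
Lemma bv_rep_uniq a b u c m1 m2 c' m1' m2' : a < b ->
  bv_rep a b u c m1 m2 -> bv_rep a b u c' m1' m2' ->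
  c = c' /\ forall A, measurable A -> (m1 A + m2' A = m1' A + m2 A)%E.
Proof.
move=> ab [_ m1c m2c uE] [_ m1c' m2c' uE'].
pose g x := (c + cumul m1 x - cumul m2 x) - (c' + cumul m1' x - cumul m2' x).
have g0 x : a <= x < b -> g x = 0.
  apply: right_continuous_ae0.
    apply: cvgB; apply: cvgB; try exact: cumul_right_continuous;
    by apply: cvgD; [exact: cvg_cst|exact: cumul_right_continuous].
  apply: (ae2S _ uE uE') => t /= ut ut' tab.
  by rewrite /g -ut// -ut'// subrr.
have cc' : c = c'.
  have := g0 a; rewrite lexx ab => /(_ isT).
  by rewrite /g (cumul_lt_cst m1c)// (cumul_lt_cst m2c)// (cumul_lt_cst m1c')// (cumul_lt_cst m2c')//; lra.
split => // A mA; rewrite -!fmeasure_addE; apply: (@concentrated_eq_cumul a b) => //.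
- exact: concentrated_add.
- exact: concentrated_add.
- move=> x /andP[ax xb]; rewrite !cumul_add.
  by have := g0 x; rewrite (ltW ax) xb => /(_ isT); rewrite /g cc'; lra.
Qed.

End bv_representation.

Section distributional_derivative.
Context {R : realType}.
Notation mu := (@lebesgue_measure R).
Notation bmeasure := {finite_measure set (measurableTypeR R) -> \bar R}.
Implicit Types (m : bmeasure) (u g phi : R -> R) (a b c t x y : R).

Lemma within_continuous_bounded g a b : {within `[a, b], continuous g} ->
  exists B, forall x, a <= x <= b -> `|g x| <= B.
Proof.
move=> cg; have [ab|ba] := leP a b; last by exists 0 => x; lra.
have [M _ gM] := EVT_max ab cg; have [l _ gl] := EVT_min ab cg.
exists (`|g M| + `|g l|) => x xab.
have := gM x; have := gl x; rewrite in_itv/= xab => /(_ isT) lx /(_ isT) xM.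
rewrite ler_norml; have := ler_norm (g M); have := ler_norm (- g l); rewrite normrN.
have := normr_ge0 (g M); have := normr_ge0 (g l); lra.
Qed.

Lemma within_continuous_measurable g a b : {within `[a, b], continuous g} ->
  measurable_fun `]a, b[ g.
Proof.
move=> cg; apply: (@measurable_funS _ _ _ _ `[a, b]%classic) => //.
  by move=> x /=; rewrite !in_itv/=; lra.
exact: subspace_continuous_measurable_fun.
Qed.

Lemma test_function_derivable a b phi : test_function a b phi ->
  forall x, derivable phi x 1.
Proof. by move=> [tphi _] x; exact: (tphi 0%N x). Qed.

Lemma test_function_continuous a b phi : test_function a b phi -> continuous phi.
Proof.
move=> tphi x; apply/differentiable_continuous/derivable1_diffP.
exact: test_function_derivable tphi x.
Qed.

Lemma test_function_continuous_derive a b phi : test_function a b phi ->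
  continuous (derive1 phi).
Proof.
move=> [tphi _] x; apply/differentiable_continuous/derivable1_diffP.
exact: (tphi 1%N x).
Qed.

Lemma test_function_out a b phi : test_function a b phi ->
  forall x, ~ (a < x < b) -> phi x = 0.
Proof.
by move=> [_ [K [_ KO phi0]]] x xab; apply: phi0 => /KO /=; rewrite in_itv.
Qed.

Lemma test_function_FTC a b phi t : test_function a b phi -> t < b ->
  (\int[mu]_(x in `[t, b[) (derive1 phi x)%:E = (- phi t)%:E)%E.
Proof.
move=> tphi tb; rewrite integral_itv_bndo_bndc; last first.
  apply/measurable_EFinP; apply: measurable_funTS; apply: continuous_measurable_fun.
  exact: test_function_continuous_derive tphi.
rewrite (@continuous_FTC2 _ (derive1 phi) phi)//.
- by rewrite (test_function_out tphi (x := b)) ?ltxx ?andbF// sub0e.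
- by apply: continuous_subspaceT; exact: test_function_continuous_derive tphi.
- split.
  + by move=> x _; exact: test_function_derivable tphi x.
  + by apply: cvg_at_right_filter; exact: test_function_continuous tphi t.
  + by apply: cvg_at_left_filter; exact: test_function_continuous tphi b.
Qed.

Lemma test_derive_integrable a b phi : test_function a b phi ->
  mu.-integrable `]a, b[ (EFin \o derive1 phi).
Proof.
move=> tphi; have : mu.-integrable `[a, b] (EFin \o derive1 phi).
  apply: continuous_compact_integrable; first exact: segment_compact.
  by apply: continuous_subspaceT; exact: test_function_continuous_derive tphi.
by apply: integrableS => // x /=; rewrite !in_itv/=; lra.
Qed.

Lemma test_integrable a b phi m : test_function a b phi ->
  m.-integrable `]a, b[ (EFin \o phi).
Proof.
move=> tphi; have [B phiB] := within_continuous_bounded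
  (continuous_subspaceT (test_function_continuous tphi) : {within `[a, b], continuous phi}).
apply: (@integrable_bounded _ _ _ _ _ _ B) => //.
- by rewrite ltey_eq fin_num_measure.
- by apply: measurable_funTS; apply: continuous_measurable_fun; exact: test_function_continuous tphi.
- by move=> x /=; rewrite in_itv/= => xab; apply: phiB; lra.
Qed.

(** As [phi] vanishes at [b], the integral of its derivative over [[t, b[] is [- phi t]; so [m] is
    the distributional derivative of [cumul m]. *)
Lemma integral_test_cumul a b phi m : concentrated m `]a, b[%classic ->
  test_function a b phi ->
  (\int[mu]_(x in `]a, b[) (derive1 phi x * cumul m x)%:E =
   - \int[m]_(t in `]a, b[) (phi t)%:E)%E.
Proof.
move=> mc tphi; rewrite (integral_cumul mc (test_derive_integrable tphi)).
transitivity (\int[m]_(t in `]a, b[) ((-1)%:E * (phi t)%:E))%E.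
  apply: eq_integral => t /set_mem/=; rewrite in_itv/= => /andP[_ tb].
  by rewrite (test_function_FTC tphi)// -EFinM mulN1r.
by rewrite integralZl//; [rewrite mulN1e|exact: test_integrable tphi].
Qed.

(** The integral is defined through a Hahn decomposition. For any other splitting, [nu^+ + m2] and
    [m1 + nu^-] are the same measure, and integrating [phi] against it gives the claim. *)
Lemma charge_integral_diff (nu : {charge set (measurableTypeR R) -> \bar R}) m1 m2
    (D : set (measurableTypeR R)) phi :
  (forall A, measurable A -> nu A = m1 A - m2 A)%E -> measurable D ->
  (forall m, m.-integrable D (EFin \o phi)) ->
  charge_integral nu D phi =
  (\int[m1]_(x in D) (phi x)%:E - \int[m2]_(x in D) (phi x)%:E)%E.
Proof.
move=> nuE mD iphi; rewrite /charge_integral.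
pose p : bmeasure := jordan_pos (hahn_posneg nu).
pose n : bmeasure := jordan_neg (hahn_posneg nu).
rewrite -[LHS]/(\int[p]_(x in D) (phi x)%:E - \int[n]_(x in D) (phi x)%:E)%E.
have : (\int[measure_add p m2]_(x in D) (EFin \o phi) x =
        \int[measure_add m1 n]_(x in D) (EFin \o phi) x)%E.
  apply: eq_measure_integral => A mA _; rewrite [LHS]measure_addE [RHS]measure_addE.
  have := jordan_decomp (hahn_posneg nu) mA; rewrite nuE// /cadd/= cscaleN1 /=.
  rewrite -/(p A) -/(n A).
  rewrite -(fineK (fin_num_measure m1 _ mA)) -(fineK (fin_num_measure m2 _ mA)).
  rewrite -(fineK (fin_num_measure p _ mA)) -(fineK (fin_num_measure n _ mA)).
  rewrite -!EFinB -!EFinD => -[e]; congr EFin; lra.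
rewrite (integral_measure_add mD (iphi p) (iphi m2)) (integral_measure_add mD (iphi m1) (iphi n)).
have fin m : (\int[m]_(x in D) (phi x)%:E)%E \is a fin_num.
  exact: integrable_fin_num (iphi m).
rewrite -(fineK (fin m1)) -(fineK (fin m2)) -(fineK (fin p)) -(fineK (fin n)).
by rewrite -!EFinB -!EFinD => -[e]; congr EFin; lra.
Qed.

Lemma cumul_norm_le m x : `|cumul m x| <= fine (m setT).
Proof. by rewrite ger0_norm ?cumul_ge0// cumul_le_mass. Qed.

Lemma integrable_derive_cumul a b phi m : test_function a b phi ->
  mu.-integrable `]a, b[ (EFin \o (fun x => derive1 phi x * cumul m x)).
Proof.
move=> tphi; apply: (@integrable_realMbounded _ _ _ _ _ _ _ (fine (m setT))) => //.
- exact: test_derive_integrable.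
- by apply: measurable_funTS; exact: measurable_cumul.
- by move=> x _; exact: cumul_norm_le.
Qed.

Lemma bv_rep_distr_derivative a b u c m1 m2
    (nu : {charge set (measurableTypeR R) -> \bar R}) : a < b ->
  bv_rep a b u c m1 m2 ->
  (forall A, measurable A -> nu A = m1 A - m2 A)%E -> is_distr_derivative a b u nu.
Proof.
move=> ab [mu_u m1c m2c uE] nuE; split=> [A mA|phi tphi].
  have mAO : measurable (A `&` `]a, b[%classic) by apply: measurableI.
  by rewrite !nuE// (concentratedI m1c)// (concentratedI m2c).
have mphi : measurable_fun `]a, b[ (derive1 phi) by exact: integrable_real_measurable (test_derive_integrable tphi).
transitivity (\int[mu]_(x in `]a, b[)
    (c * derive1 phi x + derive1 phi x * cumul m1 x - derive1 phi x * cumul m2 x)%:E)%E.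
  apply: ae_eq_integral => //.
  - by apply/measurable_EFinP; exact: measurable_funM.
  - apply/measurable_EFinP; apply: measurable_funB; [apply: measurable_funD|].
    + exact: measurable_funM.
    + by apply: measurable_funM => //; apply: measurable_funTS; exact: measurable_cumul.
    + by apply: measurable_funM => //; apply: measurable_funTS; exact: measurable_cumul.
  - refine (@aeS _ _ _ mu _ _ _ uE) => x /= ux xab; rewrite ux//; congr EFin; lra.
have i1 := integrable_derive_cumul m1 tphi.
have i2 := integrable_derive_cumul m2 tphi.
have ic : mu.-integrable `]a, b[ (EFin \o (fun x => c * derive1 phi x)).
  by apply: integrable_realZl => //; exact: test_derive_integrable.
rewrite -EFin_Rintegral//; last by apply: integrable_realB => //; exact: integrable_realD.
rewrite RintegralB//; last exact: integrable_realD.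
rewrite RintegralD// RintegralZl//; last exact: test_derive_integrable.
have -> : \int[mu]_(x in `]a, b[) derive1 phi x = 0.
  rewrite /Rintegral integral_itv_obnd_cbnd; last by apply/measurable_EFinP.
  by rewrite (test_function_FTC tphi)//= (test_function_out tphi) ?oppr0// ltxx.
rewrite mulr0 add0r EFinB !EFin_Rintegral// !(integral_test_cumul _ tphi)//.
rewrite (charge_integral_diff nuE)//; last by move=> m; exact: test_integrable.
have fin m : (\int[m]_(x in `]a, b[) (phi x)%:E)%E \is a fin_num.
  by apply: integrable_fin_num => //; exact: test_integrable.
by rewrite -(fineK (fin m1)) -(fineK (fin m2)) -!EFinN -!EFinD; congr EFin; lra.
Qed.

Lemma cumul_integrable a b m : mu.-integrable `]a, b[ (EFin \o cumul m).
Proof.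
apply: (@integrable_bounded _ _ _ _ _ _ (fine (m setT))) => //.
- by rewrite /= lebesgue_measure_itv/=; case: ifP => _; rewrite ltry.
- by apply: measurable_funTS; exact: measurable_cumul.
- by move=> x _; exact: cumul_norm_le.
Qed.

Lemma integrable_derive_mul a b u phi : mu.-integrable `]a, b[ (EFin \o u) ->
  test_function a b phi ->
  mu.-integrable `]a, b[ (EFin \o (fun x => u x * derive1 phi x)).
Proof.
move=> iu tphi; have [B phiB] := within_continuous_bounded
  (continuous_subspaceT (test_function_continuous_derive tphi) :
    {within `[a, b], continuous (derive1 phi)}).
apply: (@integrable_realMbounded _ _ _ _ _ _ _ B) => //.
- exact: integrable_real_measurable (test_derive_integrable tphi).
- by move=> x /=; rewrite in_itv/= => xab; apply: phiB; lra.
Qed.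

(** The difference [v] of the cumulative distributions of the Jordan parts has derivative [nu], like
    [u]; so [u - v] has derivative zero and is constant by [du_bois_reymond]. *)
Lemma distr_derivative_bv_rep a b u (nu : {charge set (measurableTypeR R) -> \bar R}) :
  a < b -> mu.-integrable `]a, b[ (EFin \o u) -> is_distr_derivative a b u nu ->
  exists c, bv_rep a b u c (jordan_pos (hahn_posneg nu)) (jordan_neg (hahn_posneg nu)).
Proof.
move=> ab iu [nuO nuphi].
set p : bmeasure := jordan_pos (hahn_posneg nu).
set n : bmeasure := jordan_neg (hahn_posneg nu).
have mOC : measurable (~` `]a, b[%classic : set (measurableTypeR R)) by apply: measurableC.
(* The Jordan parts are, up to sign, values of [nu] on pieces of the Hahn sets, so they inherit the
   concentration on the interval. *)
have nu0 A : measurable A -> nu (~` `]a, b[%classic `&` A) = 0%E.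
  move=> mA; rewrite nuO; last exact: measurableI.
  by rewrite setIAC setICl set0I charge0.
have pc : concentrated p `]a, b[%classic.
  apply: (etrans (jordan_posE (hahn_posneg nu) _)); rewrite cjordan_posE /crestr0 mem_set// /crestr nu0//.
  by have [[]] := hahn_posneg nu.
have nc : concentrated n `]a, b[%classic.
  apply: (etrans (jordan_negE (hahn_posneg nu) _)); rewrite cjordan_negE /crestr0 mem_set// /crestr nu0 ?oppe0//.
  by have [_ []] := hahn_posneg nu.
pose v x := 0 + cumul p x - cumul n x.
have vrep : bv_rep a b v 0 p n.
  split => //; last exact: aeW.
  by apply: measurable_funB; [apply: measurable_funD => //|];
    apply: measurable_funTS; exact: measurable_cumul.
have vnu : is_distr_derivative a b v nu.
  apply: (bv_rep_distr_derivative ab vrep) => A mA.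
  by rewrite [LHS](jordan_decomp (hahn_posneg nu) mA) /cadd/= cscaleN1.
have iv : mu.-integrable `]a, b[ (EFin \o v).
  rewrite (_ : v = fun x => cumul p x - cumul n x); last first.
    by apply/funext => x; rewrite /v add0r.
  by apply: integrable_realB => //; exact: cumul_integrable.
have [c uc] : exists c, {ae mu, forall x, `]a, b[%classic x -> u x - v x = c}.
  apply: du_bois_reymond => //; first exact: integrable_realB.
  move=> phi tphi; under eq_integral do rewrite mulrBl EFinB.
  have iup := integrable_derive_mul iu tphi.
  have ivp := integrable_derive_mul iv tphi.
  rewrite integralB_EFin// nuphi// vnu.2//.
  by rewrite subee// -vnu.2//; exact: integrable_fin_num.
exists c; split => //; first exact: integrable_real_measurable iu.
by refine (@aeS _ _ _ mu _ _ _ uc) => x /= ux xab; have := ux xab; rewrite /v; lra.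
Qed.

End distributional_derivative.

Section total_variation_measure.
Context {R : realType}.
Notation mu := (@lebesgue_measure R).
Notation bmeasure := {finite_measure set (measurableTypeR R) -> \bar R}.
Implicit Types (m : bmeasure) (u g phi : R -> R) (a b c t x y : R).

Lemma bv_rep_integrable a b u c m1 m2 : bv_rep a b u c m1 m2 ->
  mu.-integrable `]a, b[ (EFin \o u).
Proof.
move=> [mu_u _ _ uE]; pose v x := c + cumul m1 x - cumul m2 x.
have iv : mu.-integrable `]a, b[ (EFin \o v).
  apply: integrable_realB => //; last exact: cumul_integrable.
  apply: integrable_realD => //; last exact: cumul_integrable.
  apply: (@integrable_bounded _ _ _ _ _ _ `|c|) => //.
  by rewrite /= lebesgue_measure_itv/=; case: ifP => _; rewrite ltry.
exact: integrable_ae_eq iv.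
Qed.

Lemma bv_rep_BV a b u c m1 m2 : a < b -> bv_rep a b u c m1 m2 -> BV a b u.
Proof.
move=> ab urep; split; first exact: bv_rep_integrable urep.
exists (cadd (charge_of_finite_measure m1) (cscale (-1) (charge_of_finite_measure m2))).
apply: (bv_rep_distr_derivative ab urep) => A mA.
by transitivity (m1 A + (-1)%:E * m2 A)%E; [|rewrite mulN1e].
Qed.

Lemma distr_derivativeP a b u : BV a b u -> is_distr_derivative a b u (distr_derivative a b u).
Proof.
by move=> [_ Du]; rewrite /distr_derivative; case: pselect => // ?; case: cid.
Qed.

(** [P] is a positive Hahn set. It records the mutual singularity of the two measures, on which
    [Dvariation_le] rests. *)
Lemma BV_bv_rep a b u : a < b -> BV a b u -> exists c m1 m2 P,
  [/\ bv_rep a b u c m1 m2, measurable P, m1 (~` P) = 0%E, m2 P = 0%E &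
      forall A, measurable A -> Dvariation a b u A = (m1 A + m2 A)%E].
Proof.
move=> ab uBV; have [c urep] := distr_derivative_bv_rep ab uBV.1 (distr_derivativeP uBV).
set nu := distr_derivative a b u in urep *.
have [[mP _] [mN _] PN PN0] := hahn_posneg nu.
exists c, (jordan_pos (hahn_posneg nu)), (jordan_neg (hahn_posneg nu)), (hahn_pos nu).
split => //.
- apply: (etrans (jordan_posE (hahn_posneg nu) _)).
  by rewrite cjordan_posE /crestr0 mem_set /crestr ?setICl ?charge0//; apply: measurableC.
- apply: (etrans (jordan_negE (hahn_posneg nu) _)).
  by rewrite cjordan_negE /crestr0 mem_set /crestr ?PN0 ?charge0 ?oppe0.
Qed.

(** Minimality of the Jordan decomposition. On [P] the negative part [n] vanishes, so there
    [m1 = p + m2 >= p]; off [P] likewise [m2 >= n]. *)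
Lemma Dvariation_le a b u c m1 m2 : a < b -> bv_rep a b u c m1 m2 ->
  forall A, measurable A -> (Dvariation a b u A <= m1 A + m2 A)%E.
Proof.
move=> ab urep A mA; have [c' [p [n [P [urep' mP pP nP ->]]]]]// := BV_bv_rep ab (bv_rep_BV ab urep).
have [_ E] := bv_rep_uniq ab urep urep'.
have mPC : measurable (~` P) by apply: measurableC.
have mAP : measurable (A `&` P) by apply: measurableI.
have mAPC : measurable (A `&` ~` P) by apply: measurableI.
have pE : p A = p (A `&` P) by apply: concentratedI.
have nE : n A = n (A `&` ~` P) by apply: concentratedI; rewrite // /concentrated setCK.
have le0 m B C : measurable B -> measurable C -> B `<=` C -> m C = 0%E -> m B = 0%E.
  move=> mB mC BC mC0; apply/eqP; rewrite eq_le measure_ge0 andbT -mC0.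
  by apply: le_measure; rewrite ?inE.
have nAP : n (A `&` P) = 0%E by apply: (@le0 n _ P).
have pAP : p (A `&` ~` P) = 0%E by apply: (@le0 p _ (~` P)).
apply: leeD.
- rewrite pE; have := E _ mAP; rewrite nAP adde0 => mE.
  apply: (@le_trans _ _ (m1 (A `&` P))).
    by rewrite mE leeDl.
  by apply: le_measure; rewrite ?inE.
- rewrite nE; have := E _ mAPC; rewrite pAP add0e => mE.
  apply: (@le_trans _ _ (m2 (A `&` ~` P))).
    by rewrite -mE leeDr.
  by apply: le_measure; rewrite ?inE.
Qed.

End total_variation_measure.

(** * Compactness and lower semicontinuity *)

Section helly_selection.
Context {R : realType}.
Notation mu := (@lebesgue_measure R).
Implicit Types (F : nat -> R -> R) (f : R -> R) (M x y : R).

(* Continuity at [x], for a nondecreasing [f]. *)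
Definition no_jump f x := forall e, 0 < e ->
  exists y z, [/\ y < x, x < z, f x - e <= f y & f z <= f x + e].

Lemma no_jumpP f x : {homo f : x y / x <= y} -> ~ discontinuity f x -> no_jump f x.
Proof.
move=> ndf xdisc e e0.
have cvgl : cvg (f y @[y --> x^'-]).
  apply: nondecreasing_at_left_is_cvgr.
    by near=> z => u v _ _; exact: ndf.
  apply: nearW => z; exists (f x) => r [y /=]; rewrite in_itv/= => /andP[_ yx] <-.
  by apply: ndf; exact: ltW.
have cvgr : cvg (f y @[y --> x^'+]).
  apply: nondecreasing_at_right_is_cvgr.
    by near=> z => u v _ _; exact: ndf.
  apply: nearW => z; exists (f x) => r [y /=]; rewrite in_itv/= => /andP[xy _] <-.
  by apply: ndf; exact: ltW.
have lr : lim (f y @[y --> x^'-]) = lim (f y @[y --> x^'+]).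
  by apply: contrapT => /eqP lr; exact: xdisc.
have lx : lim (f y @[y --> x^'-]) <= f x.
  apply: limr_le => //; near=> y; apply: ndf; apply: ltW; near: y; exact: nbhs_left_lt.
have xr : f x <= lim (f y @[y --> x^'+]).
  apply: limr_ge => //; near=> y; apply: ndf; apply: ltW; near: y; exact: nbhs_right_gt.
have El : lim (f y @[y --> x^'-]) = f x by apply/eqP; rewrite eq_le lx lr xr.
have Er : lim (f y @[y --> x^'+]) = f x by rewrite -lr El.
have {}cvgl : f y @[y --> x^'-] --> f x by rewrite -El.
have {}cvgr : f y @[y --> x^'+] --> f x by rewrite -Er.
have [y [yx fy]] : exists y, y < x /\ f x - e <= f y.
  have : \forall y \near x^'-, y < x /\ f x - e <= f y.
    near=> y; split; first by near: y; exact: nbhs_left_lt.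
    near: y; apply: (cvgr_ge _ cvgl); rewrite ltrBlDr ltrDl//.
  by case/filter_ex => y; exists y.
have [z [xz fz]] : exists z, x < z /\ f z <= f x + e.
  have : \forall y \near x^'+, x < y /\ f y <= f x + e.
    near=> z; split; first by near: z; exact: nbhs_right_gt.
    near: z; apply: (cvgr_le _ cvgr); rewrite ltrDl//.
  by case/filter_ex => z; exists z.
by exists y, z.
Unshelve. all: by end_near. Qed.

Lemma no_jump_ae f : {homo f : x y / x <= y} -> {ae mu, forall x, no_jump f x}.
Proof.
move=> ndf; pose D n := [set x | x \in Interval (BRight (- n%:R)) (BLeft n%:R) /\ discontinuity f x].
have cDn n : countable (D n).
  by apply: (@discontinuity_countable _ (- n%:R) n%:R) => x y _ _; exact: ndf.
exists (\bigcup_n D n); split.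
- by apply: bigcupT_measurable => n; exact: countable_measurable.
- by apply: countable_lebesgue_measure0; exact: bigcup_countable.
- move=> x /= xj; exists (Num.bound `|x|) => //; split.
    by rewrite in_itv/= -ltr_norml archi_boundP.
  by apply: contrapT => xd; apply: xj; exact: no_jumpP.
Qed.

(** The limit of a bounded sequence along an ultrafilter. *)
Definition ulim (U : set_system nat) (u : nat -> R) : R :=
  sup [set r | U [set n | r <= u n]].

Lemma ulim_near (U : set_system nat) (u : nat -> R) M : UltraFilter U ->
  (forall n, `|u n| <= M) ->
  forall e, 0 < e -> U [set n | `|u n - ulim U u| <= e].
Proof.
move=> UU uM e e0; set S := [set r | U [set n | r <= u n]].
have uM' n : - M <= u n <= M by rewrite -ler_norml.
have SM : ubound S M.
  move=> r Sr; have [n /= rn] := filter_ex Sr.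
  by apply: le_trans rn _; have /andP[] := uM' n.
have S0 : has_sup S.
  split; last by exists M.
  exists (- M); rewrite /S/=; apply: filterS filterT => n _ /=.
  by have /andP[] := uM' n.
have [r Sr lr] := sup_adherent e0 S0.
have up : U [set n | u n <= sup S + e].
  have [//|nU] := in_ultra_setVsetC [set n | u n <= sup S + e] UU.
  have : S (sup S + e).
    by apply: filterS nU => n /= /negP; rewrite -ltNge => /ltW.
  by move/(ub_le_sup S0.2); rewrite gerDl leNgt e0.
apply: filterS2 Sr up => n /= rn nu; rewrite /ulim -/S ler_norml; lra.
Qed.

Lemma ulim_le (U : set_system nat) (u v : nat -> R) M : UltraFilter U ->
  (forall n, `|u n| <= M) -> (forall n, `|v n| <= M) ->
  (forall n, u n <= v n) -> ulim U u <= ulim U v.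
Proof.
move=> UU uM vM uv; apply/ler_addgt0Pr => e e0.
have e20 : 0 < e / 2 by rewrite divr_gt0.
have [n /= []] := filter_ex (filterI (ulim_near UU uM e20) (ulim_near UU vM e20)).
by have := uv n; rewrite !ler_norml; lra.
Qed.

(** Instead of a diagonal argument, an ultrafilter finer than the eventual filter gives the limit
    [f] at all points at once; the index [k n] is then chosen so that [F (k n)] is close to [f] at
    the first [n.+1] codes of rationals. The choice only ensures [n <= k n], not monotonicity, and
    this suffices for limits. *)
Lemma helly F M : (forall n, {homo F n : x y / x <= y}) ->
  (forall n x, `|F n x| <= M) ->
  exists (k : nat -> nat) (f : R -> R), [/\ forall n, (n <= k n)%N,
    {homo f : x y / x <= y}, forall x, `|f x| <= M &
    forall x, no_jump f x -> F (k n) x @[n --> \oo] --> f x].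
Proof.
move=> ndF FM; have [U [UU ooU]] := ultraFilterLemma (@eventually_filter).
pose f x := ulim U (fun n => F n x).
have fnear x e : 0 < e -> U [set n | `|F n x - f x| <= e].
  by move=> e0; exact: ulim_near.
have Uge N : U [set n | (N <= n)%N] by apply: ooU; exists N.
(* Enumerates the rationals; a code of no rational gets the value [0]. *)
pose q i : R := if unpickle i is Some r then ratr (r : rat) else 0.
have kE n : exists k, (n <= k)%N /\
    forall i, (i <= n)%N -> `|F k (q i) - f (q i)| <= n.+1%:R^-1.
  have : U [set k | (n <= k)%N /\ forall i, (i <= n)%N -> `|F k (q i) - f (q i)| <= n.+1%:R^-1].
    suff : forall j, U [set k | (n <= k)%N /\ forall i, (i < j)%N -> `|F k (q i) - f (q i)| <= n.+1%:R^-1].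
      by move/(_ n.+1); apply: filterS => k [nk H]; split.
    elim=> [|j IH]; first by apply: filterS (Uge n) => k.
    have jn : U [set k | `|F k (q j) - f (q j)| <= n.+1%:R^-1] by apply: fnear; rewrite invr_gt0.
    apply: filterS2 IH jn => k /= [nk H] Hj; split => // i.
    by rewrite ltnS leq_eqVlt => /predU1P[->//|]; exact: H.
  by case/filter_ex => k kP; exists k.
have [k kP] := choice kE.
have ndf : {homo f : x y / x <= y}.
  by move=> x y xy; apply: (@ulim_le U _ _ M) => // n; exact: ndF.
have cvg_rat (r : rat) : F (k n) (ratr r) @[n --> \oo] --> f (ratr r).
  apply/cvgrPdist_le => e e0; have [N Ne] := ltr_add_invr e0; rewrite add0r in Ne.
  near=> n; rewrite distrC.
  have qr : q (pickle r) = ratr r by rewrite /q pickleK.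
  rewrite -qr; have [_ /(_ (pickle r))] := kP n.
  have rn : (pickle r <= n)%N by near: n; exact: nbhs_infty_ge.
  move/(_ rn)/le_trans; apply; apply: le_trans (ltW Ne).
  by rewrite lef_pV2 ?posrE// ler_nat ltnS; near: n; exact: nbhs_infty_ge.
exists k, f; split => //.
- by move=> n; have [] := kP n.
- move=> x; apply/ler_addgt0Pr => e e0.
  have [n /= ne] := filter_ex (fnear x e e0).
  by have := FM n x; move: ne; rewrite !ler_norml; lra.
(* Monotonicity squeezes [F (k n) x] between the values at rationals [r < x < s], chosen where [f]
   is within [e / 2] of [f x]. *)
- move=> x fx; apply/cvgrPdist_le => e e0.
  have e20 : 0 < e / 2 by rewrite divr_gt0.
  have [y [z [yx xz fy fz]]] := fx _ e20.
  have [r] := rat_in_itvoo yx; rewrite in_itv/= => /andP[yr rx].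
  have [s] := rat_in_itvoo xz; rewrite in_itv/= => /andP[xs sz].
  near=> n.
  have Hr : `|f (ratr r) - F (k n) (ratr r)| <= e / 2.
    by near: n; move/cvgrPdist_le : (cvg_rat r); exact.
  have Hs : `|f (ratr s) - F (k n) (ratr s)| <= e / 2.
    by near: n; move/cvgrPdist_le : (cvg_rat s); exact.
  have := ndF (k n) _ _ (ltW rx); have := ndF (k n) _ _ (ltW xs).
  have := ndf _ _ (ltW yr); have := ndf _ _ (ltW sz).
  by move: Hr Hs; rewrite !ler_norml; lra.
Unshelve. all: by end_near. Qed.

End helly_selection.

Section stieltjes_limit.
Context {R : realType}.
Notation mu := (@lebesgue_measure R).
Notation bmeasure := {finite_measure set (measurableTypeR R) -> \bar R}.
Variables (f : R -> R) (M : R).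
Hypotheses (ndf : {homo f : x y / x <= y}) (fM : forall x, `|f x| <= M).

(** The right limit of [f]: it turns a Helly limit into a right-continuous function, to which a
    Lebesgue-Stieltjes measure belongs, without changing it where [f] has no jump. *)
Definition right_regularization x := inf [set f y | y in [set y | x < y]].
Notation fr := right_regularization.

Let has_inf_fr x : has_inf [set f y | y in [set y | x < y]].
Proof.
split; first by exists (f (x + 1)), (x + 1) => //=; rewrite ltrDl.
by exists (- M) => _ [y _ <-]; have := fM y; rewrite ler_norml => /andP[].
Qed.

Lemma right_regularization_ge x : f x <= fr x.
Proof. by apply: lb_le_inf; [exact: (has_inf_fr x).1|move=> _ [y /= xy <-]; exact/ndf/ltW]. Qed.

Lemma right_regularization_le x y : x < y -> fr x <= f y.
Proof. by move=> xy; apply: ge_inf; [exact: (has_inf_fr x).2|exists y]. Qed.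

Lemma right_regularization_nd : {homo fr : x y / x <= y}.
Proof.
move=> x y; rewrite le_eqVlt => /predU1P[->//|xy].
exact: le_trans (right_regularization_le xy) (right_regularization_ge y).
Qed.

Lemma right_regularization_rc x : fr y @[y --> x^'+] --> fr x.
Proof.
apply/cvgrPdist_le => e e0.
have [_ [z /= xz <-] fz] := inf_adherent e0 (has_inf_fr x).
near=> y.
have xy : x < y by near: y; exact: nbhs_right_gt.
have yz : y < z by near: y; exact: nbhs_right_lt.
have := right_regularization_nd (ltW xy); have := right_regularization_le yz.
by move: fz; rewrite -/(fr x) ler_norml; lra.
Unshelve. all: by end_near. Qed.

Lemma right_regularization_no_jump x : no_jump f x -> fr x = f x.
Proof.
move=> fx; apply/eqP; rewrite eq_le right_regularization_ge andbT.
apply/ler_addgt0Pr => e e0; have [_ [z [_ xz _ fz]]] := fx _ e0.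
exact: le_trans (right_regularization_le xz) fz.
Qed.

HB.instance Definition _ := isCumulative.Build R _ R right_regularization
  right_regularization_nd right_regularization_rc.

Let lsf : {measure set (measurableTypeR R) -> \bar R} :=
  lebesgue_stieltjes_measure fr.

Let lsf_itv x y : x <= y -> lsf `]x, y]%classic = (fr y - fr x)%:E.
Proof.
move=> xy; rewrite /lsf /= /lebesgue_stieltjes_measure.
rewrite /measure_extension measurable_mu_extE/=; last exact: is_ocitv.
by rewrite wlength_itv_bnd.
Qed.

(** The Stieltjes measure is cut down to the open interval. Variation of [f] at or beyond the
    endpoints is lost, hence only an inequality between increments over arbitrary intervals. *)
Lemma stieltjes_limit a b : a < b -> exists (m : bmeasure) (k : R),
  [/\ concentrated m `]a, b[%classic,
      forall x, a < x < b -> no_jump f x -> cumul m x = f x - k &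
      forall x y, x <= y -> no_jump f x -> no_jump f y ->
        cumul m y - cumul m x <= f y - f x].
Proof.
move=> ab.
have mab : measurable (`]a, b[%classic : set (measurableTypeR R)) by exact: measurable_itv.
have fin_ab : (lsf `]a, b[%classic < +oo)%E.
  apply: (@le_lt_trans _ _ (lsf `]a, b]%classic)).
    by apply: le_measure; rewrite ?inE// => x /=; rewrite !in_itv/=; lra.
  by rewrite lsf_itv ?ltry// ltW.
pose m : bmeasure := mfrestr mab fin_ab.
have mE A : m A = lsf (A `&` `]a, b[%classic) by [].
exists m, (fr a); split.
- by rewrite /concentrated mE setICl measure0.
- move=> x /andP[ax xb] fx; rewrite -(right_regularization_no_jump fx).
  apply: EFin_inj; rewrite cumulE mE -lsf_itv ?ltW//; congr (lsf _).
  by apply/seteqP; split=> y /=; rewrite !in_itv/=; lra.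
- move=> x y xy fx fy; rewrite -(right_regularization_no_jump fx) -(right_regularization_no_jump fy).
  rewrite -lee_fin cumulB// -lsf_itv// mE; apply: le_measure; rewrite ?inE//.
  exact: measurableI.
Qed.

End stieltjes_limit.

Section lower_semicontinuity.
Context {R : realType}.
Notation mu := (@lebesgue_measure R).
Notation bmeasure := {finite_measure set (measurableTypeR R) -> \bar R}.
Implicit Types (m : bmeasure) (a b t x y h e : R).

(** Expresses [\int A dm], up to an error, through the values of [cumul m], for which pointwise
    convergence is available. By Fubini the left integral is the [m]-integral of [A] integrated over
    [[t, t + h[], where [A] differs from [A t] by at most [e]. *)
Lemma fubini_moving_average a b m (A : R -> R) (B h e : R) :
  concentrated m `]a, b[%classic -> 0 < h <= 1 -> 0 <= e ->
  measurable_fun setT A -> (forall x, `|A x| <= B) ->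
  (forall x t, a < t < b -> t <= x < t + h -> `|A x - A t| <= e) ->
  `|\int[mu]_(x in `]a, (b + 1)[) (A x * (cumul m x - cumul m (x - h)))
    - h * \int[m]_(t in `]a, b[) A t| <= e * h * fine (m setT).
Proof.
move=> mc /andP[h0 h1] e0 mA AB unifA.
pose J : set R := `]a, b + 1[%classic; pose G := A \_ J.
have mJ : measurable J by exact: measurable_itv.
have fin_mu x y : (mu `[x, y[%classic < +oo)%E.
  by rewrite /= lebesgue_measure_itv/=; case: ifP => _; rewrite ltry.
have iA (D : set R) : measurable D -> (mu D < +oo)%E -> mu.-integrable D (EFin \o A).
  by move=> mD Dfin; apply: (@integrable_bounded _ _ _ _ _ _ B) => //; exact: measurable_funTS.
have iG : mu.-integrable setT (EFin \o G).
  rewrite (_ : EFin \o G = (EFin \o A) \_ J); last exact/esym/restrict_EFin.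
  apply/(integrable_mkcond _ _).1 => //; apply: iA => //.
  by rewrite /= lebesgue_measure_itv/=; case: ifP => _; rewrite ltry.
pose S : set (measurableTypeR R * measurableTypeR R) := [set z | z.2 <= z.1 < z.2 + h].
have mS : measurable S.
  rewrite (_ : S = setT `&` (fun z => z.1 - z.2) @^-1` `[0, h[%classic); last first.
    apply/seteqP; split=> z; rewrite /S /= in_itv/= subr_ge0 ltrBlDl => // -[//].
  have : measurable_fun setT (fun z : measurableTypeR R * measurableTypeR R => z.1 - z.2).
    by apply: measurable_funB; [exact: measurable_fst|exact: measurable_snd].
  exact.
have iAh t : mu.-integrable `[t, (t + h)[ (EFin \o A).
  apply: iA; [exact: measurable_itv|exact: fin_mu].
have H1 := @fubini_section _ _ _ _ _ _ m _ _ iG mS.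
have H2 := @integrable_fubini_section _ _ _ _ _ _ m _ _ iG mS.
have xS x : xsection S x = `]x - h, x]%classic.
  apply/seteqP; split=> t; rewrite /xsection /= inE /S/= in_itv/=; lra.
pose K t := \int[mu]_(x in `[t, (t + h)[) A x.
(* As [h <= 1], every window [[t, t + h[] with [a < t < b] lies in [J]. *)
have KE t : a < t < b -> (\int[mu]_(x in ysection S t) (G x)%:E)%E = (K t)%:E.
  move=> tab; rewrite /K (EFin_Rintegral _ (iAh t))//.
  rewrite [LHS]integral_mkcond [RHS]integral_mkcond; apply: eq_integral => x _.
  rewrite !patchE /G patchE mem_ysection.
  have -> : ((x, t) \in S) = (t <= x < t + h) by apply/idP/idP; rewrite inE.
  rewrite !mem_setE !in_itv/=; case: ifP => // xt; rewrite ifT//; lra.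
have iK : m.-integrable `]a, b[ (EFin \o K).
  have H3 : m.-integrable `]a, b[ (fun t => \int[mu]_(x in ysection S t) (G x)%:E)%E.
    exact: integrableS H2.
  apply: eq_integrable H3 => // t /set_mem/=; rewrite in_itv/= => tab.
  by rewrite KE.
have -> : \int[mu]_(x in `]a, (b + 1)[) (A x * (cumul m x - cumul m (x - h))) =
    \int[m]_(t in `]a, b[) K t.
  rewrite /Rintegral; congr fine.
  transitivity (\int[mu]_x (G x * fine (m (xsection S x)))%:E)%E.
    rewrite integral_mkcond; apply: eq_integral => x _.
    rewrite patchE /G patchE; case: ifP => _; last by rewrite mul0r.
    by congr (_ * _)%:E; rewrite xS -cumulB// gerBl ltW.
  rewrite H1 (integral_null_setC _ mc H2)//; apply: eq_integral => t /set_mem/=.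
  by rewrite in_itv/= => tab; rewrite KE.
have iAm : m.-integrable `]a, b[ (EFin \o A).
  apply: (@integrable_bounded _ _ _ _ _ _ B) => //; first by rewrite ltey_eq fin_num_measure.
  exact: measurable_funTS.
have ihA : m.-integrable `]a, b[ (EFin \o (fun t => h * A t)) by exact: integrable_realZl.
rewrite -RintegralZl// -RintegralB//.
have iKD : m.-integrable `]a, b[ (EFin \o (fun t => K t - h * A t)).
  by apply: integrable_realB.
apply: le_trans (le_normr_Rintegral _ iKD) _ => //.
have cst_le : \int[m]_(t in `]a, b[) (e * h) <= e * h * fine (m setT).
  rewrite Rintegral_cst// ler_wpM2l ?mulr_ge0// ?(ltW h0)//.
  by apply: fine_le; rewrite ?fin_num_measure// le_measure ?inE.
apply: le_trans cst_le; apply: le_Rintegral => //.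
- by have := integrable_norm iKD.
- by apply: (@integrable_bounded _ _ _ _ _ _ `|e * h|) => //; rewrite ltey_eq fin_num_measure.
- move=> t /=; rewrite in_itv/= => tab.
  have muh : fine (mu `[t, t + h[%classic) = h.
    by rewrite /= lebesgue_measure_itv/= lte_fin ltrDl h0/= addrAC subrr add0r.
  have -> : h * A t = \int[mu]_(x in `[t, (t + h)[) A t by rewrite Rintegral_cst// muh mulrC.
  have iAt : mu.-integrable `[t, t + h[ (EFin \o (fun _ => A t)).
    by apply: (@integrable_bounded _ _ _ _ _ _ `|A t|) => //; exact: fin_mu.
  rewrite /K -(RintegralB _ (iAh t) iAt)//.
  have iD : mu.-integrable `[t, t + h[ (EFin \o (fun x => A x - A t)).
    by apply: integrable_realB; [exact: measurable_itv|exact: iAh|exact: iAt].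
  apply: le_trans (le_normr_Rintegral _ iD) _ => //.
  rewrite -[in leRHS]muh -Rintegral_cst//; apply: le_Rintegral => //.
  + by have := integrable_norm iD.
  + by apply: (@integrable_bounded _ _ _ _ _ _ `|e|) => //; exact: fin_mu.
  + by move=> x /=; rewrite in_itv/= => xt; exact: unifA.
Qed.

End lower_semicontinuity.

Section weak_convergence.
Context {R : realType}.
Notation mu := (@lebesgue_measure R).
Notation bmeasure := {finite_measure set (measurableTypeR R) -> \bar R}.
Implicit Types (m : bmeasure) (a b t x y h e : R) (g : R -> R).

Definition clamp a b x := Num.max a (Num.min b x).

Lemma clamp_itv a b x : a <= b -> a <= clamp a b x <= b.
Proof. by move=> ab; rewrite /clamp le_max lexx/= ge_max ab ge_min lexx. Qed.

Lemma clamp_id a b x : a <= x <= b -> clamp a b x = x.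
Proof. by move=> /andP[ax xb]; rewrite /clamp (min_idPr xb) (max_idPr ax). Qed.

Lemma clamp_lip a b x y : a <= b -> `|clamp a b x - clamp a b y| <= `|x - y|.
Proof.
move=> ab; rewrite /clamp.
have [xb|bx] := leP b x; have [yb|by_] := leP b y;
  rewrite ?(min_idPl xb) ?(min_idPr (ltW bx)) ?(min_idPl yb) ?(min_idPr (ltW by_));
  rewrite /Num.max; repeat case: ifP; rewrite !ler_norml => *; have := ler_norm (x - y);
  have := ler_norm (y - x); rewrite (distrC y); lra.
Qed.

(** Uniform continuity on a compact interval, by Bolzano-Weierstrass, for the extension of [g] that
    is constant beyond the endpoints. The bound [h <= 1] is what [fubini_moving_average] asks
    for. *)
Lemma clamp_uniform a b g : a < b -> {within `[a, b], continuous g} ->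
  forall e, 0 < e -> exists2 h, 0 < h <= 1 &
    forall x y, `|x - y| <= h -> `|g (clamp a b x) - g (clamp a b y)| <= e.
Proof.
move=> ab /subspace_continuousP cg e e0; apply: contrapT => noh.
have bad n : exists xy : R * R, `|xy.1 - xy.2| <= n.+1%:R^-1 /\
    e < `|g (clamp a b xy.1) - g (clamp a b xy.2)|.
  apply: contrapT => nbad; apply: noh; exists n.+1%:R^-1.
    by rewrite invr_gt0 ltr0n/= invf_le1 ?ler1n.
  move=> x y xy; rewrite leNgt; apply/negP => exy; apply: nbad; by exists (x, y).
have [xy xyP] := choice bad.
pose X n := clamp a b (xy n).1; pose Y n := clamp a b (xy n).2.
have bX : bounded_fun X.
  exists (`|a| + `|b|); split; first exact: num_real.
  move=> M HM n _; apply/ltW/(le_lt_trans _ HM).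
  have /andP[] := clamp_itv (xy n).1 (ltW ab); rewrite -/(X n) ler_norml.
  have := ler_norm b; have := ler_norm (- a); rewrite normrN.
  have := normr_ge0 a; have := normr_ge0 b; lra.
have [k k_inc /cvg_ex[l Xl]] := bolzano_weierstrass bX.
have lab : a <= l <= b.
  apply/andP; split.
    apply: (cvgr_to_ge Xl); near=> n.
    by have /andP[] := clamp_itv (xy (k n)).1 (ltW ab).
  apply: (cvgr_to_le Xl); near=> n.
  by have /andP[] := clamp_itv (xy (k n)).1 (ltW ab).
have e20 : 0 < e / 2 by rewrite divr_gt0.
have /cvgrPdist_le/(_ _ e20) : g x @[x --> within `[a, b]%classic (nbhs l)] --> g l.
  by apply: cg; rewrite /= in_itv.
move=> [d /= d0 dg].
have d20 : 0 < d / 2 by rewrite divr_gt0.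
have kn n : (n <= k n)%N.
  elim: n => // n IH; apply: leq_ltn_trans IH _.
  by have := k_inc n.+1 n; rewrite !leEnat ltnn ltnNge => ->.
have [N Nd] := ltr_add_invr d20; rewrite add0r in Nd.
have : \forall n \near \oo, False.
  near=> n.
  have Xn : `|l - X (k n)| < d / 2.
    by near: n; move/cvgrPdist_lt : Xl; exact.
  have [xyn exy] := xyP (k n).
  have XYn : `|X (k n) - Y (k n)| < d / 2.
    apply: le_lt_trans Nd; apply: le_trans (clamp_lip _ _ (ltW ab)) _.
    apply: le_trans xyn _; rewrite lef_pV2 ?posrE// ler_nat ltnS.
    by apply: leq_trans (kn n); near: n; exact: nbhs_infty_ge.
  have gX : `|g l - g (X (k n))| <= e / 2.
    by apply: dg; [rewrite /=; lra|rewrite /= in_itv; exact: clamp_itv (ltW ab)].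
  have gY : `|g l - g (Y (k n))| <= e / 2.
    apply: dg; last by rewrite /= in_itv; exact: clamp_itv (ltW ab).
    by move: Xn XYn; rewrite /= !ltr_norml; lra.
  move: gX gY exy; rewrite -/(X (k n)) -/(Y (k n)) ltNge => gX gY /negP; apply.
  by move: gX gY; rewrite !ler_norml; lra.
by case/filter_ex.
Unshelve. all: by end_near. Qed.

Lemma no_jump_shift (f : R -> R) h x : no_jump (fun x => f (x - h)) x -> no_jump f (x - h).
Proof.
move=> fx e /fx[y [z [yx xz fy fz]]]; exists (y - h), (z - h); split => //; lra.
Qed.

(** For a fixed window [h], moving averages replace both integrals by Lebesgue integrals of
    increments. Those of [cumul (p n)] converge to those of [f] by dominated convergence, and those
    of [f] dominate those of [cumul m]; mass lost at the endpoints can only help. *)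
Lemma stieltjes_integral_lsc a b g (p : nat -> bmeasure) m (f : R -> R) M :
  a < b -> {within `[a, b], continuous g} -> (forall x, a <= x <= b -> 0 <= g x) ->
  (forall n, concentrated (p n) `]a, b[%classic) -> concentrated m `]a, b[%classic ->
  (forall n, fine (p n setT) <= M) ->
  {homo f : x y / x <= y} ->
  (forall x, no_jump f x -> cumul (p n) x @[n --> \oo] --> f x) ->
  (forall x y, x <= y -> no_jump f x -> no_jump f y ->
    cumul m y - cumul m x <= f y - f x) ->
  forall e, 0 < e -> \forall n \near \oo,
    \int[m]_(t in `]a, b[) g t <= \int[p n]_(t in `]a, b[) g t + e.
Proof.
move=> ab cg g0 pc mc pM ndf pf mf e e0.
pose A x := g (clamp a b x).
have gA (m0 : bmeasure) : \int[m0]_(t in `]a, b[) g t = \int[m0]_(t in `]a, b[) A t.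
  apply: eq_Rintegral => t /set_mem /=; rewrite in_itv/= => tab.
  by rewrite /A clamp_id//; lra.
have [B gB] := within_continuous_bounded cg.
have AB x : `|A x| <= B by apply/gB/clamp_itv/ltW.
have A0 x : 0 <= A x by apply/g0/clamp_itv/ltW.
have cA : continuous A.
  move=> x; apply/cvgrPdist_le => d d0.
  have [h /andP[h0 _] hA] := clamp_uniform ab cg d0.
  near=> y; apply: hA; near: y; apply/nbhs_ballP; exists h => //= y.
  by rewrite /ball/= => /ltW.
have mA : measurable_fun setT A by exact: continuous_measurable_fun.
have M0 : 0 <= M by apply: le_trans (pM 0%N); exact: fine_ge0.
pose S := M + fine (m setT) + 1.
have S0 : 0 < S by rewrite ltr_wpDl// addr_ge0// fine_ge0.
(* The two averaging errors are at most [d * h] times the masses, together at most [h * (e / 2)];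
   the other half of [e] is spent on the convergence. *)
pose d := e / 2 / S; have d0 : 0 < d by rewrite !divr_gt0.
have [h h01 hA] := clamp_uniform ab cg d0; have /andP[h0 h1] := h01.
have avg (m0 : bmeasure) : concentrated m0 `]a, b[%classic ->
    `|\int[mu]_(x in `]a, (b + 1)[) (A x * (cumul m0 x - cumul m0 (x - h)))
      - h * \int[m0]_(t in `]a, b[) A t| <= d * h * fine (m0 setT).
  move=> m0c; apply: (fubini_moving_average (B := B)) => //; first exact: ltW.
  by move=> x t _ xt; apply: hA; rewrite ler_norml; lra.
pose J : set R := `]a, b + 1[%classic.
have mJ : measurable J by exact: measurable_itv.
have finJ : (mu J < +oo)%E.
  by rewrite /= lebesgue_measure_itv/=; case: ifP => _; rewrite ltry.
have mshift (f' : R -> R) : {homo f' : x y / x <= y} ->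
    measurable_fun J (fun x => A x * (f' x - f' (x - h))).
  move=> ndf'; apply: measurable_funM; first exact: measurable_funTS.
  apply: measurable_funB; apply: nondecreasing_measurable => // x y xy; apply: ndf' => //; lra.
(* The increments involve both [x] and [x - h], so jumps must be avoided at both. *)
have nj : {ae mu, forall x, no_jump f x /\ no_jump f (x - h)}.
  have ndfh : {homo (fun x => f (x - h)) : x y / x <= y} by move=> x y xy; apply: ndf; lra.
  refine (@ae2S _ _ _ mu _ _ _ _ (no_jump_ae ndf) (no_jump_ae ndfh)) => x fx /no_jump_shift fxh.
  by split.
have pbound n x : `|cumul (p n) x - cumul (p n) (x - h)| <= M.
  have xh : x - h <= x by rewrite gerBl ltW.
  have := cumul_nd (p n) xh; have := cumul_ge0 (p n) (x - h).
  have := cumul_le_mass (p n) x; have := pM n; rewrite ler_norml; lra.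
have B0 : 0 <= B by exact: le_trans (AB 0).
have Dcvg : \int[mu]_(x in J) (A x * (cumul (p n) x - cumul (p n) (x - h))) @[n --> \oo] -->
    \int[mu]_(x in J) (A x * (f x - f (x - h))).
  apply: (@Rintegral_bounded_cvg _ _ _ mu J _ _ (B * M)) => //.
  - by move=> n; apply: mshift; exact: cumul_nd.
  - exact: mshift.
  - by move=> n x _; rewrite normrM ler_pM.
  - refine (@aeS _ _ _ mu _ _ _ nj) => x [fx fxh] _.
    by apply: cvgM; [exact: cvg_cst|apply: cvgB; exact: pf].
have im (m0 : bmeasure) : mu.-integrable J (EFin \o (fun x => A x * (cumul m0 x - cumul m0 (x - h)))).
  apply: (@integrable_bounded _ _ _ _ _ _ (B * fine (m0 setT))) => //.
    by apply: mshift; exact: cumul_nd.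
  move=> x _; rewrite normrM ler_pM//.
  have xh : x - h <= x by rewrite gerBl ltW.
  have := cumul_nd m0 xh; have := cumul_ge0 m0 (x - h).
  have := cumul_le_mass m0 x; rewrite ler_norml; lra.
have iF : mu.-integrable J (EFin \o (fun x => A x * (f x - f (x - h)))).
  apply: (@integrable_bounded _ _ _ _ _ _ (B * (f (b + 1) - f (a - h)))) => //.
    exact: mshift.
  move=> x; rewrite /J/= in_itv/= => /andP[ax xb]; rewrite normrM ler_pM//.
  have xh : x - h <= x by rewrite gerBl ltW.
  have := ndf _ _ xh; have := ndf _ _ (ltW xb).
  have /ndf : a - h <= x - h by rewrite lerD2r ltW.
  rewrite ler_norml; lra.
have mF : \int[mu]_(x in J) (A x * (cumul m x - cumul m (x - h))) <=
    \int[mu]_(x in J) (A x * (f x - f (x - h))).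
  apply: le_Rintegral_ae => //.
  refine (@aeS _ _ _ mu _ _ _ nj) => x [fx fxh] _.
  by rewrite ler_wpM2l// mf// gerBl ltW.
have arith (X Y Z Im Ip mm mp : R) : - (d * h * mm) <= X - h * Im ->
    Y - h * Ip <= d * h * mp -> Z - h * (e / 2) <= Y -> X <= Z ->
    h * (d * mp + d * mm) <= h * (e / 2) -> h * Im <= h * (Ip + e).
  by clear; lra.
have he0 : 0 < h * (e / 2) by rewrite mulr_gt0// divr_gt0.
near=> n.
have F1 : \int[mu]_(x in J) (A x * (f x - f (x - h))) - h * (e / 2) <=
    \int[mu]_(x in J) (A x * (cumul (p n) x - cumul (p n) (x - h))).
  by near: n; apply: (cvgr_ge _ Dcvg); rewrite ltrBlDr ltrDl.
have := avg _ (pc n); have := avg _ mc; rewrite -/J !gA.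
rewrite !ler_norml => /andP[Fm _] /andP[_ Fp].
have dS : d * (M + fine (m setT)) <= e / 2.
  have <- : d * S = e / 2 by rewrite /d divfK// gt_eqF.
  by rewrite ler_wpM2l ?(ltW d0)// /S lerDl.
have hdS : h * (d * fine (p n setT) + d * fine (m setT)) <= h * (e / 2).
  rewrite ler_wpM2l ?(ltW h0)//; apply: le_trans dS.
  by rewrite -mulrDr ler_wpM2l ?(ltW d0)// lerD2r.
by rewrite -(ler_pM2l h0); exact: arith Fm Fp F1 mF hdS.
Unshelve. all: by end_near. Qed.

End weak_convergence.

Section bv_compactness.
Context {R : realType}.
Notation mu := (@lebesgue_measure R).
Notation bmeasure := {finite_measure set (measurableTypeR R) -> \bar R}.
Implicit Types (m : bmeasure) (a b t x y h e : R) (g : R -> R).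

Lemma cvg_subseq (u : nat -> R) (l : R) (k : nat -> nat) :
  (forall n, (n <= k n)%N) -> u n @[n --> \oo] --> l -> u (k n) @[n --> \oo] --> l.
Proof.
move=> kn ul; apply: (cvg_comp k u) ul => A [N _ NA].
by exists N => // n /= Nn; apply: NA => /=; exact: leq_trans (kn n).
Qed.

(** The conclusion covers every later selection [j], because the selections for the second sequence
    of measures and for the constants are made afterwards. *)
Lemma helly_stieltjes a b (p : nat -> bmeasure) M : a < b ->
  (forall n, concentrated (p n) `]a, b[%classic) -> (forall n, fine (p n setT) <= M) ->
  exists (k : nat -> nat) (m : bmeasure) (c : R),
  [/\ forall n, (n <= k n)%N, concentrated m `]a, b[%classic &
   forall j : nat -> nat, (forall n, (n <= j n)%N) ->
   {ae mu, forall x, `]a, b[%classic x ->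
     cumul (p (k (j n))) x @[n --> \oo] --> c + cumul m x} /\
   forall g, {within `[a, b], continuous g} -> (forall x, a <= x <= b -> 0 <= g x) ->
   forall e, 0 < e -> \forall n \near \oo,
     \int[m]_(t in `]a, b[) g t <= \int[p (k (j n))]_(t in `]a, b[) g t + e].
Proof.
move=> ab pc pM.
have pcM n x : `|cumul (p n) x| <= M by apply: le_trans (cumul_norm_le _ _) (pM n).
have [k [f [kn ndf fM pf]]] := helly (fun n => @cumul_nd _ (p n)) pcM.
have [m [c [mc mf mle]]] := stieltjes_limit ndf fM ab.
exists k, m, c; split => // j jn; split.
  refine (@aeS _ _ _ mu _ _ _ (no_jump_ae ndf)) => x fx /=; rewrite in_itv/= => xab.
  rewrite mf// addrC subrK.
  by apply: (@cvg_subseq (fun n => cumul (p (k n)) x)) => //; exact: pf.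
move=> g cg g0 e e0; apply: (stieltjes_integral_lsc (f := f) (M := M)) => // x fx.
by apply: (@cvg_subseq (fun n => cumul (p (k n)) x)) => //; exact: pf.
Qed.

Lemma bv_compact a b (c : nat -> R) (p q : nat -> bmeasure) M C : a < b ->
  (forall n, concentrated (p n) `]a, b[%classic) -> (forall n, fine (p n setT) <= M) ->
  (forall n, concentrated (q n) `]a, b[%classic) -> (forall n, fine (q n setT) <= M) ->
  (forall n, `|c n| <= C) ->
  exists (k : nat -> nat) (d : R) (m1 m2 : bmeasure),
  [/\ forall n, (n <= k n)%N,
   concentrated m1 `]a, b[%classic, concentrated m2 `]a, b[%classic,
   {ae mu, forall x, `]a, b[%classic x ->
     c (k n) + cumul (p (k n)) x - cumul (q (k n)) x @[n --> \oo] -->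
     d + cumul m1 x - cumul m2 x} &
   forall g, {within `[a, b], continuous g} -> (forall x, a <= x <= b -> 0 <= g x) ->
   forall e, 0 < e -> \forall n \near \oo,
     \int[m1]_(t in `]a, b[) g t + \int[m2]_(t in `]a, b[) g t <=
     \int[p (k n)]_(t in `]a, b[) g t + \int[q (k n)]_(t in `]a, b[) g t + e].
Proof.
move=> ab pc pM qc qM cC.
have [k1 [m1 [c1 [k1n m1c H1]]]] := helly_stieltjes ab pc pM.
have [k2 [m2 [c2 [k2n m2c H2]]]] :=
  helly_stieltjes ab (fun n => qc (k1 n)) (fun n => qM (k1 n)).
have bc : bounded_fun (fun n => c (k1 (k2 n))).
  exists C; split; first exact: num_real.
  by move=> B CB n _; exact: le_trans (cC _) (ltW CB).
have [k3 k3_inc /cvg_ex[l cl]] := bolzano_weierstrass bc.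
have k3n n : (n <= k3 n)%N.
  elim: n => // n IH; apply: leq_ltn_trans IH _.
  by have := k3_inc n.+1 n; rewrite !leEnat ltnn ltnNge => ->.
have [p_ae p_lsc] := H1 (k2 \o k3) (fun n => leq_trans (k3n n) (k2n _)).
have [q_ae q_lsc] := H2 k3 k3n.
(* [c1] and [c2] collect the mass that accumulates at [a] in the limit; for the limit function it is
   part of the constant. *)
exists (k1 \o k2 \o k3), (l + c1 - c2), m1, m2; split => //.
- by move=> n; exact: leq_trans (k3n n) (leq_trans (k2n _) (k1n _)).
- refine (@ae2S _ _ _ mu _ _ _ _ p_ae q_ae) => x px qx xab.
  have -> : l + c1 - c2 + cumul m1 x - cumul m2 x =
      l + (c1 + cumul m1 x) - (c2 + cumul m2 x) by lra.
  by apply: cvgB; [apply: cvgD => //; exact: px|exact: qx].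
- move=> g cg g0 e e0; have e20 : 0 < e / 2 by rewrite divr_gt0.
  near=> n.
  have -> : e = e / 2 + e / 2 by lra.
  have h1 : \int[m1]_(t in `]a, b[) g t <= \int[p (k1 (k2 (k3 n)))]_(t in `]a, b[) g t + e / 2.
    by near: n; exact: p_lsc.
  have h2 : \int[m2]_(t in `]a, b[) g t <= \int[q (k1 (k2 (k3 n)))]_(t in `]a, b[) g t + e / 2.
    by near: n; exact: q_lsc.
  by apply: le_trans (lerD h1 h2) _; rewrite addrACA.
Unshelve. all: by end_near. Qed.

End bv_compactness.

(** * Minimizers under a total variation constraint *)

Section energy.
Context {R : realType}.
Notation mu := (@lebesgue_measure R).
Notation bmeasure := {finite_measure set (measurableTypeR R) -> \bar R}.
Implicit Types (m : bmeasure) (a b c t x y h e : R) (f g u v alpha : R -> R).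

Definition fidelity a b f u : R := \int[mu]_(x in `]a, b[) (f x - u x) ^+ 2.

Definition weighted_variation a b alpha u : R :=
  \int[Dvariation a b u]_(x in `]a, b[) alpha x.

Definition energy a b f alpha u : R :=
  2^-1 * fidelity a b f u + weighted_variation a b alpha u.

Lemma within_continuous_integrable a b g m : {within `[a, b], continuous g} ->
  m.-integrable `]a, b[ (EFin \o g).
Proof.
move=> cg; have [B gB] := within_continuous_bounded cg.
apply: (@integrable_bounded _ _ _ _ _ _ B) => //.
- by rewrite ltey_eq fin_num_measure.
- exact: within_continuous_measurable cg.
- by move=> x /=; rewrite in_itv/= => xab; apply: gB; lra.
Qed.

Lemma integral_Dvariation a b u m1 m2 alpha :
  (forall A, measurable A -> Dvariation a b u A = (m1 A + m2 A)%E) ->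
  {within `[a, b], continuous alpha} ->
  (\int[Dvariation a b u]_(x in `]a, b[) (alpha x)%:E =
   \int[m1]_(x in `]a, b[) (alpha x)%:E + \int[m2]_(x in `]a, b[) (alpha x)%:E)%E.
Proof.
move=> DE ca; have ia m := within_continuous_integrable m ca.
rewrite -(integral_measure_add _ (ia m1) (ia m2))//.
by apply: eq_measure_integral => A mA _; rewrite DE//; exact/esym/measure_addE.
Qed.

Lemma weighted_variationE a b u m1 m2 alpha :
  (forall A, measurable A -> Dvariation a b u A = (m1 A + m2 A)%E) ->
  {within `[a, b], continuous alpha} ->
  weighted_variation a b alpha u =
  \int[m1]_(x in `]a, b[) alpha x + \int[m2]_(x in `]a, b[) alpha x.
Proof.
move=> DE ca; rewrite /weighted_variation {1}/Rintegral (integral_Dvariation DE ca).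
have ia m := within_continuous_integrable m ca.
by rewrite fineD//; [exact: integrable_fin_num (ia m1)|exact: integrable_fin_num (ia m2)].
Qed.

Lemma weighted_variation_le a b u c m1 m2 alpha : a < b -> bv_rep a b u c m1 m2 ->
  {within `[a, b], continuous alpha} -> (forall x, a <= x <= b -> 0 <= alpha x) ->
  weighted_variation a b alpha u <=
  \int[m1]_(x in `]a, b[) alpha x + \int[m2]_(x in `]a, b[) alpha x.
Proof.
move=> ab urep ca a0.
have [c' [p [q [_ [_ _ _ _ DE]]]]] := BV_bv_rep ab (bv_rep_BV ab urep).
rewrite (weighted_variationE DE ca).
have ia m := within_continuous_integrable m ca.
rewrite -lee_fin !EFinD !(EFin_Rintegral _ (ia _))//.
rewrite -(integral_Dvariation DE ca).
rewrite -(integral_measure_add _ (ia m1) (ia m2))//.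
rewrite [leLHS]integral_mkcond [leRHS]integral_mkcond.
apply: ge0_le_measure_integral => //.
- by move=> A mA; have := Dvariation_le ab urep mA; rewrite -measure_addE.
- move=> x; rewrite patchE; case: ifPn => // /set_mem/=; rewrite in_itv/= => xab.
  by rewrite lee_fin a0//; lra.
- apply/(measurable_restrictT _ _).1 => //; apply/measurable_EFinP.
  exact: within_continuous_measurable ca.
Qed.

Lemma weighted_variation_ge0 a b u alpha :
  (forall x, a <= x <= b -> 0 <= alpha x) -> 0 <= weighted_variation a b alpha u.
Proof.
by move=> a0; apply: Rintegral_ge0 => x /=; rewrite in_itv/= => xab; apply: a0; lra.
Qed.

Lemma bv_rep_bounded c m1 m2 x :
  `|c + cumul m1 x - cumul m2 x| <= `|c| + fine (m1 setT) + fine (m2 setT).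
Proof.
have := cumul_norm_le m1 x; have := cumul_norm_le m2 x.
have := ler_norm c; have := ler_norm (- c); rewrite normrN !ler_norml; lra.
Qed.

Lemma measurable_bv_fun c m1 m2 (D : set R) :
  measurable_fun D (fun x => c + cumul m1 x - cumul m2 x).
Proof.
by apply: measurable_funTS; apply: measurable_funB; [apply: measurable_funD|];
  try exact: measurable_cumul.
Qed.

Lemma itv_finite a b : (mu `]a, b[%classic < +oo)%E.
Proof. by rewrite /= lebesgue_measure_itv/=; case: ifP => _; rewrite ltry. Qed.

(** BV functions on a bounded interval are essentially bounded. *)
Lemma BV_integrableM a b u v : a < b -> BV a b u -> BV a b v ->
  mu.-integrable `]a, b[ (EFin \o (fun x => u x * v x)).
Proof.
move=> ab /(BV_bv_rep ab)[c [p [q [_ [[mu_u _ _ uE] _ _ _ _]]]]].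
move=> /(BV_bv_rep ab)[d [r [s [_ [[mv _ _ vE] _ _ _ _]]]]].
pose U x := c + cumul p x - cumul q x; pose V x := d + cumul r x - cumul s x.
have iUV : mu.-integrable `]a, b[ (EFin \o (fun x => U x * V x)).
  apply: (@integrable_bounded _ _ _ _ _ _ ((`|c| + fine (p setT) + fine (q setT)) *
    (`|d| + fine (r setT) + fine (s setT)))) => //; first exact: itv_finite.
  - by apply: measurable_funM; exact: measurable_bv_fun.
  - by move=> x _; rewrite normrM ler_pM// bv_rep_bounded.
apply: integrable_ae_eq iUV => //; first exact: measurable_funM.
by refine (@ae2S _ _ _ mu _ _ _ _ uE vE) => x ux vx xab; rewrite ux// vx.
Qed.

Lemma BV_integrable_sqB a b f u : a < b -> BV a b f -> BV a b u ->
  mu.-integrable `]a, b[ (EFin \o (fun x => (f x - u x) ^+ 2)).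
Proof.
move=> ab fBV uBV.
rewrite (_ : (fun x => _) = fun x => f x * f x - (2 * (f x * u x)) + u x * u x); last first.
  by apply/funext => x; lra.
apply: integrable_realD => //; last exact: BV_integrableM.
apply: integrable_realB => //; first exact: BV_integrableM.
by apply: integrable_realZl => //; exact: BV_integrableM.
Qed.

(** The functional is finite on BV, so that minimisation can be carried out with real numbers. *)
Lemma weightedTV_functionalE a b f alpha u : a < b -> BV a b f -> BV a b u ->
  {within `[a, b], continuous alpha} ->
  weightedTV_functional a b f alpha u = (energy a b f alpha u)%:E.
Proof.
move=> ab fBV uBV ca; rewrite /weightedTV_functional /energy EFinD EFinM; congr (_ * _ + _)%E.
  by rewrite /fidelity EFin_Rintegral//; exact: BV_integrable_sqB.
have [c [p [q [_ [_ _ _ _ DE]]]]] := BV_bv_rep ab uBV.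
rewrite (integral_Dvariation DE ca) (weighted_variationE DE ca) EFinD.
by rewrite !EFin_Rintegral//; exact: within_continuous_integrable.
Qed.

End energy.

Section constrained_minimizer.
Context {R : realType}.
Notation mu := (@lebesgue_measure R).
Notation bmeasure := {finite_measure set (measurableTypeR R) -> \bar R}.
Implicit Types (m : bmeasure) (a b c t x y h e M : R) (f g u v alpha : R -> R).

Definition total_variation_le a b M : set (R -> R) :=
  [set u | BV a b u /\ weighted_variation a b (cst 1) u <= M].

Lemma BV0 a b : a < b -> BV a b (cst 0) /\
  forall alpha, weighted_variation a b alpha (cst 0) = 0.
Proof.
move=> ab; pose z : bmeasure := mzero.
have zrep : bv_rep a b (cst 0) 0 z z.
  split => //; apply: aeW => x _; rewrite /cumul /=; lra.
split => [|alpha]; first exact: bv_rep_BV zrep.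
rewrite /weighted_variation /Rintegral.
rewrite (_ : integral _ _ _ = 0%E)//.
rewrite (@eq_measure_integral _ _ _ _ z); first exact: integral_measure_zero.
move=> A mA _; apply/eqP; rewrite eq_le measure_ge0 andbT.
by have := Dvariation_le ab zrep mA; rewrite /z /= /mzero adde0.
Qed.

Lemma total_massE a b m : concentrated m `]a, b[%classic ->
  \int[m]_(x in `]a, b[) cst 1 x = fine (m setT).
Proof.
move=> mc; rewrite Rintegral_cst// mul1r (concentratedI mc (measurable_itv _) measurableT).
by rewrite setTI.
Qed.

(** Keeps the constants of a minimizing sequence bounded: [c] is the difference of a quantity
    bounded by [M1 + M2 + M2] and of [f - w], whose square has integral at most [K]. Squaring,
    averaging over the interval and [|c| <= c ^+ 2 + 1] give the bound. *)
Lemma mean_value_bound a b f M1 M2 K c (m1 m2 : bmeasure) : a < b ->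
  (forall x, `|f x| <= M1) -> fine (m1 setT) <= M2 -> fine (m2 setT) <= M2 ->
  measurable_fun `]a, b[ f ->
  \int[mu]_(x in `]a, b[) (f x - (c + cumul m1 x - cumul m2 x)) ^+ 2 <= K ->
  `|c| <= 2 * K / (b - a) + 2 * (M1 + M2 + M2) ^+ 2 + 1.
Proof.
move=> ab fM m1M m2M mf IK.
have ba : 0 < b - a by rewrite subr_gt0.
pose w x := c + cumul m1 x - cumul m2 x; pose N := `|c| + fine (m1 setT) + fine (m2 setT).
have wN x : `|w x| <= N by exact: bv_rep_bounded.
have M10 : 0 <= M1 by exact: le_trans (fM 0).
have N0 : 0 <= N by exact: le_trans (wN 0).
have isq : mu.-integrable `]a, b[ (EFin \o (fun x => (f x - w x) ^+ 2)).
  apply: (@integrable_bounded _ _ _ _ _ _ ((M1 + N) ^+ 2)) => //; first exact: itv_finite.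
  - apply: measurable_funX; apply: measurable_funB => //; exact: measurable_bv_fun.
  - move=> x _; rewrite normrX lerXn2r ?nnegrE//.
      by rewrite addr_ge0.
    by rewrite (le_trans (ler_normB _ _))// lerD.
have cle x : c ^+ 2 <= 2 * (f x - w x) ^+ 2 + 2 * (M1 + M2 + M2) ^+ 2.
  have := fM x; have := cumul_norm_le m1 x; have := cumul_norm_le m2 x.
  rewrite !ler_norml /w; set F := cumul m1 x; set G := cumul m2 x; set y := f x.
  move=> hG hF hy.
  have h1 : (y - F + G) ^+ 2 <= (M1 + M2 + M2) ^+ 2.
    rewrite -[leLHS]real_normK ?num_real// lerXn2r ?nnegrE//; last by rewrite ler_norml; lra.
    lra.
  have h2 := sqr_ge0 ((y - (c + F - G)) + (y - F + G)).
  have : c ^+ 2 = ((y - F + G) - (y - (c + F - G))) ^+ 2 by congr (_ ^+ 2); lra.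
  nra.
have icst (r : R) : mu.-integrable `]a, b[ (EFin \o cst r).
  by apply: (@integrable_bounded _ _ _ _ _ _ `|r|) => //; exact: itv_finite.
have muab : fine (mu `]a, b[%classic) = b - a.
  by rewrite /= lebesgue_measure_itv/= lte_fin ab.
have c2 : c ^+ 2 * (b - a) <= 2 * K + 2 * (M1 + M2 + M2) ^+ 2 * (b - a).
  have : \int[mu]_(x in `]a, b[) (cst (c ^+ 2) x) <=
     \int[mu]_(x in `]a, b[) (2 * (f x - w x) ^+ 2 + cst (2 * (M1 + M2 + M2) ^+ 2) x).
    apply: le_Rintegral => //.
    by apply: integrable_realD => //; exact: integrable_realZl.
  rewrite RintegralD//; last exact: integrable_realZl.
  rewrite RintegralZl// !Rintegral_cst// muab => /le_trans; apply.
  by rewrite lerD2r ler_pM2l.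
have c2' : c ^+ 2 <= 2 * K / (b - a) + 2 * (M1 + M2 + M2) ^+ 2.
  by rewrite -(ler_pM2r ba) mulrDl divfK ?gt_eqF.
apply: (@le_trans _ _ (c ^+ 2 + 1)); last by rewrite lerD2r.
rewrite ler_norml; have := sqr_ge0 (c - 1); have := sqr_ge0 (c + 1); nra.
Qed.

Lemma exists_constrained_minimizer a b f alpha M : a < b -> BV a b f -> 0 <= M ->
  {within `[a, b], continuous alpha} -> (forall x, a <= x <= b -> 0 <= alpha x) ->
  exists2 u, total_variation_le a b M u &
    forall v, total_variation_le a b M v -> energy a b f alpha u <= energy a b f alpha v.
Proof.
move=> ab fBV M0 ca a0; pose S := [set energy a b f alpha v | v in total_variation_le a b M].
have E_ge0 u : 0 <= energy a b f alpha u.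
  rewrite addr_ge0 ?weighted_variation_ge0// mulr_ge0//.
  by apply: Rintegral_ge0 => x _; exact: sqr_ge0.
have infS : has_inf S.
  split; last by exists 0 => _ [v _ <-].
  exists (energy a b f alpha (cst 0)), (cst 0) => //; have [? T0] := BV0 ab; split => //.
  by rewrite T0.
have useq n : exists u, total_variation_le a b M u /\ energy a b f alpha u <= inf S + n.+1%:R^-1.
  have n0 : 0 < n.+1%:R^-1 :> R by rewrite invr_gt0.
  by have [_ [u uM <-] /ltW uE] := inf_adherent n0 infS; exists u.
have [u uP] := choice useq.
have repseq n : exists cpq : R * bmeasure * bmeasure,
    bv_rep a b (u n) cpq.1.1 cpq.1.2 cpq.2 /\
    forall A, measurable A -> Dvariation a b (u n) A = (cpq.1.2 A + cpq.2 A)%E.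
  have [c [p [q [P [urep _ _ _ uD]]]]] := BV_bv_rep ab (uP n).1.1.
  by exists (c, p, q).
have [cpq cpqP] := choice repseq.
pose c n := (cpq n).1.1; pose p n := (cpq n).1.2; pose q n := (cpq n).2.
have urep n : bv_rep a b (u n) (c n) (p n) (q n) by exact: (cpqP n).1.
have uD n := (cpqP n).2; rewrite -/(p _) -/(q _) in uD.
have pc n : concentrated (p n) `]a, b[%classic by have [] := urep n.
have qc n : concentrated (q n) `]a, b[%classic by have [] := urep n.
have c1 : {within `[a, b], continuous (cst 1 : R -> R)} by apply: continuous_subspaceT; exact: cst_continuous.
have TE n : weighted_variation a b (cst 1) (u n) = fine (p n setT) + fine (q n setT).
  by rewrite (weighted_variationE (uD n) c1) (total_massE (pc n)) (total_massE (qc n)).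
have pM n : fine (p n setT) <= M.
  by apply: le_trans (uP n).1.2; rewrite TE lerDl fine_ge0.
have qM n : fine (q n setT) <= M.
  by apply: le_trans (uP n).1.2; rewrite TE lerDr fine_ge0.
have [cf [pf [qf [_ [[mf _ _ fE] _ _ _ _]]]]] := BV_bv_rep ab fBV.
(* A representative of [f] that is bounded everywhere, so that constants can serve as dominating
   functions. *)
pose F x := cf + cumul pf x - cumul qf x; pose Mf := `|cf| + fine (pf setT) + fine (qf setT).
have FM x : `|F x| <= Mf by exact: bv_rep_bounded.
have mF : measurable_fun `]a, b[ F by exact: measurable_bv_fun.
have fidE v d (r s : bmeasure) : bv_rep a b v d r s ->
    fidelity a b f v = \int[mu]_(x in `]a, b[) (F x - (d + cumul r x - cumul s x)) ^+ 2.
  move=> [mv _ _ vE]; apply: eq_Rintegral_ae => //.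
  - by apply: measurable_funX; exact: measurable_funB.
  - by apply: measurable_funX; apply: measurable_funB => //; exact: measurable_bv_fun.
  - by refine (@ae2S _ _ _ mu _ _ _ _ fE vE) => x fx vx xab; rewrite fx// vx.
(* The energy is at most [inf S + 1] along the sequence and the variation term is nonnegative. *)
have fid_le n : fidelity a b f (u n) <= 2 * (inf S + 1).
  have := (uP n).2; have : n.+1%:R^-1 <= 1 :> R by rewrite invf_le1 ?ler1n.
  have := weighted_variation_ge0 (u n) a0; rewrite /energy.
  move: (fidelity _ _ _ _) (weighted_variation _ _ _ _) (inf S) (n.+1%:R^-1).
  by clear=> x y z r; lra.
have cC n : `|c n| <= 2 * (2 * (inf S + 1)) / (b - a) + 2 * (Mf + M + M) ^+ 2 + 1.
  by apply: (mean_value_bound ab FM (pM n) (qM n)) => //; rewrite -(fidE _ _ _ _ (urep n)).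
have [k [d [m1 [m2 [kn m1c m2c uae ulsc]]]]] := bv_compact ab pc pM qc qM cC.
pose us x := d + cumul m1 x - cumul m2 x.
have usrep : bv_rep a b us d m1 m2.
  by split => //; [exact: measurable_bv_fun|exact: aeW].
have usBV := bv_rep_BV ab usrep.
exists us.
  split => //; apply/ler_addgt0Pr => e e0.
  apply: le_trans (weighted_variation_le ab usrep c1 _) _ => //.
  have [n /= ne] := filter_ex (ulsc _ c1 (fun _ _ => ler01) e e0).
  apply: le_trans ne _; rewrite lerD2r.
  by rewrite !total_massE// -TE; exact: (uP (k n)).1.2.
set C := 2 * _ / _ + _ + _ in cC.
have Mf0 : 0 <= Mf by exact: le_trans (FM 0).
have C0 : 0 <= C by exact: le_trans (cC 0%N).
(* The fidelity actually converges: constants and masses are bounded, so domination is by a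
   constant. Only the variation term needs lower semicontinuity. *)
have fid_cvg : fidelity a b f (u (k n)) @[n --> \oo] --> fidelity a b f us.
  rewrite (fidE _ _ _ _ usrep); under eq_fun do rewrite (fidE _ _ _ _ (urep _)).
  apply: (@Rintegral_bounded_cvg _ _ _ mu _ _ _ ((Mf + (C + M + M)) ^+ 2)) => //.
  - exact: itv_finite.
  - by move=> n; apply: measurable_funX; apply: measurable_funB => //; exact: measurable_bv_fun.
  - by apply: measurable_funX; apply: measurable_funB => //; exact: measurable_bv_fun.
  - move=> n x _; rewrite normrX lerXn2r ?nnegrE//.
      by apply: addr_ge0 => //; apply: addr_ge0 => //; exact: addr_ge0.
    rewrite (le_trans (ler_normB _ _))// lerD//.
    by apply: le_trans (bv_rep_bounded _ _ _ _) _; rewrite !lerD.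
  - refine (@aeS _ _ _ mu _ _ _ uae) => x ux xab.
    have cvg_diff : F x - (c (k n) + cumul (p (k n)) x - cumul (q (k n)) x) @[n --> \oo] -->
        F x - us x.
      by apply: cvgB; [exact: cvg_cst|exact: ux].
    by rewrite expr2; under eq_fun do rewrite expr2; apply: cvgM; exact: cvg_diff.
move=> v vM; apply: (@le_trans _ _ (inf S)); last by apply: ge_inf; [exact: infS.2|exists v].
apply/ler_addgt0Pr => e e0; have e30 : 0 < e / 3 by rewrite divr_gt0.
have [N Ne] := ltr_add_invr e30; rewrite add0r in Ne.
have arith (X Xn Y Yn r I d0 : R) : 0 < d0 -> X - d0 / 3 <= Xn -> Y <= Yn + d0 / 3 ->
    r <= d0 / 3 -> 2^-1 * Xn + Yn <= I + r -> 2^-1 * X + Y <= I + d0.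
  by clear; lra.
have : \forall n \near \oo, energy a b f alpha us <= inf S + e.
  near=> n.
  have h1 : fidelity a b f us - e / 3 <= fidelity a b f (u (k n)).
    by near: n; apply: (cvgr_ge _ fid_cvg); rewrite ltrBlDr ltrDl.
  have h2 : weighted_variation a b alpha us <= weighted_variation a b alpha (u (k n)) + e / 3.
    apply: le_trans (weighted_variation_le ab usrep ca a0) _.
    by rewrite (weighted_variationE (uD (k n)) ca); near: n; exact: ulsc.
  have h3 : (k n).+1%:R^-1 <= e / 3.
    apply: le_trans (ltW Ne); rewrite lef_pV2 ?posrE// ler_nat ltnS.
    by apply: leq_trans (kn n); near: n; exact: nbhs_infty_ge.
  exact: arith e0 h1 h2 h3 (uP (k n)).2.
by case/filter_ex.
Unshelve. all: by end_near. Qed.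

End constrained_minimizer.

(** * The total variation of minimizers *)

Section superlevel_comparison.
Context {R : realType}.
Notation mu := (@lebesgue_measure R).
Notation bmeasure := {finite_measure set (measurableTypeR R) -> \bar R}.
Implicit Types (a b c s t r x y N : R) (h : R -> R).

Definition tail b h t : R := \int[mu]_(x in `[t, b[) h x.

Definition tail_superlevel a b h : set R := [set t | a < t < b /\ 0 < tail b h t].

Lemma co_itv_finite s t : (mu `[s, t[%classic < +oo)%E.
Proof. by rewrite /= lebesgue_measure_itv/=; case: ifP => _; rewrite ltry. Qed.

Section tail_theory.
Variables (b N : R) (h : R -> R).
Hypotheses (mh : measurable_fun setT h) (hN : forall x, `|h x| <= N).

Let ih s t : mu.-integrable `[s, t[ (EFin \o h).
Proof.
apply: (@integrable_bounded _ _ _ _ _ _ N) => //; first exact: co_itv_finite.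
exact: measurable_funTS.
Qed.

Lemma tailB s t : s <= t <= b -> tail b h s - tail b h t = \int[mu]_(x in `[s, t[) h x.
Proof.
move=> /andP[st tb]; rewrite /tail.
have E : `[s, b[%classic = `[s, t[%classic `|` `[t, b[%classic :> set R.
  by rewrite -itv_bndbnd_setU// bnd_simp.
rewrite E Rintegral_setU//; first by rewrite addrK.
- by rewrite -E.
- apply/disj_setPS => x [] /=; rewrite !in_itv/= => /andP[_ xt] /andP[tx _].
  by move: (lt_le_trans xt tx); rewrite ltxx.
Qed.

Lemma tail_lip s t : s <= t <= b -> `|tail b h s - tail b h t| <= N * (t - s).
Proof.
move=> stb; have /andP[st tb] := stb; rewrite tailB//.
apply: le_trans (le_normr_Rintegral _ (ih s t)) _ => //.
have muE : fine (mu `[s, t[%classic) = t - s.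
  rewrite /= lebesgue_measure_itv/= lte_fin; case: ltP => // ts /=.
  by apply/esym/eqP; rewrite subr_eq0 eq_le ts st.
rewrite -muE -Rintegral_cst//; apply: le_Rintegral => //.
- by have := integrable_norm (ih s t).
- by apply: (@integrable_bounded _ _ _ _ _ _ `|N|) => //; exact: co_itv_finite.
Qed.

Lemma Rintegral_co_le0 s t : (forall x, s <= x < t -> h x <= 0) ->
  \int[mu]_(x in `[s, t[) h x <= 0.
Proof.
move=> h0; rewrite -oppr_ge0 -mulN1r -RintegralZl//; apply: Rintegral_ge0 => x /=.
by rewrite in_itv/= => /h0; rewrite mulN1r oppr_ge0.
Qed.

Lemma Rintegral_co_ge0 s t : (forall x, s <= x < t -> 0 <= h x) ->
  0 <= \int[mu]_(x in `[s, t[) h x.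
Proof. by move=> h0; apply: Rintegral_ge0 => x /=; rewrite in_itv/= => /h0. Qed.

Lemma open_tail_superlevel a : open (tail_superlevel a b h).
Proof.
rewrite openE => t /= [/andP[at_ tb] t0]; rewrite /interior /=.
have N0 : 0 <= N by exact: le_trans (hN 0).
apply/nbhs_ballP; exists (Num.min (Num.min (t - a) (b - t)) (tail b h t / (N + 1))) => /=.
  by rewrite !lt_min !subr_gt0 at_ tb divr_gt0// ltr_wpDl.
move=> y; rewrite /ball/= !lt_min => /andP[/andP[ya yb] yt].
have ab_y : a < y < b by move: ya yb; rewrite !ltr_norml; lra.
split => //.
have d : `|tail b h t - tail b h y| <= N * `|t - y|.
  have [ty|yt'] := leP t y.
    have -> : `|t - y| = y - t by rewrite distrC ger0_norm ?subr_ge0.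
    by apply: tail_lip; lra.
  have -> : `|t - y| = t - y by rewrite ger0_norm ?subr_ge0// ltW.
  by rewrite distrC; apply: tail_lip; lra.
have : N * `|t - y| < tail b h t.
  rewrite ltr_pdivlMr ?ltr_wpDl// in yt; apply: le_lt_trans yt.
  by rewrite mulrC ler_wpM2l// lerDl.
by move: d; rewrite ler_norml; lra.
Qed.

End tail_theory.

(** Here [m1 - m2] is the derivative of [h]. The tail grows away from [s], so [h s <= 0]. If [m2]
    exceeded [m1] on []s, r[], then [h] would be at most [h s] near [r], and the tail could not stay
    positive up to [r]. *)
Lemma component_comparison (m1 m2 : bmeasure) b c s r : s < r -> r <= b ->
  let h x := c + cumul m1 x - cumul m2 x in
  tail b h s <= 0 -> tail b h r <= 0 -> (forall y, s < y < r -> 0 < tail b h y) ->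
  (m2 `]s, r[%classic <= m1 `]s, r[%classic)%E.
Proof.
move=> sr rb h hs hr hpos.
have mh : measurable_fun setT h by exact: measurable_bv_fun.
have hN x : `|h x| <= `|c| + fine (m1 setT) + fine (m2 setT) by exact: bv_rep_bounded.
(* If [h s > 0], right-continuity keeps [h] positive just after [s], and the tail there would be at
   most its value at [s]. *)
have hs0 : h s <= 0.
  rewrite leNgt; apply/negP => hs_pos.
  have rc : h y @[y --> s^'+] --> h s.
    apply: cvgB; last exact: cumul_right_continuous.
    by apply: cvgD; [exact: cvg_cst|exact: cumul_right_continuous].
  have /cvgrPdist_lt/(_ _ hs_pos)[d /= d0 hd] := rc.
  pose y := s + Num.min (d / 2) ((r - s) / 2).
  have dr0 : 0 < Num.min (d / 2) ((r - s) / 2) by rewrite lt_min !divr_gt0// subr_gt0.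
  have sy : s < y by rewrite /y ltrDl.
  have yd : y < s + d by rewrite /y ltrD2l gt_min; apply/orP; left; lra.
  have yr : y < r by rewrite /y -ltrBrDl gt_min; apply/orP; right; lra.
  have : 0 <= \int[mu]_(x in `[s, y[) h x.
    apply: Rintegral_co_ge0 => x /andP[sx xy].
    have [->|xs] := eqVneq x s; first exact: ltW.
    have sx' : s < x by rewrite lt_neqAle eq_sym xs.
    have : `|h s - h x| < h s by apply: hd => //=; rewrite ltr_norml; lra.
    by rewrite ltr_norml; lra.
  rewrite -(tailB (b := b) mh hN); last by rewrite (ltW sy)/=; lra.
  by have := hpos y; rewrite sy yr => /(_ isT); lra.
rewrite leNgt; apply/negP => m12.
(* Continuity from below makes the excess of [m2] visible on some []s, y0]] with [y0 < r]; it
   persists at all later points because [m1] is compared on the whole of []s, r[]. *)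
have [y0 [sy0 y0r my0]] : exists y, [/\ s < y, y < r &
    (m1 `]s, r[%classic < m2 `]s, y]%classic)%E].
  apply: contrapT => ny.
  pose F n : set (measurableTypeR R) := `]s, r - n.+1%:R^-1]%classic.
  have cupF : \bigcup_n F n = `]s, r[%classic.
    apply/seteqP; split=> z /=; rewrite ?in_itv/=.
      move=> [n _]; rewrite /F/= in_itv/= => /andP[-> /= zr].
      by apply: le_lt_trans zr _; rewrite ltrBlDr ltrDl invr_gt0.
    move=> /andP[sz zr]; have [n nr] := ltr_add_invr zr; exists n => //.
    by rewrite /F/= in_itv/= sz lerBrDr ltW.
  have mF n : measurable (F n) by exact: measurable_itv.
  have Fcvg : m2 (F n) @[n --> \oo] --> m2 `]s, r[%classic.
    rewrite -cupF; apply: nondecreasing_cvg_mu => //.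
    - by rewrite cupF; exact: measurable_itv.
    - move=> n k nk; apply/subsetPset; apply: subset_itvl; rewrite bnd_simp lerD2l lerN2.
      by rewrite lef_pV2 ?posrE// ler_nat ltnS.
  have : (m2 `]s, r[%classic <= m1 `]s, r[%classic)%E.
    rewrite -(cvg_lim _ Fcvg)//; apply: lime_le; first by apply/cvg_ex; exists (m2 `]s, r[%classic).
    apply: nearW => n; rewrite leNgt; apply/negP => mn; apply: ny.
    exists (r - n.+1%:R^-1); split => //.
      rewrite ltNge; apply/negP => rs; have F0 : F n = set0.
        by rewrite /F set_itv_ge// bnd_simp -leNgt.
      by move: mn; rewrite F0 measure0 ltNge measure_ge0.
    by rewrite ltrBlDr ltrDl invr_gt0.
  by rewrite leNgt m12.
have hneg y : y0 <= y < r -> h y <= 0.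
  move=> /andP[y0y yr]; apply: le_trans hs0; rewrite /h.
  have sy : s <= y by exact: le_trans (ltW sy0) y0y.
  have e1 : (cumul m1 y - cumul m1 s)%:E = m1 `]s, y]%classic by rewrite cumulB.
  have e2 : (cumul m2 y - cumul m2 s)%:E = m2 `]s, y]%classic by rewrite cumulB.
  have : (m1 `]s, y]%classic <= m2 `]s, y]%classic)%E.
    apply: (@le_trans _ _ (m1 `]s, r[%classic)).
      by apply: le_measure; rewrite ?inE// => z /=; rewrite !in_itv/=; lra.
    apply: (le_trans (ltW my0)).
    by apply: le_measure; rewrite ?inE// => z /=; rewrite !in_itv/=; lra.
  by rewrite -e1 -e2 lee_fin; lra.
have := Rintegral_co_le0 mh hN hneg; rewrite -(tailB (b := b) mh hN); last by rewrite (ltW y0r).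
by have := hpos y0; rewrite sy0 y0r => /(_ isT); lra.
Qed.

Lemma open_interval_endpoints (I : set R) a b : open I -> is_interval I ->
  I !=set0 -> I `<=` `]a, b[%classic ->
  exists s r, [/\ a <= s, s < r, r <= b & I = `]s, r[%classic].
Proof.
move=> oI itvI I0 Iab; have [i0 Ii0] := I0.
have ubI : has_ubound I by exists b => x /Iab/=; rewrite in_itv/= => /andP[_ /ltW].
have lbI : has_lbound I by exists a => x /Iab/=; rewrite in_itv/= => /andP[/ltW].
have Ilt x : I x -> exists2 y, I y & y < x.
  move=> Ix; have /nbhs_ballP[e /= e0 xe] := open_nbhs_nbhs (conj oI Ix).
  exists (x - e / 2); last by rewrite ltrBlDr ltrDl divr_gt0.
  by apply: xe; rewrite /ball/= opprB addrC subrK ger0_norm; lra.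
have Igt x : I x -> exists2 y, I y & x < y.
  move=> Ix; have /nbhs_ballP[e /= e0 xe] := open_nbhs_nbhs (conj oI Ix).
  exists (x + e / 2); last by rewrite ltrDl divr_gt0.
  by apply: xe; rewrite /ball/= opprD addrA subrr sub0r normrN ger0_norm; lra.
have infI x : I x -> inf I < x.
  by move=> /Ilt[y Iy yx]; apply: le_lt_trans yx; exact: ge_inf.
have supI x : I x -> x < sup I.
  by move=> /Igt[y Iy xy]; apply: lt_le_trans xy _; exact: ub_le_sup.
exists (inf I), (sup I); split.
- by apply: lb_le_inf => // x /Iab/=; rewrite in_itv/= => /andP[/ltW].
- by apply: lt_trans (infI _ Ii0) (supI _ Ii0).
- by apply: sup_le_ub => // x /Iab/=; rewrite in_itv/= => /andP[_ /ltW].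
- apply/seteqP; split=> x /=; first by move=> Ix; rewrite in_itv/= infI ?supI.
  rewrite in_itv/= => /andP[ix xs].
  have [y Iy yx] := inf_lt I0 ix.
  have [z Iz xz] := sup_gt I0 xs.
  by apply: (itvI _ _ Iy Iz); rewrite !ltW.
Qed.

(** Countable additivity over the components of the open superlevel set. The condition at [a] is
    one-sided; at [b] the tail vanishes by definition. *)
Lemma superlevel_comparison (m1 m2 : bmeasure) a b c :
  let h x := c + cumul m1 x - cumul m2 x in
  tail b h a <= 0 ->
  (m2 (tail_superlevel a b h) <= m1 (tail_superlevel a b h))%E.
Proof.
move=> h ha; set G := tail_superlevel a b h.
have mh : measurable_fun setT h by exact: measurable_bv_fun.
have hN x : `|h x| <= `|c| + fine (m1 setT) + fine (m2 setT) by exact: bv_rep_bounded.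
have oG : open G by exact: open_tail_superlevel mh hN a.
pose I := open_disjoint_itv oG.
have GI : G = \bigcup_n I n by exact: open_disjoint_itv_bigcup.
have oI n : open (I n) by exact: open_disjoint_itv_open.
have mI n : measurable (I n : set (measurableTypeR R)) by exact: open_measurable.
have tI : trivIset setT I by exact: open_disjoint_itv_trivIset.
have IG n : I n `<=` G by rewrite GI; exact: bigcup_sup.
have hb : tail b h b = 0 by rewrite /tail set_itv_ge ?Rintegral_set0// bnd_simp ltxx.
(* A point adherent to a component but outside it cannot have a positive tail: it would lie in
   another component, and this open set would meet the first. *)
have ends n z : I n !=set0 -> ~ I n z -> a <= z <= b ->
    (forall e, 0 < e -> exists2 y, I n y & `|z - y| < e) -> tail b h z <= 0.
  move=> In0 Inz /andP[az zb] zI; rewrite leNgt; apply/negP => z0.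
  have az' : a < z.
    by rewrite lt_neqAle az andbT; apply/eqP => az'; move: z0; rewrite -az' ltNge ha.
  have zb' : z < b.
    by rewrite lt_neqAle zb andbT; apply/eqP => zb'; move: z0; rewrite zb' hb ltxx.
  have : G z by split => //; rewrite az' zb'.
  rewrite GI => -[k _ Ikz].
  have /nbhs_ballP[e /= e0 ze] := open_nbhs_nbhs (conj (oI k) Ikz).
  have [y Iny zy] := zI e e0.
  have kn : k = n by apply: (tI k n) => //; exists y; split => //; exact: ze.
  by apply: Inz; rewrite -kn.
have main n : (m2 (I n) <= m1 (I n))%E.
  have [->|/set0P In0] := eqVneq (I n) set0; first by rewrite !measure0.
  have Iab : I n `<=` `]a, b[%classic.
    by move=> x /IG[xab _]; rewrite /= in_itv.
  have [s [r [as_ sr rb Isr]]] := open_interval_endpoints (oI n)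
    (@open_disjoint_itv_is_interval _ _ oG n) In0 Iab.
  have Isr' y : s < y < r -> I n y by rewrite Isr /= in_itv.
  rewrite Isr; apply: (@component_comparison m1 m2 b c s r) => //.
  - apply: (ends n) => //; first by rewrite Isr /= in_itv/= ltxx.
      by rewrite as_/=; lra.
    move=> e e0; pose y := s + Num.min (e / 2) ((r - s) / 2).
    have d0 : 0 < Num.min (e / 2) ((r - s) / 2) by rewrite lt_min !divr_gt0// subr_gt0.
    have d1 : Num.min (e / 2) ((r - s) / 2) <= e / 2 by rewrite ge_min lexx.
    have d2 : Num.min (e / 2) ((r - s) / 2) <= (r - s) / 2 by rewrite ge_min lexx orbT.
    by exists y; [apply: Isr'; rewrite /y; lra|rewrite /y ltr_norml; lra].
  - apply: (ends n) => //; first by rewrite Isr /= in_itv/= ltxx andbF.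
      by rewrite rb andbT; lra.
    move=> e e0; pose y := r - Num.min (e / 2) ((r - s) / 2).
    have d0 : 0 < Num.min (e / 2) ((r - s) / 2) by rewrite lt_min !divr_gt0// subr_gt0.
    have d1 : Num.min (e / 2) ((r - s) / 2) <= e / 2 by rewrite ge_min lexx.
    have d2 : Num.min (e / 2) ((r - s) / 2) <= (r - s) / 2 by rewrite ge_min lexx orbT.
    by exists y; [apply: Isr'; rewrite /y; lra|rewrite /y ltr_norml; lra].
  - by move=> y /Isr'/IG[].
rewrite GI !measure_bigcup//.
apply: lee_nneseries => [n _ _|n _]; first exact: measure_ge0.
exact: (main n).
Qed.

End superlevel_comparison.

Section convexity.
Context {R : realType}.
Notation mu := (@lebesgue_measure R).
Notation bmeasure := {finite_measure set (measurableTypeR R) -> \bar R}.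
Implicit Types (m : bmeasure) (a b c t x y M : R) (f g u v alpha : R -> R).

Lemma cumul_scale (r : {nonneg R}) m x :
  cumul (fmeasure_scale r m) x = r%:num * cumul m x.
Proof. by apply: EFin_inj; rewrite EFinM !cumulE fmeasure_scaleE. Qed.

Lemma concentrated_scale (r : {nonneg R}) m (D : set R) :
  concentrated m D -> concentrated (fmeasure_scale r m) D.
Proof. by rewrite /concentrated fmeasure_scaleE => ->; rewrite mule0. Qed.

Lemma Rintegral_fmeasure_add m1 m2 a b g : {within `[a, b], continuous g} ->
  \int[fmeasure_add m1 m2]_(x in `]a, b[) g x =
  \int[m1]_(x in `]a, b[) g x + \int[m2]_(x in `]a, b[) g x.
Proof.
move=> cg; have ig m := within_continuous_integrable m cg.
apply: EFin_inj; rewrite EFinD !(EFin_Rintegral _ (ig _))//.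
by rewrite -(integral_measure_add _ (ig m1) (ig m2)).
Qed.

Lemma Rintegral_fmeasure_scale (r : {nonneg R}) m a b g :
  {within `[a, b], continuous g} -> (forall x, a <= x <= b -> 0 <= g x) ->
  \int[fmeasure_scale r m]_(x in `]a, b[) g x = r%:num * \int[m]_(x in `]a, b[) g x.
Proof.
move=> cg g0; have ig m' := within_continuous_integrable m' cg.
apply: EFin_inj; rewrite EFinM !(EFin_Rintegral _ (ig _))//.
apply: ge0_integral_mscale => //.
- by apply/measurable_EFinP; exact: within_continuous_measurable cg.
- by move=> x /=; rewrite in_itv/= => xab; rewrite lee_fin g0//; lra.
Qed.

Lemma bv_rep_conv a b u v c d p q r s t : 0 <= t <= 1 ->
  bv_rep a b u c p q -> bv_rep a b v d r s ->
  exists P Q : bmeasure,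
  [/\ bv_rep a b (fun x => (1 - t) * u x + t * v x) ((1 - t) * c + t * d) P Q &
   forall g, {within `[a, b], continuous g} -> (forall x, a <= x <= b -> 0 <= g x) ->
   \int[P]_(x in `]a, b[) g x + \int[Q]_(x in `]a, b[) g x =
   (1 - t) * (\int[p]_(x in `]a, b[) g x + \int[q]_(x in `]a, b[) g x) +
   t * (\int[r]_(x in `]a, b[) g x + \int[s]_(x in `]a, b[) g x)].
Proof.
move=> /andP[t0 t1] [mu_u pc qc uE] [mv rc sc vE].
have t1' : 0 <= 1 - t by rewrite subr_ge0.
pose T := NngNum t0; pose T' := NngNum t1'.
exists (fmeasure_add (fmeasure_scale T' p) (fmeasure_scale T r)).
exists (fmeasure_add (fmeasure_scale T' q) (fmeasure_scale T s)).
split; last first.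
  by move=> g cg g0; rewrite !Rintegral_fmeasure_add// !Rintegral_fmeasure_scale//=; lra.
split.
- by apply: measurable_funD; apply: measurable_funM.
- by apply: concentrated_add; exact: concentrated_scale.
- by apply: concentrated_add; exact: concentrated_scale.
- refine (@ae2S _ _ _ mu _ _ _ _ uE vE) => x ux vx xab.
  by rewrite ux// vx// !cumul_add !cumul_scale/=; lra.
Qed.

(** Combining the Jordan parts of [u] and [v] gives a representation of the combination in which
    cancellation may occur, hence an inequality. *)
Lemma BV_conv a b u v t : a < b -> 0 <= t <= 1 -> BV a b u -> BV a b v ->
  BV a b (fun x => (1 - t) * u x + t * v x) /\
  forall alpha, {within `[a, b], continuous alpha} ->
    (forall x, a <= x <= b -> 0 <= alpha x) ->
    weighted_variation a b alpha (fun x => (1 - t) * u x + t * v x) <=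
    (1 - t) * weighted_variation a b alpha u + t * weighted_variation a b alpha v.
Proof.
move=> ab t01 /(BV_bv_rep ab)[c [p [q [_ [urep _ _ _ uD]]]]].
move=> /(BV_bv_rep ab)[d [r [s [_ [vrep _ _ _ vD]]]]].
have [P [Q [wrep PQ]]] := bv_rep_conv t01 urep vrep.
split=> [|alpha ca a0]; first exact: bv_rep_BV wrep.
apply: le_trans (weighted_variation_le ab wrep ca a0) _.
by rewrite PQ// (weighted_variationE uD ca) (weighted_variationE vD ca).
Qed.

Lemma BV_integrable_mulB a b f u v w : a < b -> BV a b f -> BV a b u -> BV a b v ->
  BV a b w -> mu.-integrable `]a, b[ (EFin \o (fun x => (f x - u x) * (v x - w x))).
Proof.
move=> ab fBV uBV vBV wBV.
rewrite (_ : (fun x => _) = fun x => (f x * v x - f x * w x) - (u x * v x - u x * w x)).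
  by apply: integrable_realB => //; apply: integrable_realB => //; exact: BV_integrableM.
by apply/funext => x; lra.
Qed.

(** Minimality is required along the segment from [u] to [v] only, so the lemma serves minimizers
    with and without a constraint on the variation. The quadratic term of the expansion in [t]
    disappears after division by [t]. *)
Lemma variational_inequality a b f alpha u v : a < b -> BV a b f -> BV a b u -> BV a b v ->
  {within `[a, b], continuous alpha} -> (forall x, a <= x <= b -> 0 <= alpha x) ->
  (forall t, 0 <= t <= 1 ->
    energy a b f alpha u <= energy a b f alpha (fun x => (1 - t) * u x + t * v x)) ->
  \int[mu]_(x in `]a, b[) ((f x - u x) * (v x - u x)) <=
  weighted_variation a b alpha v - weighted_variation a b alpha u.
Proof.
move=> ab fBV uBV vBV ca a0 umin.
set I := Rintegral _ _ _; set D := _ - _.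
pose Q := \int[mu]_(x in `]a, b[) ((v x - u x) * (v x - u x)).
have Q0 : 0 <= Q by apply: Rintegral_ge0 => x _; rewrite -expr2 sqr_ge0.
have fidE t : fidelity a b f (fun x => (1 - t) * u x + t * v x) =
    fidelity a b f u - 2 * t * I + t ^+ 2 * Q.
  have i1 := BV_integrable_sqB ab fBV uBV.
  have i2 := BV_integrable_mulB ab fBV uBV vBV uBV.
  have i3 := BV_integrable_mulB ab vBV uBV vBV uBV.
  have i2' : mu.-integrable `]a, b[ (EFin \o (fun x => 2 * t * ((f x - u x) * (v x - u x)))).
    exact: integrable_realZl.
  have i3' : mu.-integrable `]a, b[ (EFin \o (fun x => t ^+ 2 * ((v x - u x) * (v x - u x)))).
    exact: integrable_realZl.
  rewrite /I /Q -!RintegralZl// /fidelity -RintegralB// -RintegralD//; last exact: integrable_realB.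
  by apply: eq_Rintegral => x _; lra.
have arith (F i q wu wv w t : R) : w <= (1 - t) * wu + t * wv ->
    2^-1 * F + wu <= 2^-1 * (F - 2 * t * i + t ^+ 2 * q) + w ->
    t * i <= t * (wv - wu + t * q / 2).
  by clear; lra.
have step t : 0 < t <= 1 -> I <= D + t * Q / 2.
  move=> /andP[t0 t1]; have t01 : 0 <= t <= 1 by rewrite ltW.
  have [_ /(_ _ ca a0) tvw] := BV_conv ab t01 uBV vBV.
  have := umin t t01; rewrite /energy fidE => /(arith _ _ _ _ _ _ _ tvw).
  by rewrite (ler_pM2l t0).
rewrite leNgt; apply/negP => DI.
(* Chosen so that [t * Q / 2 < I - D], which contradicts [step]; the [+ 1] allows [Q = 0]. *)
pose t := Num.min 1 ((I - D) / (Q + 1)).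
have Q1 : 0 < Q + 1 by rewrite ltr_wpDl.
have t0 : 0 < t by rewrite lt_min ltr01 divr_gt0// subr_gt0.
have t1 : t <= 1 by rewrite ge_min lexx.
have tQ : t * (Q + 1) <= I - D by rewrite -ler_pdivlMr// ge_min lexx orbT.
have := step t; rewrite t0 t1 => /(_ isT).
have tQ0 : 0 <= t * Q by rewrite mulr_ge0// ltW.
by move: tQ DI t0 tQ0; clear; lra.
Qed.

End convexity.

Section total_variation_bound.
Context {R : realType}.
Notation mu := (@lebesgue_measure R).
Notation bmeasure := {finite_measure set (measurableTypeR R) -> \bar R}.
Implicit Types (m : bmeasure) (a b c d t x y M N : R) (f g h u v alpha : R -> R).

Lemma continuous_tail b h N : measurable_fun setT h -> (forall x, `|h x| <= N) ->
  continuous (tail b h).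
Proof.
move=> mh hN.
have N0 : 0 <= N by exact: le_trans (hN 0).
have tail_ge s : b <= s -> tail b h s = 0.
  by move=> bs; rewrite /tail set_itv_ge ?Rintegral_set0// bnd_simp -leNgt.
have lip s t : s <= t -> `|tail b h s - tail b h t| <= N * (t - s).
  move=> st; have [tb|/ltW bt] := leP t b; first by apply: (tail_lip mh hN); rewrite st.
  rewrite (tail_ge t bt); have [sb|/ltW bs] := leP s b; last first.
    by rewrite tail_ge// subrr normr0 mulr_ge0// subr_ge0.
  rewrite -(tail_ge b (lexx b)); apply: le_trans (tail_lip mh hN _) _; first by rewrite sb lexx.
  by rewrite ler_wpM2l// lerD2r.
move=> x; apply/cvgrPdist_le => e e0; near=> y.
have xy : `|x - y| <= e / (N + 1).
  near: y; apply/nbhs_ballP; exists (e / (N + 1)) => /=; first by rewrite divr_gt0// ltr_wpDl.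
  by move=> y /ltW.
apply: (@le_trans _ _ (N * `|x - y|)).
  have [xy'|/ltW yx] := leP x y.
    have -> : `|x - y| = y - x by rewrite distrC ger0_norm ?subr_ge0.
    exact: lip.
  have -> : `|x - y| = x - y by rewrite ger0_norm ?subr_ge0.
  by rewrite distrC; exact: lip.
rewrite ler_pdivlMr ?ltr_wpDl// in xy; apply: le_trans xy.
by rewrite mulrC ler_wpM2l// lerDl.
Unshelve. all: by end_near. Qed.

Lemma Rintegral_cumul a b m h N : concentrated m `]a, b[%classic ->
  measurable_fun setT h -> (forall x, `|h x| <= N) ->
  \int[mu]_(x in `]a, b[) (h x * cumul m x) = \int[m]_(t in `]a, b[) tail b h t.
Proof.
move=> mc mh hN; rewrite /Rintegral integral_cumul//; last first.
  apply: (@integrable_bounded _ _ _ _ _ _ N) => //; first exact: itv_finite.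
  exact: measurable_funTS.
congr fine; apply: eq_integral => t _; rewrite /tail EFin_Rintegral//.
apply: (@integrable_bounded _ _ _ _ _ _ N) => //; first exact: co_itv_finite.
exact: measurable_funTS.
Qed.

Lemma concentrated_restr m (D B : set (measurableTypeR R)) (mB : measurable B) :
  concentrated m D -> measurable D -> concentrated (fmeasure_restr m mB) D.
Proof.
move=> mc mD; apply/eqP; rewrite eq_le measure_ge0 andbT -[leRHS]mc.
have mDC : measurable (~` D) by apply: measurableC.
have mI : measurable (~` D `&` B) by apply: measurableI.
by rewrite fmeasure_restrE; apply: le_measure; rewrite ?inE//; exact: subIsetl.
Qed.

(* First-order optimality against removing the part of [m] lying on [B]. *)
Lemma null_off_superlevel a b h N m alpha : a < b ->
  measurable_fun setT h -> (forall x, `|h x| <= N) ->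
  concentrated m `]a, b[%classic -> {within `[a, b], continuous alpha} ->
  (forall x, a <= x <= b -> 0 < alpha x) ->
  (forall (B : set (measurableTypeR R)) (mB : measurable B),
    \int[fmeasure_restr m mB]_(x in `]a, b[) alpha x <=
    \int[mu]_(x in `]a, b[) (h x * cumul (fmeasure_restr m mB) x)) ->
  m (~` tail_superlevel a b h) = 0%E.
Proof.
move=> ab mh hN mc ca a0 opt; set G := tail_superlevel a b h.
have mG : measurable (G : set (measurableTypeR R)).
  by apply: open_measurable; exact: open_tail_superlevel mh hN a.
have mGC : measurable (~` G : set (measurableTypeR R)) by apply: measurableC.
have mab : measurable (`]a, b[%classic : set (measurableTypeR R)) by exact: measurable_itv.
pose m' : bmeasure := fmeasure_restr m mGC.
have m'c : concentrated m' `]a, b[%classic by exact: concentrated_restr.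
have m'G : m' G = 0%E by rewrite /m' fmeasure_restrE setICr measure0.
(* By Fubini the right-hand side becomes the [m']-integral of the tail, which is nonpositive where
   [m'] lives. *)
have := opt _ mGC; rewrite -/m' (Rintegral_cumul m'c mh hN) => le_tail.
have itail : m'.-integrable `]a, b[ (EFin \o tail b h).
  by apply: within_continuous_integrable; apply: continuous_subspaceT; exact: continuous_tail mh hN.
have i0 (r : R) : m'.-integrable `]a, b[ (EFin \o cst r).
  by apply: within_continuous_integrable; apply: continuous_subspaceT; exact: cst_continuous.
have tail_le0 : \int[m']_(t in `]a, b[) tail b h t <= 0.
  have -> : 0 = \int[m']_(t in `]a, b[) cst 0 t by rewrite Rintegral_cst// mul0r.
  apply: le_Rintegral_ae => //.
  exists G; split => //.
  move=> t /= /not_implyP[]; rewrite in_itv/= => tab tpos; split => //.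
  by rewrite ltNge; apply/negP.
(* The continuous positive weight has a positive minimum [dl], so [dl] times the mass of [m'] is at
   most [0]. *)
have [dl dl0 dle] : exists2 e, 0 < e & forall x, a <= x <= b -> e <= alpha x.
  have [l' l'ab la'] := EVT_min (ltW ab) ca.
  by exists (alpha l'); [apply: a0; move: l'ab; rewrite in_itv|move=> x xab; apply: la'; rewrite in_itv].
have : dl * fine (m' `]a, b[%classic) <= 0.
  apply: le_trans tail_le0; apply: le_trans le_tail.
  rewrite -Rintegral_cst//; apply: le_Rintegral => //.
  - exact: i0.
  - exact: within_continuous_integrable.
  - by move=> x /=; rewrite in_itv/= => xab; apply: dle; lra.
rewrite pmulr_rle0// => m'0.
have m'ab0 : m' `]a, b[%classic = 0%E.
  apply/eqP; rewrite eq_le measure_ge0 andbT.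
  by rewrite -(fineK (fin_num_measure m' _ mab)) lee_fin.
have : m' setT = 0%E by rewrite (concentratedI m'c)// setTI.
by rewrite /m' fmeasure_restrE setTI.
Qed.

Lemma measure_split m (B : set (measurableTypeR R)) (mB : measurable B)
    (mBC : measurable (~` B)) A : measurable A ->
  m A = fmeasure_add (fmeasure_restr m mB) (fmeasure_restr m mBC) A.
Proof.
move=> mA; rewrite [RHS]fmeasure_addE !fmeasure_restrE (measureDI m mA mB) addeC.
by rewrite setDE.
Qed.

End total_variation_bound.

Section constrained_minimizer_bound.
Context {R : realType}.
Notation mu := (@lebesgue_measure R).
Notation bmeasure := {finite_measure set (measurableTypeR R) -> \bar R}.
Implicit Types (m : bmeasure) (a b c d t x y M N : R) (f g h u v alpha : R -> R).

(* Keeps [//] from unfolding these while comparing distinct competitors. *)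
Local Opaque weighted_variation energy BV bv_rep.

Lemma cst_within_continuous a b (r : R) : {within `[a, b], continuous (cst r : R -> R)}.
Proof. by apply: continuous_subspaceT; exact: cst_continuous. Qed.

Lemma total_variation_le_conv a b M u v t : a < b -> 0 <= t <= 1 ->
  total_variation_le a b M u -> total_variation_le a b M v ->
  total_variation_le a b M (fun x => (1 - t) * u x + t * v x).
Proof.
move=> ab t01 [uBV uM] [vBV vM]; have [wBV wv] := BV_conv ab t01 uBV vBV; split; first exact: wBV.
have wle := wv (cst 1) (@cst_within_continuous a b 1) (fun _ _ => ler01).
apply: (le_trans wle); move: uM vM; clear -t01 => uM vM.
have /andP[t0 t1] := t01.
have t1' : 0 <= 1 - t by rewrite subr_ge0.
apply: (@le_trans _ _ ((1 - t) * M + t * M)); last by rewrite -mulrDl subrK mul1r.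
exact: lerD (ler_wpM2l t1' uM) (ler_wpM2l t0 vM).
Qed.

(** The competitor drops [p2] and [q2] from the derivative and shifts the constant by [d]. The first
    factor of the integrand is [f - u], the second is the competitor minus [u]. One statement covers
    shifts and removals from either Jordan part. *)
Lemma constrained_first_order a b f alpha M u cf pf qf c p q d (p1 p2 q1 q2 : bmeasure) :
  a < b -> BV a b f -> bv_rep a b f cf pf qf -> bv_rep a b u c p q ->
  (forall A, measurable A -> Dvariation a b u A = (p A + q A)%E) ->
  {within `[a, b], continuous alpha} -> (forall x, a <= x <= b -> 0 <= alpha x) ->
  total_variation_le a b M u ->
  (forall v, total_variation_le a b M v -> energy a b f alpha u <= energy a b f alpha v) ->
  (forall A, measurable A -> p A = fmeasure_add p1 p2 A) ->
  (forall A, measurable A -> q A = fmeasure_add q1 q2 A) ->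
  concentrated p1 `]a, b[%classic -> concentrated q1 `]a, b[%classic ->
  \int[p2]_(x in `]a, b[) alpha x + \int[q2]_(x in `]a, b[) alpha x +
  \int[mu]_(x in `]a, b[)
    ((cf - c + cumul (fmeasure_add pf q) x - cumul (fmeasure_add qf p) x) *
     (d - cumul p2 x + cumul q2 x)) <= 0.
Proof.
move=> ab fBV [mf _ _ fE] urep uD ca a0 uM umin pE qE p1c q1c.
have [mu_u _ _ uE] : [/\ _, _, _ & _] := urep; have [uBV uMle] := uM.
pose w x := c + d + cumul p1 x - cumul q1 x.
have wrep : bv_rep a b w (c + d) p1 q1.
  by split => //; [exact: measurable_bv_fun|exact: aeW].
have wBV := bv_rep_BV ab wrep.
have pI g : {within `[a, b], continuous g} -> \int[p]_(x in `]a, b[) g x =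
    \int[p1]_(x in `]a, b[) g x + \int[p2]_(x in `]a, b[) g x.
  move=> cg; rewrite -Rintegral_fmeasure_add//; congr fine.
  by apply: eq_measure_integral => A mA _; exact: pE.
have qI g : {within `[a, b], continuous g} -> \int[q]_(x in `]a, b[) g x =
    \int[q1]_(x in `]a, b[) g x + \int[q2]_(x in `]a, b[) g x.
  move=> cg; rewrite -Rintegral_fmeasure_add//; congr fine.
  by apply: eq_measure_integral => A mA _; exact: qE.
have pcE x : cumul p x = cumul p1 x + cumul p2 x.
  by rewrite -cumul_add; congr fine; exact: pE.
have qcE x : cumul q x = cumul q1 x + cumul q2 x.
  by rewrite -cumul_add; congr fine; exact: qE.
have wv_le g : {within `[a, b], continuous g} -> (forall x, a <= x <= b -> 0 <= g x) ->
    weighted_variation a b g w <= weighted_variation a b g u -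
    (\int[p2]_(x in `]a, b[) g x + \int[q2]_(x in `]a, b[) g x).
  move=> cg g0; apply: le_trans (weighted_variation_le ab wrep cg g0) _.
  by rewrite (weighted_variationE uD cg) pI// qI//; lra.
have c1 := @cst_within_continuous a b 1.
have pos m : 0 <= \int[m]_(x in `]a, b[) cst 1 x by apply: Rintegral_ge0.
(* The competitor stays admissible because removal does not increase the variation for the weight
   [1]. *)
have wM : total_variation_le a b M w.
  split; first exact: wBV.
  apply: le_trans uMle; apply: (le_trans (wv_le _ c1 (fun _ _ => ler01))).
  by rewrite gerBl addr_ge0 ?pos.
have arith (W U S I : R) : W <= U - S -> I <= W - U -> S + I <= 0 by clear; lra.
apply: (arith _ _ _ _ (wv_le _ ca a0)).
have VI := @variational_inequality _ a b f alpha u w ab fBV uBV wBV ca a0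
  (fun t t01 => umin _ (total_variation_le_conv ab t01 uM wM)).
apply: le_trans VI; rewrite le_eqVlt; apply/orP; left; apply/eqP/esym.
apply: eq_Rintegral_ae => //.
- apply: measurable_funM; apply: measurable_funB => //; exact: measurable_bv_fun.
- apply: measurable_funM; first exact: measurable_bv_fun.
  by apply: measurable_funTS; apply: measurable_funD; [apply: measurable_funB => //|];
    exact: measurable_cumul.
- refine (@ae2S _ _ _ mu _ _ _ _ fE uE) => x fx ux xab.
  by rewrite fx// ux// /w !cumul_add pcE qcE; lra.
Qed.

Lemma constrained_minimizer_variation_le a b f alpha M u : a < b -> BV a b f ->
  {within `[a, b], continuous alpha} -> (forall x, a <= x <= b -> 0 < alpha x) ->
  total_variation_le a b M u ->
  (forall v, total_variation_le a b M v -> energy a b f alpha u <= energy a b f alpha v) ->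
  weighted_variation a b (cst 1) u <= weighted_variation a b (cst 1) f.
Proof.
move=> ab fBV ca apos uM umin.
have flip (x y z w : R) : x - y + z - w = - (y - x + w - z) by clear; lra.
have neg (x y : R) : x * (0 - y + 0) = - 1 * (x * y) by clear; lra.
have pos (x y : R) : x * (0 - 0 + y) = -1 * (- x * y) by clear; lra.
have a0 x : a <= x <= b -> 0 <= alpha x by move=> /apos/ltW.
have [cf [pf [qf [_ [frep _ _ _ fD]]]]] := BV_bv_rep ab fBV.
have [c [p [q [_ [urep _ _ _ uD]]]]] := BV_bv_rep ab uM.1.
have [_ pfc qfc _] := frep; have [_ pc qc _] := urep.
have c1 := @cst_within_continuous a b 1.
pose z : bmeasure := mzero.
have zc : concentrated z `]a, b[%classic by [].
have cz x : cumul z x = 0 by [].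
have zI g : \int[z]_(x in `]a, b[) g x = 0 by rewrite /Rintegral integral_measure_zero.
have addz m A : m A = fmeasure_add m z A.
  by rewrite [RHS]fmeasure_addE [X in (_ + X)%E](_ : _ = 0%E) ?adde0.
(* [f - u] written with [pf + q] and [qf + p] as its two measures; [k] is its opposite in the same
   form, so that [superlevel_comparison] applies to both signs. *)
pose h x := cf - c + cumul (fmeasure_add pf q) x - cumul (fmeasure_add qf p) x.
pose k x := c - cf + cumul (fmeasure_add qf p) x - cumul (fmeasure_add pf q) x.
have kh x : k x = - h x by exact: flip.
have mh : measurable_fun setT h by exact: measurable_bv_fun.
have mk : measurable_fun setT k by exact: measurable_bv_fun.
have [N hN] : exists N, forall x, `|h x| <= N by eexists => x; exact: bv_rep_bounded.
have kN x : `|k x| <= N by rewrite kh normrN.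
have ih : mu.-integrable `]a, b[ (EFin \o h).
  apply: (@integrable_bounded _ _ _ _ _ _ N) => //; first exact: itv_finite.
  exact: measurable_funTS.
have first_order d p1 p2 q1 q2 := @constrained_first_order a b f alpha M u cf pf qf c p q
  d p1 p2 q1 q2 ab fBV frep urep uD ca a0 uM umin.
have inth : \int[mu]_(x in `]a, b[) h x = 0.
  (* Nothing is removed and the constant alone moves; [d = 1] and [d = -1] together give mean
     zero. *)
  have shift d : d * \int[mu]_(x in `]a, b[) h x <= 0.
    have := first_order d p z q z (fun A _ => addz p A) (fun A _ => addz q A) pc qc.
    rewrite !zI add0r add0r; under eq_Rintegral do rewrite !cz subr0 addr0 mulrC.
    by rewrite RintegralZl.
  apply/eqP; rewrite eq_le; have := shift 1; have := shift (-1).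
  by rewrite mul1r mulN1r oppr_le0 => -> ->.
have tail_a : tail b h a = 0.
  by rewrite -inth /tail /Rintegral integral_itv_obnd_cbnd//; apply/measurable_EFinP; exact: measurable_funTS.
have tail_k t : tail b k t = - tail b h t.
  rewrite /tail -mulN1r -RintegralZl//; last first.
    apply: (@integrable_bounded _ _ _ _ _ _ N) => //; first exact: co_itv_finite.
    exact: measurable_funTS.
  by apply: eq_Rintegral => x _; rewrite kh mulN1r.
(* The part of [p] on an arbitrary [B] is removed, which is the hypothesis of [null_off_superlevel];
   for [q] the sign of [h] is reversed. *)
have pG : p (~` tail_superlevel a b h) = 0%E.
  apply: (null_off_superlevel ab mh hN pc ca apos) => B mB.
  have mBC : measurable (~` B) by apply: measurableC.
  have := first_order 0 (fmeasure_restr p mBC) (fmeasure_restr p mB) q z _ (fun A _ => addz q A) _ qc.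
  rewrite zI addr0 => H; rewrite -subr_le0; move: H.
  have -> : \int[mu]_(x in `]a, b[) (h x * (0 - cumul (fmeasure_restr p mB) x + cumul z x)) =
      - \int[mu]_(x in `]a, b[) (h x * cumul (fmeasure_restr p mB) x).
    rewrite -mulN1r -RintegralZl//.
      by apply: eq_Rintegral => x _; rewrite cz; lra.
    apply: (@integrable_realMbounded _ _ _ _ _ _ _ (fine (fmeasure_restr p mB setT))) => //.
      by apply: measurable_funTS; exact: measurable_cumul.
    by move=> x _; exact: cumul_norm_le.
  apply; last exact: concentrated_restr.
  by move=> A mA; rewrite (measure_split p mB mBC)// !fmeasure_addE addeC.
have qG : q (~` tail_superlevel a b k) = 0%E.
  apply: (null_off_superlevel ab mk kN qc ca apos) => B mB.
  have mBC : measurable (~` B) by apply: measurableC.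
  have := first_order 0 p z (fmeasure_restr q mBC) (fmeasure_restr q mB) (fun A _ => addz p A) _ pc _.
  rewrite zI add0r => H; rewrite -subr_le0; move: H.
  have -> : \int[mu]_(x in `]a, b[) (h x * (0 - cumul z x + cumul (fmeasure_restr q mB) x)) =
      - \int[mu]_(x in `]a, b[) (k x * cumul (fmeasure_restr q mB) x).
    rewrite -mulN1r -RintegralZl//.
      by apply: eq_Rintegral => x _; rewrite cz kh; lra.
    apply: (@integrable_realMbounded _ _ _ _ _ _ _ (fine (fmeasure_restr q mB setT))) => //.
    - rewrite (_ : k = fun x => -1 * h x); first exact: integrable_realZl.
      by apply/funext => x; rewrite kh mulN1r.
    - by apply: measurable_funTS; exact: measurable_cumul.
    - by move=> x _; exact: cumul_norm_le.
  apply; last exact: concentrated_restr.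
  by move=> A mA; rewrite (measure_split q mB mBC)// !fmeasure_addE addeC.
have mG g : measurable_fun setT g -> (forall x, `|g x| <= N) ->
    measurable (tail_superlevel a b g : set (measurableTypeR R)).
  by move=> mg gN; apply: open_measurable; exact: open_tail_superlevel mg gN a.
have hk : tail_superlevel a b k `<=` ~` tail_superlevel a b h.
  by move=> t [_ kt] [_ ht]; move: kt; rewrite tail_k oppr_gt0 ltNge (ltW ht).
have total m G : measurable (G : set (measurableTypeR R)) -> m (~` G) = 0%E -> m setT = m G.
  move=> mG' mG0; rewrite -[in RHS](adde0 (m G)) -mG0 -measureU ?setUv ?setICr//.
  exact: measurableC.
have pk : p (tail_superlevel a b k) = 0%E.
  apply/eqP; rewrite eq_le measure_ge0 andbT -pG; apply: le_measure => //; rewrite inE.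
    exact: mG.
  by apply: measurableC; exact: mG.
have qh : q (tail_superlevel a b h) = 0%E.
  apply/eqP; rewrite eq_le measure_ge0 andbT -qG; apply: le_measure; rewrite ?inE.
  - exact: mG.
  - by apply: measurableC; exact: mG.
  - by move=> t ht kt; exact: hk kt ht.
(* The superlevel set of [h] carries all of [p] and none of [q], so the comparison of [qf + p] with
   [pf + q] there reduces to [p] against [pf]. *)
have ple : (p setT <= pf setT)%E.
  rewrite (total p _ (mG h mh hN) pG).
  have ha : tail b h a <= 0 by rewrite tail_a.
  have := @superlevel_comparison _ (fmeasure_add pf q) (fmeasure_add qf p) a b (cf - c) ha.
  rewrite -/h !fmeasure_addE qh adde0 => H.
  apply: (@le_trans _ _ (pf (tail_superlevel a b h))).
    by apply: le_trans H; rewrite leeDr.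
  by apply: le_measure; rewrite ?inE//; exact: mG.
have qle : (q setT <= qf setT)%E.
  rewrite (total q _ (mG k mk kN) qG).
  have ka : tail b k a <= 0 by rewrite tail_k tail_a oppr0.
  have := @superlevel_comparison _ (fmeasure_add qf p) (fmeasure_add pf q) a b (c - cf) ka.
  rewrite -/k !fmeasure_addE pk adde0 => H.
  apply: (@le_trans _ _ (qf (tail_superlevel a b k))).
    by apply: le_trans H; rewrite leeDr.
  by apply: le_measure; rewrite ?inE//; exact: mG.
rewrite (weighted_variationE uD c1) (weighted_variationE fD c1) !total_massE//.
by apply: lerD; apply: fine_le => //; exact: fin_num_measure.
Qed.

End constrained_minimizer_bound.

(** * Minimizers without constraint and their uniqueness *)

Section minimisation.
Context {R : realType}.
Notation mu := (@lebesgue_measure R).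
Notation bmeasure := {finite_measure set (measurableTypeR R) -> \bar R}.
Implicit Types (m : bmeasure) (a b e x : R) (f g u v w alpha beta : R -> R).

Lemma weighted_variation_mono a b u alpha beta : a < b -> BV a b u ->
  {within `[a, b], continuous alpha} -> {within `[a, b], continuous beta} ->
  (forall x, a <= x <= b -> alpha x <= beta x) ->
  weighted_variation a b alpha u <= weighted_variation a b beta u.
Proof.
move=> ab uBV ca cb le_ab; have [c [p [q [_ [_ _ _ _ uD]]]]] := BV_bv_rep ab uBV.
rewrite (weighted_variationE uD ca) (weighted_variationE uD cb).
have ia m := within_continuous_integrable m ca.
have ib m := within_continuous_integrable m cb.
have le m : \int[m]_(x in `]a, b[) alpha x <= \int[m]_(x in `]a, b[) beta x.
  apply: (le_Rintegral _ (ia m) (ib m)); first exact: measurable_itv.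
  by move=> x /=; rewrite in_itv/= => /andP[/ltW ax /ltW xb]; rewrite le_ab// ax.
exact: lerD.
Qed.

Lemma within_continuousD_cst a b alpha e : {within `[a, b], continuous alpha} ->
  {within `[a, b], continuous (fun x => alpha x + e)}.
Proof. by move=> ca x; apply: cvgD; [exact: ca|exact: cvg_cst]. Qed.

Lemma weighted_variationD_cst a b u alpha e : a < b -> BV a b u ->
  {within `[a, b], continuous alpha} ->
  weighted_variation a b (fun x => alpha x + e) u =
  weighted_variation a b alpha u + e * weighted_variation a b (cst 1) u.
Proof.
move=> ab uBV ca; have [c [p [q [_ [_ _ _ _ uD]]]]] := BV_bv_rep ab uBV.
have c1 := @cst_within_continuous R a b 1.
have ce := @within_continuousD_cst a b alpha e ca.
rewrite (weighted_variationE uD ca) (weighted_variationE uD c1) (weighted_variationE uD ce).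
have split m : \int[m]_(x in `]a, b[) (alpha x + e) =
    \int[m]_(x in `]a, b[) alpha x + e * \int[m]_(x in `]a, b[) cst 1 x.
  have i1 := within_continuous_integrable m c1.
  rewrite -RintegralZl// -RintegralD//.
  - by apply: eq_Rintegral => x _; rewrite /= mulr1.
  - exact: within_continuous_integrable.
  - exact: integrable_realZl.
by rewrite !split mulrDr addrACA.
Qed.

Lemma energyD_cst a b f u alpha e : a < b -> BV a b u ->
  {within `[a, b], continuous alpha} ->
  energy a b f (fun x => alpha x + e) u =
  energy a b f alpha u + e * weighted_variation a b (cst 1) u.
Proof. by move=> ab uBV ca; rewrite /energy weighted_variationD_cst// addrA. Qed.

Lemma energy_mono a b f u alpha beta : a < b -> BV a b u ->
  {within `[a, b], continuous alpha} -> {within `[a, b], continuous beta} ->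
  (forall x, a <= x <= b -> alpha x <= beta x) ->
  energy a b f alpha u <= energy a b f beta u.
Proof. by move=> ab uBV ca cb le_ab; rewrite lerD2l weighted_variation_mono. Qed.

Local Opaque weighted_variation energy BV bv_rep.

(** A competitor [v] of large variation is handled through the minimizer [w] for a bound [M] that
    admits [v]: the variation of [w] is again at most that of [f], so [w] is admissible for [u]. *)
Lemma exists_minimizer_pos a b f alpha : a < b -> BV a b f ->
  {within `[a, b], continuous alpha} -> (forall x, a <= x <= b -> 0 < alpha x) ->
  exists2 u, total_variation_le a b (weighted_variation a b (cst 1) f) u &
    forall v, BV a b v -> energy a b f alpha u <= energy a b f alpha v.
Proof.
move=> ab fBV ca apos; set T := weighted_variation a b (cst 1) f.
have a0 x : a <= x <= b -> 0 <= alpha x by move=> /apos/ltW.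
have T0 : 0 <= T by exact: weighted_variation_ge0.
have [u uT umin] := exists_constrained_minimizer ab fBV T0 ca a0.
exists u; first exact: uT.
move=> v vBV; have [M [M0 TM vM]] : exists M, [/\ 0 <= M, T <= M & weighted_variation a b (cst 1) v <= M].
  move: T T0 (weighted_variation _ _ _ v) {umin uT} => T T0 V.
  by exists (Num.max T V); rewrite !le_max T0 !lexx orbT.
have [w wM wmin] := exists_constrained_minimizer ab fBV M0 ca a0.
have wT := constrained_minimizer_variation_le ab fBV ca apos wM wmin.
apply: (@le_trans _ _ (energy a b f alpha w)); first by apply: umin; split; [exact: wM.1|exact: wT].
by apply: wmin; split; [exact: vBV|exact: vM].
Qed.

(** With [w] minimizing for the weight [alpha + d], the energy of [u] is at most that of [w], which
    is at most the perturbed energy of [v]; this exceeds the energy of [v] by [d] times its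
    variation, at most [e]. The first inequality holds because the variation of [w] is bounded by
    that of [f] for every [d]. *)
Lemma exists_minimizer a b f alpha : a < b -> BV a b f ->
  {within `[a, b], continuous alpha} -> (forall x, a <= x <= b -> 0 <= alpha x) ->
  exists2 u, BV a b u & forall v, BV a b v -> energy a b f alpha u <= energy a b f alpha v.
Proof.
move=> ab fBV ca a0; set T := weighted_variation a b (cst 1) f.
have T0 : 0 <= T by exact: weighted_variation_ge0.
have [u uT umin] := exists_constrained_minimizer ab fBV T0 ca a0.
exists u; first exact: uT.1.
move=> v vBV.
have V0 : 0 <= weighted_variation a b (cst 1) v by apply: weighted_variation_ge0.
have arith (x1 x2 x3 y1 y2 r : R) :
    x1 <= x2 -> x2 + y1 <= x3 + y2 -> 0 <= y1 -> y2 <= r -> x1 <= x3 + r by clear; lra.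
apply/ler_addgt0Pr => e e0.
pose d := e / (weighted_variation a b (cst 1) v + 1).
have V1 : 0 < weighted_variation a b (cst 1) v + 1 by exact: ltr_wpDl.
have d0 : 0 < d by rewrite divr_gt0.
have dV : d * weighted_variation a b (cst 1) v <= e.
  by rewrite /d mulrAC ler_pdivrMr// ler_pM2l// lerDl.
have cd := @within_continuousD_cst a b alpha d ca.
have [w wT wmin] := exists_minimizer_pos ab fBV cd (fun x xab => ltr_wpDl (a0 x xab) d0).
have uw := umin _ wT; have wv := wmin _ vBV.
have W0 : 0 <= weighted_variation a b (cst 1) w by apply: weighted_variation_ge0.
have dW : 0 <= d * weighted_variation a b (cst 1) w by rewrite mulr_ge0// ltW.
move: uw wv; rewrite (energyD_cst f d ab wT.1 ca) (energyD_cst f d ab vBV ca).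
by move=> uw wv; exact: arith uw wv dW dV.
Qed.

(** In the sum of the two variational inequalities the weighted variations cancel and the integral
    of [(v - u) ^+ 2] remains. *)
Lemma minimizer_unique a b f alpha u v : a < b -> BV a b f ->
  {within `[a, b], continuous alpha} -> (forall x, a <= x <= b -> 0 <= alpha x) ->
  BV a b u -> BV a b v ->
  (forall w, BV a b w -> energy a b f alpha u <= energy a b f alpha w) ->
  (forall w, BV a b w -> energy a b f alpha v <= energy a b f alpha w) ->
  ae_eq mu `]a, b[%classic v u.
Proof.
move=> ab fBV ca a0 uBV vBV umin vmin.
have arith (x y p q : R) : x <= p - q -> y <= q - p -> x + y <= 0 by clear; lra.
have sqE (x y z : R) : (y - x) ^+ 2 = (z - x) * (y - x) + (z - y) * (x - y) by clear; lra.
have uv := variational_inequality ab fBV uBV vBV ca a0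
  (fun t t01 => umin _ (BV_conv ab t01 uBV vBV).1).
have vu := variational_inequality ab fBV vBV uBV ca a0
  (fun t t01 => vmin _ (BV_conv ab t01 vBV uBV).1).
have isq := BV_integrable_sqB ab vBV uBV.
have sq_le0 : \int[mu]_(x in `]a, b[) ((v x - u x) ^+ 2) <= 0.
  rewrite [leLHS](_ : _ = \int[mu]_(x in `]a, b[) ((f x - u x) * (v x - u x)) +
      \int[mu]_(x in `]a, b[) ((f x - v x) * (u x - v x))).
    exact: arith uv vu.
  rewrite -RintegralD//; try exact: BV_integrable_mulB.
  by apply: eq_Rintegral => x _; exact: sqE.
have sq0 : \int[mu]_(x in `]a, b[) ((v x - u x) ^+ 2) = 0.
  by apply/eqP; rewrite eq_le sq_le0; apply: Rintegral_ge0 => x _; exact: sqr_ge0.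
have abs0 : (\int[mu]_(x in `]a, b[) `|((v x - u x) ^+ 2)%:E| = 0)%E.
  rewrite -[RHS]/(0%:E) -sq0 EFin_Rintegral//; apply: eq_integral => x _.
  by rewrite /= ger0_norm// sqr_ge0.
have mab : measurable (`]a, b[%classic : set R) by exact: measurable_itv.
have H := (ae_eq_integral_abs mu mab (measurable_int _ isq)).1 abs0.
refine (@aeS _ _ _ mu _ _ _ H) => x vux xab.
by apply/eqP; have /eqP := vux xab; rewrite eqe sqrf_eq0 subr_eq0.
Qed.

Lemma weightedTV_minimizerP a b f alpha u : a < b -> BV a b f ->
  {within `[a, b], continuous alpha} ->
  minimizer (BV a b) (weightedTV_functional a b f alpha) u <->
  BV a b u /\ forall v, BV a b v -> energy a b f alpha u <= energy a b f alpha v.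
Proof.
move=> ab fBV ca; have FE w wBV := @weightedTV_functionalE _ a b f alpha w ab fBV wBV ca.
split=> -[uBV umin]; (split; first exact: uBV) => v vBV; have := umin v vBV.
  by rewrite (FE u uBV) (FE v vBV) lee_fin.
by rewrite (FE u uBV) (FE v vBV) lee_fin.
Qed.

Lemma uniform_cvg_near a b (alpha_ : nat -> R -> R) alpha e : 0 < e ->
  {uniform `[a, b]%classic, alpha_ @ \oo --> alpha} ->
  \forall n \near \oo, forall x, a <= x <= b -> `|alpha x - alpha_ n x| < e.
Proof.
move=> e0 cvg_a.
have nb : nbhs (alpha : {uniform` `[a, b]%classic -> R})
    [set g | forall x, `[a, b]%classic x -> `|alpha x - g x| < e].
  apply/uniform_nbhs; exists [set xy | `|xy.1 - xy.2| < e]; split=> //.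
  by exists e.
by have [N _ HN] := cvg_a _ nb; exists N.
Qed.

End minimisation.

Unset Implicit Arguments.

Theorem theorem5p3 (R : realType) (a b : R) (f alpha : R -> R)
  (ltab : a < b)
  (f_BV : BV a b f)
  (alpha_continuous : {within `[a, b]%classic, continuous alpha})
  (alpha_ge0 : forall x, a <= x <= b -> 0 <= alpha x) :
  exists ustar : R -> R,
    [/\ minimizer (BV a b) (weightedTV_functional a b f alpha) ustar,
        forall v, minimizer (BV a b) (weightedTV_functional a b f alpha) v ->
          ae_eq (@lebesgue_measure R) `]a, b[%classic v ustar
      & forall alpha_ : nat -> R -> R,
          (forall n, smooth_on_closure a b (alpha_ n)) ->
          (forall n x, a <= x <= b -> alpha_ n.+1 x <= alpha_ n x) ->
          {uniform `[a, b]%classic, alpha_ @ \oo --> alpha} ->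
          (forall n x, a <= x <= b -> 0 < alpha_ n x) ->
          exists m : nat -> \bar R,
            (forall n, is_minimum (BV a b)
               (weightedTV_functional a b f (alpha_ n)) (m n)) /\
            m @ \oo --> weightedTV_functional a b f alpha ustar].
Proof.
have [ustar ustarBV ustar_min] := exists_minimizer ltab f_BV alpha_continuous alpha_ge0.
exists ustar; split.
- by apply/weightedTV_minimizerP.
- move=> v /(weightedTV_minimizerP _ ltab f_BV alpha_continuous)[vBV v_min].
  exact: minimizer_unique ustar_min v_min.
move=> alpha_ smooth decr cvg_alpha pos.
have ca n : {within `[a, b]%classic, continuous (alpha_ n)} := (smooth n).1.
(* If [alpha_ n x] were below [alpha x], monotonicity would keep all later terms at least as far
   below, against convergence. *)
have le_alpha n x : a <= x <= b -> alpha x <= alpha_ n x.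
  move=> xab; rewrite leNgt; apply/negP => lt_n.
  have e0 : 0 < alpha x - alpha_ n x by rewrite subr_gt0.
  have [k _ /(_ (k + n)%N (leq_addr _ _) x xab)] := uniform_cvg_near e0 cvg_alpha.
  have : alpha_ (k + n)%N x <= alpha_ n x.
    by elim: k => // k; apply: le_trans; exact: decr.
  by rewrite ltr_norml; clear; lra.
have min_n n : exists u, BV a b u /\
    forall v, BV a b v -> energy a b f (alpha_ n) u <= energy a b f (alpha_ n) v.
  have [u uT u_min] := exists_minimizer_pos ltab f_BV (ca n) (pos n).
  by exists u; split; [exact: uT.1|exact: u_min].
have [u_ u_min] := choice min_n.
exists (fun n => weightedTV_functional a b f (alpha_ n) (u_ n)); split=> [n|].
  exists (u_ n); last exact: erefl.
  exact: ((weightedTV_minimizerP (u_ n) ltab f_BV (ca n)).2 (u_min n)).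
have -> : (fun n => weightedTV_functional a b f (alpha_ n) (u_ n)) =
    EFin \o (fun n => energy a b f (alpha_ n) (u_ n)).
  by apply/funext => n; exact: weightedTV_functionalE ltab f_BV (u_min n).1 (ca n).
rewrite (weightedTV_functionalE ltab f_BV ustarBV alpha_continuous).
apply: cvg_EFin; first exact: nearW.
apply/cvgrPdist_le => e e0.
(* Raising the weight by [d] raises the energy of [ustar] by [d * V], so closeness [e / (V + 1)] of
   the weights suffices; the [+ 1] covers [V = 0]. *)
pose V := weighted_variation a b (cst 1) ustar.
have V0 : 0 <= V by exact: weighted_variation_ge0.
have V1 : 0 < V + 1 by exact: ltr_wpDl.
have d0 : 0 < e / (V + 1) by exact: divr_gt0.
have dV : e / (V + 1) * V <= e by rewrite mulrAC ler_pdivrMr// ler_pM2l// lerDl.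
apply: filterS (uniform_cvg_near d0 cvg_alpha) => n near_n.
have lower : energy a b f alpha ustar <= energy a b f (alpha_ n) (u_ n).
  apply: le_trans (ustar_min _ (u_min n).1) _.
  exact: energy_mono ltab (u_min n).1 alpha_continuous (ca n) (le_alpha n).
have upper : energy a b f (alpha_ n) (u_ n) <= energy a b f alpha ustar + e.
  apply: le_trans ((u_min n).2 _ ustarBV) _.
  apply: (@le_trans _ _ (energy a b f (fun x => alpha x + e / (V + 1)) ustar)).
    apply: (energy_mono f ltab ustarBV (ca n)); first exact: within_continuousD_cst.
    move=> x xab; have := near_n x xab; rewrite ltr_norml => /andP[+ _].
    by rewrite ltrBrDl ltrBlDr => /ltW; rewrite addrC.
  by rewrite (energyD_cst f _ ltab ustarBV alpha_continuous) lerD2l.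
by rewrite distrC ger0_norm ?subr_ge0// lerBlDl.
Qed.
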